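(* If a finite index subgroup of Thompson's group \(F\) is isomorphic to \(\langle X\rangle\) for some geometrically proper set \(X\subseteq\operatorname{Homeo}_+(I)\), then it is isomorphic to \(F\).
   Context: \(I=[0,1]\); \(\operatorname{Homeo}_+(I)\) is the group of orientation preserving homeomorphisms of \(I\). The support of \(f\) is \(\{t\in I: tf\neq t\}\). A left (right) transition point of \(f\) is a point \(t\) not in the support of \(f\) such that for every \(\epsilon>0\), \((t,t+\epsilon)\) (resp. \((t-\epsilon,t)\)) meets the support of \(f\). A set \(X\) is geometrically proper if no point of \(I\) is a left transition point of two distinct elements of \(X\) and no point is a right transition point of two distinct elements of \(X\). *)

(* Defs.v *)
From Stdlib Require Import Reals ZArith.
Open Scope R_scope.

Definition in_I (t : R) : Prop := 0 <= t <= 1.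

(* Elements of Homeo_+(I) are represented as functions R -> R that are the
   identity outside I (so equality of functions = equality on I).
   An orientation preserving homeomorphism of I is a continuous strictly
   increasing map of I with f 0 = 0 and f 1 = 1 (surjectivity follows). *)
Definition homeo_plus (f : R -> R) : Prop :=
  (forall t, in_I t -> forall eps, 0 < eps -> exists delta, 0 < delta /\
      forall s, in_I s -> Rabs (s - t) < delta -> Rabs (f s - f t) < eps) /\
  (forall s t, in_I s -> in_I t -> s < t -> f s < f t) /\
  f 0 = 0 /\ f 1 = 1 /\
  (forall t, ~ in_I t -> f t = t).

Definition comp (f g : R -> R) : R -> R := fun t => f (g t).
Definition idf : R -> R := fun t => t.

Definition inverse_of (g f : R -> R) : Prop := comp g f = idf /\ comp f g = idf.

Definition is_subgroup (S : (R -> R) -> Prop) : Prop :=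
  (forall f, S f -> homeo_plus f) /\
  S idf /\
  (forall f g, S f -> S g -> S (comp f g)) /\
  (forall f g, S f -> inverse_of g f -> S g).

Definition subset (A B : (R -> R) -> Prop) : Prop := forall f, A f -> B f.

Definition gen (X : (R -> R) -> Prop) (f : R -> R) : Prop :=
  forall S, is_subgroup S -> subset X S -> S f.

Definition in_support (f : R -> R) (t : R) : Prop := in_I t /\ f t <> t.

Definition left_transition (f : R -> R) (t : R) : Prop :=
  in_I t /\ ~ in_support f t /\
  forall eps, 0 < eps -> exists s, t < s < t + eps /\ in_support f s.

Definition right_transition (f : R -> R) (t : R) : Prop :=
  in_I t /\ ~ in_support f t /\
  forall eps, 0 < eps -> exists s, t - eps < s < t /\ in_support f s.

Definition geometrically_proper (X : (R -> R) -> Prop) : Prop :=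
  (forall f g t, X f -> X g -> left_transition f t -> left_transition g t -> f = g) /\
  (forall f g t, X f -> X g -> right_transition f t -> right_transition g t -> f = g).

Definition dyadic (x : R) : Prop := exists (m : Z) (n : nat), x = IZR m / 2 ^ n.

Definition thompsonF (f : R -> R) : Prop :=
  homeo_plus f /\
  exists (n : nat) (b : nat -> R),
    b 0%nat = 0 /\ b n = 1 /\
    (forall i, (i < n)%nat -> b i < b (S i)) /\
    (forall i, (i <= n)%nat -> dyadic (b i)) /\
    (forall i, (i < n)%nat -> exists (k : Z) (c : R),
        forall t, b i <= t <= b (S i) -> f t = powerRZ 2 k * t + c).

Definition finite_index (H G : (R -> R) -> Prop) : Prop :=
  exists (n : nat) (g : nat -> R -> R),
    (forall i, (i < n)%nat -> G (g i)) /\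
    forall f, G f -> exists i h, (i < n)%nat /\ H h /\ f = comp (g i) h.

Definition isomorphic (A B : (R -> R) -> Prop) : Prop :=
  exists phi : (R -> R) -> (R -> R),
    (forall f, A f -> B (phi f)) /\
    (forall f g, A f -> A g -> phi f = phi g -> f = g) /\
    (forall g, B g -> exists f, A f /\ phi f = g) /\
    (forall f g, A f -> A g -> phi (comp f g) = comp (phi f) (phi g)).

(* Main.v *)
Require Import Defs.
From Stdlib Require Import Reals ZArith Lra Lia List ClassicalEpsilon FunctionalExtensionality Classical.
Import ListNotations.
Open Scope R_scope.

(** Write [Fc] for the elements of [F] that are trivial near 0 and near 1, and [lam], [rho] for the
    logarithms of the slopes at 0 and 1. Every nontrivial subgroup normalized by [Fc] contains
    [Fc]; hence a finite index subgroup [H] contains [Fc], and it is determined by the lattice of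
    its pairs of slopes.

    Let [H] be isomorphic to [gen X]. Some orbit of [gen X] has hull [(p, q)] on which the action is
    faithful. Properness allows only one generator with a nontrivial germ at [p], and one at [q],
    so commutators are trivial near [p] and [q], and the group pushes such elements as close to
    [p] or [q] as desired. An element of [F] with nontrivial germs at both 0 and 1 has finitely
    many conjugates with trivial common centralizer; so a generator trivial near [p] or near [q]
    corresponds to an element of [H] trivial near 0 or near 1. If one generator were nontrivial
    at both ends, all the others would be trivial at both ends and would correspond to elements of
    [Fc], which would make the lattice cyclic. So the lattice is a product [aZ x bZ], and then
    conjugation by a map with infinitely many break points, which turns the germ [2^a] at 0 into
    [2], followed by the same at 1, carries [H] onto [F]. *)

(** * Homeomorphisms of the interval *)

(** Only the group law crosses the isomorphism: [X] may be infinite, and its group may act with a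
    large kernel on parts of the interval. So geometric facts are exchanged through commutation. On
    the side of [gen X], elements with disjoint supports in [[p, q]] commute; on the side of [H], an
    element commuting with a few conjugates of a map that is nontrivial at an endpoint must be
    trivial near that endpoint. Playing these against each other forces germs to vanish.

    That [Fc] lies in every nontrivial subgroup it normalizes rests on its perfectness, proved
    without a presentation: an element of [F] is a quotient of two positive words in the usual
    generators, modulo commutators a word depends only on two letter counts, and the slopes at 0 and
    1 reveal both counts.

    A conjugation that is affine near 0 preserves the slope at 0, so a map turning [2^a] into 2 with
    [a > 1] needs break points accumulating at 0. It is built self-similar, intertwining
    [t -> 2^-a t] with [t -> t/2], so that linear germs whose exponent is a multiple of [a] stay
    linear. *)

Lemma hp_incr f s t : homeo_plus f -> s < t -> f s < f t.
Proof.
  intros (_ & Hi & H0 & H1 & Ho) st.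
  assert (A : forall u, u < 0 -> f u = u) by (intros u Hu; apply Ho; unfold in_I; lra).
  assert (B : forall u, 1 < u -> f u = u) by (intros u Hu; apply Ho; unfold in_I; lra).
  assert (C : forall u, in_I u -> 0 <= f u <= 1).
  { intros u [u0 u1].
    destruct (Req_dec u 0) as [->|]; [lra|].
    destruct (Req_dec u 1) as [->|]; [lra|].
    assert (f 0 < f u) by (apply Hi; unfold in_I; lra).
    assert (f u < f 1) by (apply Hi; unfold in_I; lra). lra. }
  destruct (Rlt_dec s 0); [rewrite (A s) by lra|destruct (Rlt_dec 1 s); [rewrite (B s) by lra|]];
  (destruct (Rlt_dec t 0); [rewrite (A t) by lra|destruct (Rlt_dec 1 t); [rewrite (B t) by lra|]]); try lra.
  - assert (in_I t) by (unfold in_I; lra). specialize (C t H). lra.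
  - assert (in_I s) by (unfold in_I; lra). specialize (C s H). lra.
  - apply Hi; unfold in_I; lra.
Qed.

Lemma hp_le f s t : homeo_plus f -> s <= t -> f s <= f t.
Proof. intros Hf [H| ->]; [left; now apply hp_incr|lra]. Qed.

Lemma hp_inj f s t : homeo_plus f -> f s = f t -> s = t.
Proof.
  intros Hf E. destruct (Rtotal_order s t) as [H|[H|H]]; auto;
  apply (hp_incr f) in H; auto; lra.
Qed.

Lemma hp_lt_inv f s t : homeo_plus f -> f s < f t -> s < t.
Proof.
  intros Hf E. destruct (Rtotal_order s t) as [H|[H|H]]; auto; [subst; lra|].
  apply (hp_incr f) in H; auto; lra.
Qed.

Lemma hp_le_inv f s t : homeo_plus f -> f s <= f t -> s <= t.
Proof. intros Hf E. apply Rnot_lt_le. intros H. apply (hp_incr f) in H; auto; lra. Qed.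

Lemma hp_out f t : homeo_plus f -> (t <= 0 \/ 1 <= t) -> f t = t.
Proof.
  intros (_ & _ & H0 & H1 & Ho) Ht.
  destruct (Req_dec t 0) as [->|]; auto. destruct (Req_dec t 1) as [->|]; auto.
  apply Ho. unfold in_I; lra.
Qed.

Lemma hp_continuity f : homeo_plus f -> continuity f.
Proof.
  intros Hf t. pose proof Hf as (Hc & _ & H0 & H1 & Ho).
  intros eps He. destruct (Rlt_dec t 0) as [Hn|Hn].
  { exists (Rmin eps (-t)). split. { apply Rmin_glb_lt; lra. }
    intros s [_ Hs]. simpl in *. unfold Rdist in *.
    assert (E := Rmin_l eps (-t)). assert (E' := Rmin_r eps (-t)).
    assert (s < 0). { apply Rabs_def2 in Hs. lra. }
    rewrite !(hp_out f) by (auto; lra). lra. }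
  destruct (Rlt_dec 1 t) as [Hp|Hp].
  { exists (Rmin eps (t-1)). split. { apply Rmin_glb_lt; lra. }
    intros s [_ Hs]. simpl in *. unfold Rdist in *.
    assert (E := Rmin_l eps (t-1)). assert (E' := Rmin_r eps (t-1)).
    assert (1 < s). { apply Rabs_def2 in Hs. lra. }
    rewrite !(hp_out f) by (auto; lra). lra. }
  destruct (Hc t ltac:(unfold in_I; lra) (eps/2) ltac:(lra)) as (d & Hd & Hd').
  exists (Rmin d (eps/2)). split. { apply Rmin_glb_lt; lra. }
  intros s [_ Hs]. simpl in *. unfold Rdist in *.
  assert (E := Rmin_l d (eps/2)). assert (E' := Rmin_r d (eps/2)).
  apply Rabs_def2 in Hs.
  destruct (Rlt_dec s 0) as [sn|sn]; [|destruct (Rlt_dec 1 s) as [sp|sp]].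
  - rewrite (hp_out f s) by (auto; lra).
    specialize (Hd' 0 ltac:(unfold in_I; lra)). rewrite H0 in Hd'.
    assert (Rabs (0 - t) < d) by (apply Rabs_def1; lra). apply Hd' in H. apply Rabs_def2 in H.
    apply Rabs_def1; lra.
  - rewrite (hp_out f s) by (auto; lra).
    specialize (Hd' 1 ltac:(unfold in_I; lra)). rewrite H1 in Hd'.
    assert (Rabs (1 - t) < d) by (apply Rabs_def1; lra). apply Hd' in H. apply Rabs_def2 in H.
    apply Rabs_def1; lra.
  - assert (Rabs (f s - f t) < eps/2); [|lra].
    apply Hd'; [unfold in_I; lra|]. apply Rabs_def1; lra.
Qed.

Lemma hp_surj f y : homeo_plus f -> exists x, f x = y.
Proof.
  intros Hf.
  destruct (Rle_dec y 0); [exists y; apply hp_out; auto|].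
  destruct (Rle_dec 1 y); [exists y; apply hp_out; auto|].
  assert (C : continuity (f - fct_cte y)%F).
  { apply continuity_minus; [now apply hp_continuity|apply continuity_const; intros ? ?; reflexivity]. }
  destruct (IVT_cor _ 0 1 C ltac:(lra)) as (z & _ & Hz).
  { unfold minus_fct, fct_cte. rewrite !(hp_out f) by (auto; lra). nra. }
  exists z. unfold minus_fct, fct_cte in Hz. lra.
Qed.

(** Continuity comes from surjectivity: preimages of [f t - eps] and [f t + eps] bound a
    neighbourhood of [t]. The values at 0 and 1 are forced because [f] is injective and the identity
    off [I]. The homeomorphisms constructed below are checked through this criterion. *)
Lemma hp_intro f : (forall s t, s < t -> f s < f t) -> (forall y, exists x, f x = y) ->
  (forall t, t < 0 \/ 1 < t -> f t = t) -> homeo_plus f.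
Proof.
  intros Hi Hs Ho.
  assert (Hle : forall s t, s <= t -> f s <= f t) by (intros s t [H| ->]; [left; auto|lra]).
  assert (Hinv : forall s t, f s < f t -> s < t).
  { intros s t H. apply Rnot_le_lt. intros H'. apply Hle in H'. lra. }
  assert (H0 : f 0 = 0).
  { destruct (Rtotal_order (f 0) 0) as [H|[H|H]]; auto; exfalso.
    - assert (E : f (f 0) = f 0) by (apply Ho; lra). apply Hi in H. lra.
    - destruct (Hs (f 0 / 2)) as (s & Es).
      assert (s < 0) by (apply Hinv; lra). rewrite Ho in Es by lra. lra. }
  assert (H1 : f 1 = 1).
  { destruct (Rtotal_order (f 1) 1) as [H|[H|H]]; auto; exfalso.
    - destruct (Hs ((1 + f 1) / 2)) as (s & Es).
      assert (1 < s) by (apply Hinv; lra). rewrite Ho in Es by lra. lra.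
    - assert (E : f (f 1) = f 1) by (apply Ho; lra). apply Hi in H. lra. }
  split; [|split; [|split; [|split]]]; auto.
  - intros t Ht eps He.
    destruct (Hs (f t - eps)) as (a & Ea). destruct (Hs (f t + eps)) as (b & Eb).
    assert (a < t) by (apply Hinv; lra). assert (t < b) by (apply Hinv; lra).
    exists (Rmin (t-a) (b-t)). split; [apply Rmin_glb_lt; lra|].
    intros s _ Hst. assert (E := Rmin_l (t-a) (b-t)). assert (E' := Rmin_r (t-a) (b-t)).
    apply Rabs_def2 in Hst.
    assert (f a < f s) by (apply Hi; lra). assert (f s < f b) by (apply Hi; lra).
    apply Rabs_def1; lra.
  - intros t Ht. apply Ho. unfold in_I in Ht. lra.
Qed.

Definition finv (f : R -> R) (y : R) : R := epsilon (inhabits 0) (fun x => f x = y).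

Lemma finv_r f y : homeo_plus f -> f (finv f y) = y.
Proof. intros Hf. unfold finv. apply epsilon_spec. now apply hp_surj. Qed.

Lemma finv_l f x : homeo_plus f -> finv f (f x) = x.
Proof. intros Hf. apply (hp_inj f); auto. now apply finv_r. Qed.

Lemma finv_unique f x y : homeo_plus f -> f x = y -> finv f y = x.
Proof. intros Hf <-. now apply finv_l. Qed.

Lemma hp_finv f : homeo_plus f -> homeo_plus (finv f).
Proof.
  intros Hf. apply hp_intro.
  - intros s t st. apply (hp_lt_inv f); auto. now rewrite !finv_r.
  - intros y. exists (f y). now apply finv_l.
  - intros t Ht. apply finv_unique; auto. apply hp_out; auto. lra.
Qed.

Lemma hp_comp f g : homeo_plus f -> homeo_plus g -> homeo_plus (comp f g).
Proof.
  intros Hf Hg. apply hp_intro; unfold comp.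
  - intros s t st. now repeat apply hp_incr.
  - intros y. exists (finv g (finv f y)). now rewrite !finv_r.
  - intros t Ht. rewrite (hp_out g) by (auto; lra). rewrite (hp_out f) by (auto; lra). auto.
Qed.

Lemma hp_id : homeo_plus idf.
Proof. apply hp_intro; unfold idf; intros; auto. now exists y. Qed.

Lemma inverse_of_finv f : homeo_plus f -> inverse_of (finv f) f.
Proof.
  intros Hf. split; apply functional_extensionality; intros t; unfold comp, idf;
  [now apply finv_l|now apply finv_r].
Qed.

Lemma inverse_of_unique f g : homeo_plus f -> inverse_of g f -> g = finv f.
Proof.
  intros Hf [_ H]. apply functional_extensionality; intros t.
  symmetry. apply finv_unique; auto. apply (f_equal (fun u => u t)) in H. exact H.
Qed.

Lemma finv_finv f : homeo_plus f -> finv (finv f) = f.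
Proof.
  intros Hf. apply functional_extensionality; intros t. apply finv_unique; [now apply hp_finv|].
  now apply finv_l.
Qed.

Lemma finv_comp f g : homeo_plus f -> homeo_plus g -> finv (comp f g) = comp (finv g) (finv f).
Proof.
  intros Hf Hg. apply functional_extensionality; intros t.
  apply finv_unique; [now apply hp_comp|]. unfold comp. now rewrite !finv_r.
Qed.

Lemma finv_idf : finv idf = idf.
Proof. apply functional_extensionality; intros t. apply finv_unique; [apply hp_id|reflexivity]. Qed.

Lemma comp_finv_r f : homeo_plus f -> comp f (finv f) = idf.
Proof. intros Hf. apply functional_extensionality; intros t. now apply finv_r. Qed.

Lemma comp_finv_l f : homeo_plus f -> comp (finv f) f = idf.
Proof. intros Hf. apply functional_extensionality; intros t. now apply finv_l. Qed.

Lemma subgroup_intro (S : (R -> R) -> Prop) :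
  (forall f, S f -> homeo_plus f) -> S idf -> (forall f g, S f -> S g -> S (comp f g)) ->
  (forall f, S f -> S (finv f)) -> is_subgroup S.
Proof.
  intros H1 H2 H3 H4. split; [|split; [|split]]; auto.
  intros f g Hf Hg. rewrite (inverse_of_unique f g); auto.
Qed.

Lemma subgroup_hp S f : is_subgroup S -> S f -> homeo_plus f.
Proof. intros HS. apply HS. Qed.

Lemma subgroup_id S : is_subgroup S -> S idf.
Proof. intros HS. apply HS. Qed.

Lemma subgroup_comp S f g : is_subgroup S -> S f -> S g -> S (comp f g).
Proof. intros HS. apply HS. Qed.

Lemma subgroup_finv S f : is_subgroup S -> S f -> S (finv f).
Proof.
  intros HS Hf. destruct HS as (H1 & _ & _ & H4). apply (H4 f); auto.
  apply inverse_of_finv; auto.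
Qed.

Definition conjf (g f : R -> R) : R -> R := comp g (comp f (finv g)).

Lemma subgroup_conj S g f : is_subgroup S -> S g -> S f -> S (conjf g f).
Proof. intros HS Hg Hf. unfold conjf. apply subgroup_comp; auto. apply subgroup_comp; auto. now apply subgroup_finv. Qed.

Lemma hp_conj g f : homeo_plus g -> homeo_plus f -> homeo_plus (conjf g f).
Proof. intros Hg Hf. unfold conjf. apply hp_comp; auto. apply hp_comp; auto. now apply hp_finv. Qed.

Lemma conj_comp g a b : homeo_plus g -> conjf g (comp a b) = comp (conjf g a) (conjf g b).
Proof. intros Hg. apply functional_extensionality; intros t; unfold conjf, comp. now rewrite finv_l. Qed.

Lemma conj_finv g a : homeo_plus g -> homeo_plus a -> conjf g (finv a) = finv (conjf g a).
Proof.
  intros Hg Ha. assert (homeo_plus (finv g)) by now apply hp_finv.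
  unfold conjf. rewrite finv_comp; [|auto|now apply hp_comp].
  rewrite finv_comp by auto. rewrite finv_finv by auto. reflexivity.
Qed.

Lemma conj_conj g h a : homeo_plus g -> homeo_plus h -> conjf g (conjf h a) = conjf (comp g h) a.
Proof. intros Hg Hh. unfold conjf. rewrite finv_comp; auto. Qed.

Lemma conj_id a : conjf idf a = a.
Proof. unfold conjf. rewrite finv_idf. reflexivity. Qed.

Lemma conj_finvK g a : homeo_plus g -> conjf (finv g) (conjf g a) = a.
Proof. intros Hg. rewrite conj_conj by (try apply hp_finv; auto). rewrite comp_finv_l by auto. apply conj_id. Qed.

Lemma conj_Kfinv g a : homeo_plus g -> conjf g (conjf (finv g) a) = a.
Proof. intros Hg. rewrite conj_conj by (try apply hp_finv; auto). rewrite comp_finv_r by auto. apply conj_id. Qed.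

Lemma conj_app g f t : homeo_plus g -> conjf g f (g t) = g (f t).
Proof. intros Hg. unfold conjf, comp. now rewrite finv_l. Qed.

Lemma conj_of_id g : homeo_plus g -> conjf g idf = idf.
Proof. intros Hg. unfold conjf. apply comp_finv_r; auto. Qed.

Fixpoint fpow (f : R -> R) (n : nat) : R -> R :=
  match n with O => idf | S m => comp f (fpow f m) end.

Lemma subgroup_fpow S f n : is_subgroup S -> S f -> S (fpow f n).
Proof.
  intros HS Hf. induction n; simpl; [now apply subgroup_id|now apply subgroup_comp].
Qed.

Lemma fpow_comm f n : comp f (fpow f n) = comp (fpow f n) f.
Proof. induction n; simpl; auto. rewrite IHn at 1. reflexivity. Qed.

Lemma fpow_add f m n : fpow f (m + n) = comp (fpow f m) (fpow f n).
Proof. induction m; simpl; auto. rewrite IHm. reflexivity. Qed.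

Lemma fpow_mul f m n : fpow f (m * n) = fpow (fpow f n) m.
Proof. induction m; simpl; auto. rewrite fpow_add, IHm. reflexivity. Qed.

Lemma conj_fpow g f n : homeo_plus g -> conjf g (fpow f n) = fpow (conjf g f) n.
Proof.
  intros Hg. induction n; simpl; [now apply conj_of_id|]. rewrite conj_comp, IHn; auto.
Qed.

Lemma subgroup_homeo : is_subgroup homeo_plus.
Proof. apply subgroup_intro; [auto|apply hp_id|apply hp_comp|apply hp_finv]. Qed.

Lemma fpow_hp f n : homeo_plus f -> homeo_plus (fpow f n).
Proof. apply subgroup_fpow, subgroup_homeo. Qed.

Lemma fpow_fix f n t : f t = t -> fpow f n t = t.
Proof. intros E. induction n; simpl; auto. unfold comp. now rewrite IHn. Qed.

(* The supremum of the forward orbit would be a fixed point. *)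
Lemma push_up f a b s e : homeo_plus f -> a <= b -> (forall t, a < t < b -> t < f t) ->
  a < s < b -> e < b -> exists n, e < fpow f n s.
Proof.
  intros Hf ab Hup Hs He. apply NNPP. intros Hno.
  assert (Hb : forall n, fpow f n s <= e).
  { intros n. apply Rnot_lt_le. intros H. apply Hno. now exists n. }
  destruct (completeness (fun x => exists n, x = fpow f n s)) as (m & Hm1 & Hm2).
  { exists e. intros x (n & ->). auto. }
  { exists s. now exists 0%nat. }
  assert (m <= e) by (apply Hm2; intros x (n & ->); auto).
  assert (s <= m) by (apply Hm1; now exists 0%nat).
  assert (Hfm : m < f m) by (apply Hup; lra).
  assert (Hlt : finv f m < m).
  { apply (hp_lt_inv f); auto. rewrite finv_r; auto. }
  assert (m <= finv f m); [|lra].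
  apply Hm2. intros x (n & ->). apply (hp_le_inv f); auto. rewrite finv_r; auto.
  apply Hm1. now exists (S n).
Qed.

(** * Thompson's group as locally dyadic maps *)

Notation p2 := (powerRZ 2).

Lemma p2_pos k : 0 < p2 k.
Proof. apply powerRZ_lt; lra. Qed.

Lemma p2_add j k : p2 (j + k) = p2 j * p2 k.
Proof. apply powerRZ_add; lra. Qed.

Lemma p2_oppl k : p2 (- k) * p2 k = 1.
Proof. rewrite <- p2_add. now replace (- k + k)%Z with 0%Z by lia. Qed.

Lemma p2_gt1 k : (0 < k)%Z -> 1 < p2 k.
Proof.
  intros H. rewrite <- (Z2Nat.id k) by lia. rewrite <- pow_powerRZ.
  apply Rlt_pow_R1; [lra|lia].
Qed.

Lemma p2_lt j k : (j < k)%Z -> p2 j < p2 k.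
Proof.
  intros H. replace k with ((k - j) + j)%Z by lia. rewrite p2_add.
  assert (H1 := p2_gt1 (k - j) ltac:(lia)). assert (H2 := p2_pos j). nra.
Qed.

Lemma p2_inj j k : p2 j = p2 k -> j = k.
Proof.
  intros E. destruct (Z.lt_trichotomy j k) as [H|[H|H]]; auto; apply p2_lt in H; lra.
Qed.

Lemma pow2_pos n : 0 < 2 ^ n.
Proof. apply pow_lt; lra. Qed.

Lemma IZR_pow2 n : IZR (2 ^ Z.of_nat n) = 2 ^ n.
Proof. now rewrite <- pow_IZR. Qed.

Lemma dyadic_IZR m : dyadic (IZR m).
Proof. exists m, 0%nat. simpl. field. Qed.

Lemma dyadic_plus x y : dyadic x -> dyadic y -> dyadic (x + y).
Proof.
  intros (m & n & ->) (m' & n' & ->).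
  exists (m * 2 ^ Z.of_nat n' + m' * 2 ^ Z.of_nat n)%Z, (n + n')%nat.
  rewrite plus_IZR, !mult_IZR, !IZR_pow2, pow_add. field.
  split; apply Rgt_not_eq, pow2_pos.
Qed.

Lemma dyadic_mult x y : dyadic x -> dyadic y -> dyadic (x * y).
Proof.
  intros (m & n & ->) (m' & n' & ->). exists (m * m')%Z, (n + n')%nat.
  rewrite mult_IZR, pow_add. field. split; apply Rgt_not_eq, pow2_pos.
Qed.

Lemma dyadic_opp x : dyadic x -> dyadic (- x).
Proof.
  intros H. replace (- x) with (IZR (-1) * x) by ring. apply dyadic_mult; auto. apply dyadic_IZR.
Qed.

Lemma dyadic_minus x y : dyadic x -> dyadic y -> dyadic (x - y).
Proof. intros Hx Hy. apply dyadic_plus; auto. now apply dyadic_opp. Qed.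

Lemma dyadic_invpow n : dyadic (/ 2 ^ n).
Proof. exists 1%Z, n. field. apply Rgt_not_eq, pow2_pos. Qed.

Lemma dyadic_half x : dyadic x -> dyadic (x / 2).
Proof.
  intros H. apply dyadic_mult; auto. replace (/ 2) with (/ 2 ^ 1) by (simpl; field).
  apply dyadic_invpow.
Qed.

Lemma dyadic_p2 k : dyadic (p2 k).
Proof.
  destruct (Z.le_gt_cases 0 k) as [H|H].
  - rewrite <- (Z2Nat.id k) by lia. rewrite <- pow_powerRZ, <- IZR_pow2. apply dyadic_IZR.
  - replace (p2 k) with (/ 2 ^ (Z.to_nat (- k))); [apply dyadic_invpow|].
    rewrite pow_powerRZ, Z2Nat.id by lia. assert (H1 := p2_oppl k). assert (H2 := p2_pos (-k)).
    apply (Rmult_eq_reg_l (p2 (- k))); [|lra]. rewrite H1. field. lra.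
Qed.

Ltac dyad := repeat first [assumption | apply dyadic_p2 | apply dyadic_IZR | apply dyadic_half
  | apply dyadic_plus | apply dyadic_minus | apply dyadic_mult | apply dyadic_opp ].

Lemma INR_lt_pow2 n : INR n < 2 ^ n.
Proof.
  induction n; [simpl; lra|]. rewrite S_INR. simpl.
  assert (1 <= 2 ^ n) by (apply pow_R1_Rle; lra). lra.
Qed.

Lemma pow2_large x : exists n, x < 2 ^ n.
Proof.
  exists (Z.to_nat (up x)). destruct (archimed x) as [H _].
  destruct (Z.le_gt_cases 0 (up x)) as [H1|H1].
  - apply Rlt_trans with (INR (Z.to_nat (up x))); [|apply INR_lt_pow2].
    rewrite INR_IZR_INZ, Z2Nat.id by lia. lra.
  - apply IZR_lt in H1. assert (H2 := pow2_pos (Z.to_nat (up x))). lra.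
Qed.

Lemma dyadic_between a b : a < b -> exists d, dyadic d /\ a < d < b.
Proof.
  intros ab. destruct (pow2_large (/ (b - a))) as (n & Hn).
  assert (P := pow2_pos n).
  assert (H : 1 < (b - a) * 2 ^ n).
  { apply (Rmult_lt_compat_l (b - a)) in Hn; [|lra]. rewrite Rinv_r in Hn by lra. lra. }
  destruct (archimed (a * 2 ^ n)) as [H1 H2].
  exists (IZR (up (a * 2 ^ n)) / 2 ^ n). split; [now exists (up (a * 2 ^ n)), n|].
  split; apply (Rmult_lt_reg_r (2 ^ n)); auto; unfold Rdiv; rewrite ?Rmult_assoc, ?Rinv_l by lra; lra.
Qed.

Definition rgerm (f : R -> R) (t : R) (k : Z) (c : R) : Prop :=
  exists e, 0 < e /\ forall s, t <= s <= t + e -> f s = p2 k * s + c.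

Definition lgerm (f : R -> R) (t : R) (k : Z) (c : R) : Prop :=
  exists e, 0 < e /\ forall s, t - e <= s <= t -> f s = p2 k * s + c.

(** Local form of membership in [F]: the two one-sided germs may differ only at a dyadic point. In
    contrast to a list of break points, it passes through compositions and inverses point by point,
    and it also makes sense for maps with infinitely many break points. *)
Definition PLat (f : R -> R) (t : R) : Prop :=
  exists k c k' c', dyadic c /\ dyadic c' /\ rgerm f t k c /\ lgerm f t k' c' /\
    (dyadic t \/ (k = k' /\ c = c')).

Lemma rgerm_at f t k c : rgerm f t k c -> f t = p2 k * t + c.
Proof. intros (e & He & H). apply H. lra. Qed.

Lemma lgerm_at f t k c : lgerm f t k c -> f t = p2 k * t + c.
Proof. intros (e & He & H). apply H. lra. Qed.

Lemma rgerm_comp f g t k c k' c' : rgerm f t k c -> rgerm g (f t) k' c' ->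
  rgerm (comp g f) t (k' + k) (p2 k' * c + c').
Proof.
  intros Hf (e' & He' & Hg). assert (E := rgerm_at _ _ _ _ Hf). destruct Hf as (e & He & Hf).
  assert (P := p2_pos k). exists (Rmin e (e' * p2 (- k))). split.
  { apply Rmin_glb_lt; auto. apply Rmult_lt_0_compat; auto. apply p2_pos. }
  intros s Hs. assert (E1 := Rmin_l e (e' * p2 (- k))). assert (E2 := Rmin_r e (e' * p2 (- k))).
  unfold comp. rewrite Hg; rewrite (Hf s) by lra; rewrite ?p2_add; [ring|].
  assert (Q := p2_oppl k). rewrite E. split; [nra|].
  assert (p2 k * (s - t) <= p2 k * (e' * p2 (- k))) by (apply Rmult_le_compat_l; lra).
  replace (p2 k * (e' * p2 (- k))) with (e' * (p2 (-k) * p2 k)) in H by ring. rewrite Q in H. lra.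
Qed.

Lemma lgerm_comp f g t k c k' c' : lgerm f t k c -> lgerm g (f t) k' c' ->
  lgerm (comp g f) t (k' + k) (p2 k' * c + c').
Proof.
  intros Hf (e' & He' & Hg). assert (E := lgerm_at _ _ _ _ Hf). destruct Hf as (e & He & Hf).
  assert (P := p2_pos k). exists (Rmin e (e' * p2 (- k))). split.
  { apply Rmin_glb_lt; auto. apply Rmult_lt_0_compat; auto. apply p2_pos. }
  intros s Hs. assert (E1 := Rmin_l e (e' * p2 (- k))). assert (E2 := Rmin_r e (e' * p2 (- k))).
  unfold comp. rewrite Hg; rewrite (Hf s) by lra; rewrite ?p2_add; [ring|].
  assert (Q := p2_oppl k). rewrite E. split; [|nra].
  assert (p2 k * (t - s) <= p2 k * (e' * p2 (- k))) by (apply Rmult_le_compat_l; lra).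
  replace (p2 k * (e' * p2 (- k))) with (e' * (p2 (-k) * p2 k)) in H by ring. rewrite Q in H. lra.
Qed.

Lemma rgerm_inv f g t k c : (forall s, g (f s) = s) -> rgerm f t k c ->
  rgerm g (f t) (- k) (- (p2 (- k) * c)).
Proof.
  intros gf Hf. assert (E := rgerm_at _ _ _ _ Hf). destruct Hf as (e & He & Hf).
  assert (P := p2_pos k). assert (P' := p2_pos (-k)). assert (Q := p2_oppl k).
  exists (e * p2 k). split; [nra|]. intros s Hs. rewrite E in Hs.
  set (x := p2 (- k) * s + - (p2 (- k) * c)).
  assert (Ex : p2 k * x + c = s).
  { unfold x. replace (p2 k * (p2 (- k) * s + - (p2 (- k) * c)) + c) with
    ((p2 (-k) * p2 k) * s - (p2 (- k) * p2 k) * c + c) by ring. rewrite Q. ring. }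
  assert (t <= x <= t + e).
  { split; apply (Rmult_le_reg_l (p2 k)); lra. }
  rewrite <- (gf x), Hf, Ex; auto.
Qed.

Lemma lgerm_inv f g t k c : (forall s, g (f s) = s) -> lgerm f t k c ->
  lgerm g (f t) (- k) (- (p2 (- k) * c)).
Proof.
  intros gf Hf. assert (E := lgerm_at _ _ _ _ Hf). destruct Hf as (e & He & Hf).
  assert (P := p2_pos k). assert (P' := p2_pos (-k)). assert (Q := p2_oppl k).
  exists (e * p2 k). split; [nra|]. intros s Hs. rewrite E in Hs.
  set (x := p2 (- k) * s + - (p2 (- k) * c)).
  assert (Ex : p2 k * x + c = s).
  { unfold x. replace (p2 k * (p2 (- k) * s + - (p2 (- k) * c)) + c) with
    ((p2 (-k) * p2 k) * s - (p2 (- k) * p2 k) * c + c) by ring. rewrite Q. ring. }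
  assert (t - e <= x <= t).
  { split; apply (Rmult_le_reg_l (p2 k)); lra. }
  rewrite <- (gf x), Hf, Ex; auto.
Qed.

Lemma rgerm_unique f t k c k' c' : rgerm f t k c -> rgerm f t k' c' -> k = k'.
Proof.
  intros (e & He & H) (e' & He' & H'). set (m := Rmin e e').
  assert (0 < m) by (apply Rmin_glb_lt; auto).
  assert (m <= e) by apply Rmin_l. assert (m <= e') by apply Rmin_r.
  apply p2_inj.
  assert (A := H t ltac:(lra)). rewrite (H' t ltac:(lra)) in A.
  assert (B := H (t + m) ltac:(lra)). rewrite (H' (t+m) ltac:(lra)) in B. nra.
Qed.

(** Serves to carry the clause about dyadic break points through compositions and inverses. *)
Lemma PLat_dyadic f t : PLat f t -> dyadic (f t) <-> dyadic t.
Proof.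
  intros (k & c & _ & _ & Hc & _ & Hg & _ & _). apply rgerm_at in Hg. rewrite Hg. split; intros H.
  - replace t with (p2 (- k) * ((p2 k * t + c) - c)).
    + dyad.
    + assert (Q := p2_oppl k).
      replace (p2 (- k) * (p2 k * t + c - c)) with ((p2 (-k) * p2 k) * t) by ring. rewrite Q; ring.
  - dyad.
Qed.

Lemma PLat_comp f g t : PLat f t -> PLat g (f t) -> PLat (comp g f) t.
Proof.
  intros Hf Hg. assert (D := PLat_dyadic _ _ Hf).
  destruct Hf as (k & c & k' & c' & Hc & Hc' & Hr & Hl & Hd).
  destruct Hg as (j & d & j' & d' & Hcg & Hcg' & Hrg & Hlg & Hdg).
  exists (j + k)%Z, (p2 j * c + d), (j' + k')%Z, (p2 j' * c' + d'). repeat split.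
  1,2: dyad. 1: now apply rgerm_comp. 1: now apply lgerm_comp.
  destruct Hd as [Hd|(-> & ->)]; auto. destruct Hdg as [Hdg|(-> & ->)]; auto.
  left. now apply D.
Qed.

Lemma PLat_inv f g t : (forall s, g (f s) = s) -> PLat f t -> PLat g (f t).
Proof.
  intros gf Hf. assert (D := PLat_dyadic _ _ Hf).
  destruct Hf as (k & c & k' & c' & Hc & Hc' & Hr & Hl & Hd).
  exists (- k)%Z, (- (p2 (- k) * c)), (- k')%Z, (- (p2 (- k') * c')). repeat split.
  1,2: dyad. 1: now apply rgerm_inv. 1: now apply lgerm_inv.
  destruct Hd as [Hd|(-> & ->)]; auto. left. now apply D.
Qed.

Lemma PLat_affine f t k c e : 0 < e -> dyadic c ->
  (forall s, t - e <= s <= t + e -> f s = p2 k * s + c) -> PLat f t.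
Proof.
  intros He Hc H. exists k, c, k, c. repeat split; auto; exists e; split; auto;
  intros s Hs; apply H; lra.
Qed.

Lemma PLat_outside f t : homeo_plus f -> t < 0 \/ 1 < t -> PLat f t.
Proof.
  intros Hf Ht. apply (PLat_affine _ _ 0 0 (if Rlt_dec t 0 then - t else t - 1)).
  - destruct Rlt_dec; lra.
  - apply (dyadic_IZR 0).
  - intros s Hs. rewrite hp_out; auto; simpl; destruct Rlt_dec; lra.
Qed.

Inductive dyadic_part (f : R -> R) : R -> Prop :=
| dpart0 : dyadic_part f 0
| dpartS x y k c : dyadic_part f x -> x < y -> dyadic y ->
    (forall t, x <= t <= y -> f t = p2 k * t + c) -> dyadic_part f y.

Lemma dyadic_part_dyadic f x : dyadic_part f x -> dyadic x.
Proof. intros []; auto. apply (dyadic_IZR 0). Qed.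

Lemma dyadic_part_seq f x : dyadic_part f x -> exists (n : nat) (b : nat -> R),
    b 0%nat = 0 /\ b n = x /\
    (forall i, (i < n)%nat -> b i < b (S i)) /\
    (forall i, (i <= n)%nat -> dyadic (b i)) /\
    (forall i, (i < n)%nat -> exists (k : Z) (c : R),
        forall t, b i <= t <= b (S i) -> f t = powerRZ 2 k * t + c).
Proof.
  induction 1 as [|x y k c Hx IH xy Hy Ht].
  - exists 0%nat, (fun _ => 0). repeat split; intros; try lia. apply (dyadic_IZR 0).
  - destruct IH as (n & b & H0 & Hn & Hlt & Hd & Ha).
    exists (S n), (fun i => if Nat.leb i n then b i else y).
    assert (E : forall i, (i <= n)%nat -> Nat.leb i n = true) by (intros; now apply Nat.leb_le).
    assert (E' : Nat.leb (S n) n = false) by (apply Nat.leb_gt; lia).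
    repeat split.
    + now rewrite E by lia.
    + now rewrite E'.
    + intros i Hi. rewrite E by lia. destruct (Nat.eq_dec i n) as [->|]; [rewrite E'; lra|].
      rewrite E by lia. apply Hlt; lia.
    + intros i Hi. destruct (Nat.eq_dec i (S n)) as [->|]; [now rewrite E'|].
      rewrite E by lia. apply Hd; lia.
    + intros i Hi. rewrite E by lia. destruct (Nat.eq_dec i n) as [->|].
      * rewrite E', Hn. now exists k, c.
      * rewrite E by lia. apply Ha; lia.
Qed.

(** Compactness of [[0,1]] by a supremum [m] of the reachable points. The left germ at [m] joins a
    reachable point to [m] if [m] is dyadic, and the right germ continues beyond. If [m] is not
    dyadic, both germs agree, so one affine piece leads across [m] to a dyadic point. *)
Lemma dyadic_part_exists f : (forall t, PLat f t) -> dyadic_part f 1.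
Proof.
  intros Hf.
  destruct (completeness (fun x => x <= 1 /\ dyadic_part f x)) as (m & Hm1 & Hm2).
  { exists 1. intros x (H & _). auto. }
  { exists 0. split; [lra|constructor]. }
  assert (m <= 1) by (apply Hm2; intros x (? & _); auto).
  destruct (Hf m) as (k & c & k' & c' & Hc & Hc' & (e & He & Hr) & (e' & He' & Hl) & Hd).
  assert (exists x, dyadic_part f x /\ m - e' < x <= m) as (x & Hx & Hxm).
  { apply NNPP. intros Hno. assert (m <= m - e'); [|lra].
    apply Hm2. intros x (x1 & Hx). apply Rnot_lt_le. intros H'. apply Hno. exists x.
    split; [auto|split; [lra|]]. apply Hm1. auto. }
  assert (Hmd : dyadic m -> dyadic_part f m).
  { intros Dm. destruct Hxm as [H1 [H2| ->]]; auto.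
    apply (dpartS f x m k' c'); auto. intros t Ht. apply Hl. lra. }
  destruct (Req_dec m 1) as [->|Hne]; [apply Hmd; apply (dyadic_IZR 1)|exfalso].
  destruct (dyadic_between m (Rmin 1 (m + e))) as (y & Dy & Hy).
  { apply Rmin_glb_lt; lra. }
  assert (A := Rmin_l 1 (m + e)). assert (B := Rmin_r 1 (m + e)).
  assert (y <= m); [|lra]. apply Hm1. split; [lra|].
  destruct Hd as [Hd|(-> & ->)].
  - apply (dpartS f m y k c); auto; [lra|]. intros t Ht. apply Hr. lra.
  - apply (dpartS f x y k' c'); auto; [lra|]. intros t Ht.
    destruct (Rle_dec t m); [apply Hl|apply Hr]; lra.
Qed.

Lemma thompsonF_iff f : thompsonF f <-> homeo_plus f /\ forall t, PLat f t.
Proof.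
  split.
  2:{ intros (Hf & HP). split; auto. now apply dyadic_part_seq, dyadic_part_exists. }
  intros (Hf & n & b & H0 & Hn & Hlt & Hd & Ha). split; auto.
  (* Dyadic values propagate from [f 0 = 0] along the break points; this yields dyadic additive
     constants on the pieces. *)
  assert (Hdf : forall i, (i <= n)%nat -> dyadic (f (b i))).
  { induction i; intros Hi.
    - rewrite H0, hp_out; auto; [apply (dyadic_IZR 0)|lra].
    - destruct (Ha i ltac:(lia)) as (k & c & H). specialize (IHi ltac:(lia)).
      assert (L := Hlt i ltac:(lia)).
      assert (E := H (b i) ltac:(lra)). assert (E' := H (b (S i)) ltac:(lra)).
      replace (f (b (S i))) with (f (b i) + p2 k * (b (S i) - b i)) by lra.
      assert (D1 := Hd i ltac:(lia)). assert (D2 := Hd (S i) Hi). dyad. }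
  assert (Ha' : forall i, (i < n)%nat -> exists (k : Z) (c : R), dyadic c /\
        forall t, b i <= t <= b (S i) -> f t = powerRZ 2 k * t + c).
  { intros i Hi. destruct (Ha i Hi) as (k & c & H). exists k, c. split; auto.
    assert (L := Hlt i Hi).
    replace c with (f (b i) - p2 k * b i) by (rewrite (H (b i)); lra).
    assert (D1 := Hd i ltac:(lia)). assert (D2 := Hdf i ltac:(lia)). dyad. }
  assert (Hin : forall m, (m <= n)%nat -> forall t, 0 <= t < b m ->
      exists i, (i < m)%nat /\ b i <= t < b (S i)).
  { induction m; intros Hm t Ht; [rewrite H0 in Ht; lra|].
    destruct (Rlt_dec t (b m)) as [H|H].
    - destruct (IHm ltac:(lia) t ltac:(lra)) as (i & Hi & Hti). exists i. split; [lia|auto].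
    - exists m. split; [lia|lra]. }
  assert (D0 : dyadic 0) by apply (dyadic_IZR 0).
  assert (D1 : dyadic 1) by apply (dyadic_IZR 1).
  assert (Hr : forall i, (i < n)%nat -> exists k c, dyadic c /\ rgerm f (b i) k c).
  { intros i Hi. destruct (Ha' i Hi) as (k & c & Dc & H). exists k, c. split; auto.
    assert (L := Hlt i Hi). exists (b (S i) - b i). split; [lra|]. intros s Hs. apply H. lra. }
  assert (Hl : forall i, (i < n)%nat -> exists k c, dyadic c /\ lgerm f (b (S i)) k c).
  { intros i Hi. destruct (Ha' i Hi) as (k & c & Dc & H). exists k, c. split; auto.
    assert (L := Hlt i Hi). exists (b (S i) - b i). split; [lra|]. intros s Hs. apply H. lra. }
  assert (Hnpos : (0 < n)%nat). { destruct n; [|lia]. lra. }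
  assert (Hbreak : forall i, (i <= n)%nat -> PLat f (b i)).
  { intros i Hi.
    assert (exists k c, dyadic c /\ rgerm f (b i) k c) as (k & c & Hc & Hg).
    { destruct (Nat.eq_dec i n) as [->|]; [|apply Hr; lia].
      exists 0%Z, 0. split; auto. exists 1. split; [lra|]. intros s Hs. rewrite Hn in Hs.
      rewrite hp_out; auto; simpl; lra. }
    assert (exists k c, dyadic c /\ lgerm f (b i) k c) as (k' & c' & Hc' & Hg').
    { destruct i; [|apply Hl; lia].
      exists 0%Z, 0. split; auto. exists 1. split; [lra|]. intros s Hs. rewrite H0 in Hs.
      rewrite hp_out; auto; simpl; lra. }
    exists k, c, k', c'. repeat split; auto. }
  intros t. destruct (Rlt_dec t 0); [apply PLat_outside; auto|].
  destruct (Rlt_dec 1 t); [apply PLat_outside; auto|].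
  destruct (Req_dec t 1) as [->|]; [rewrite <- Hn; apply Hbreak; lia|].
  destruct (Hin n ltac:(lia) t ltac:(lra)) as (i & Hi & Hti).
  destruct (Req_dec t (b i)) as [->|]; [apply Hbreak; lia|].
  destruct (Ha' i Hi) as (k & c & Hc & H').
  assert (A := Rmin_l (t - b i) (b (S i) - t)). assert (B := Rmin_r (t - b i) (b (S i) - t)).
  apply (PLat_affine f t k c (Rmin (t - b i) (b (S i) - t))); auto.
  - apply Rmin_glb_lt; lra.
  - intros s Hs. apply H'. lra.
Qed.

Lemma thompsonF_hp f : thompsonF f -> homeo_plus f.
Proof. intros H. apply H. Qed.

Lemma thompsonF_PLat f t : thompsonF f -> PLat f t.
Proof. intros H. now apply thompsonF_iff. Qed.

Lemma subgroup_thompsonF : is_subgroup thompsonF.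
Proof.
  apply subgroup_intro.
  - apply thompsonF_hp.
  - apply thompsonF_iff. split; [apply hp_id|]. intros t.
    apply (PLat_affine _ _ 0 0 1); [lra|apply (dyadic_IZR 0)|]. intros; unfold idf; simpl; lra.
  - intros f g Hf Hg. apply thompsonF_iff. split; [apply hp_comp; now apply thompsonF_hp|].
    intros t. apply PLat_comp; now apply thompsonF_PLat.
  - intros f Hf. assert (Hp := thompsonF_hp _ Hf). apply thompsonF_iff. split; [now apply hp_finv|].
    intros t. rewrite <- (finv_r f t) by auto. apply PLat_inv; [|now apply thompsonF_PLat].
    intros s. now apply finv_l.
Qed.

(** * Elements with prescribed supports *)

Lemma finv_fpow f n : homeo_plus f -> finv (fpow f n) = fpow (finv f) n.
Proof.
  intros Hf. induction n; simpl; [apply finv_idf|].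
  rewrite finv_comp by (auto; now apply fpow_hp). rewrite IHn. symmetry. apply fpow_comm.
Qed.

(** The inverse moves points up, so one of its powers carries a point below [e] past [s]; the same
    power of [f] reverses this. *)
Lemma push_down f a b s e : homeo_plus f -> (forall t, a < t < b -> f t < t) ->
  a < s < b -> a < e -> exists n, fpow f n s < e.
Proof.
  intros Hf Hd Hs He.
  set (e' := Rmin e s). assert (e' <= e) by apply Rmin_l. assert (e' <= s) by apply Rmin_r.
  assert (a < e') by (apply Rmin_glb_lt; lra).
  assert (Hi := hp_finv _ Hf).
  destruct (push_up (finv f) a b e' s) as (n & Hn); auto; try lra.
  - intros t Ht. destruct (Rtotal_order (finv f t) t) as [L|[L|L]]; auto; exfalso.
    + assert (f (finv f t) < f t) by (apply hp_incr; auto). rewrite finv_r in H2 by auto.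
      specialize (Hd t Ht). lra.
    + assert (E : f t = t) by (rewrite <- L at 1; now apply finv_r). specialize (Hd t Ht). lra.
  - exists n. assert (Hp := fpow_hp f n Hf). rewrite <- finv_fpow in Hn by auto.
    apply (hp_incr (fpow f n)) in Hn; auto. rewrite finv_r in Hn by auto. lra.
Qed.

(** The usual first generator of [F]: slopes 1/2, 1 and 2, hence below the diagonal on (0,1). On
    subdivisions it acts as the rotation of binary trees. *)
Definition x0 (t : R) : R :=
  if Rle_dec t 0 then t else if Rle_dec t (1/2) then t / 2 else
  if Rle_dec t (3/4) then t - 1/4 else if Rle_dec t 1 then 2 * t - 1 else t.

Lemma x0_hp : homeo_plus x0.
Proof.
  apply hp_intro.
  - intros s t st. unfold x0. repeat destruct Rle_dec; lra.
  - intros y. exists (if Rle_dec y 0 then y else if Rle_dec y (1/4) then 2 * y else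
      if Rle_dec y (1/2) then y + 1/4 else if Rle_dec y 1 then (y + 1) / 2 else y).
    unfold x0. repeat destruct Rle_dec; lra.
  - intros t Ht. unfold x0. repeat destruct Rle_dec; lra.
Qed.

Lemma x0_F : thompsonF x0.
Proof.
  split; [apply x0_hp|].
  exists 3%nat, (fun i => match i with 0%nat => 0 | 1%nat => 1/2 | 2%nat => 3/4 | _ => 1 end).
  repeat split; try lra.
  - intros i Hi. destruct i as [|[|[|i]]]; try lia; lra.
  - intros i Hi. destruct i as [|[|[|i]]].
    + exists 0%Z, 0%nat. simpl; lra.
    + exists 1%Z, 1%nat. simpl; lra.
    + exists 3%Z, 2%nat. simpl; lra.
    + exists 1%Z, 0%nat. simpl; lra.
  - intros i Hi. destruct i as [|[|[|i]]]; try lia.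
    + exists (-1)%Z, 0. intros t Ht. unfold x0. simpl. repeat destruct Rle_dec; lra.
    + exists 0%Z, (-1/4). intros t Ht. unfold x0. simpl. repeat destruct Rle_dec; lra.
    + exists 1%Z, (-1). intros t Ht. unfold x0. simpl. repeat destruct Rle_dec; lra.
Qed.

Lemma x0_lt t : 0 < t < 1 -> x0 t < t.
Proof. intros Ht. unfold x0. repeat destruct Rle_dec; lra. Qed.

(** Conjugate of [f] by the affine map of [[0,1]] onto [[a,b]], a copy of [f] supported in
    [[a,b]]. *)
Definition sc (a b : R) (f : R -> R) (t : R) : R := a + (b - a) * f ((t - a) / (b - a)).

Lemma sc_arg a b t : a < b -> a + (b - a) * ((t - a) / (b - a)) = t.
Proof. intros ab. field. lra. Qed.

Lemma sc_arg' a b t : a < b -> (a + (b - a) * t - a) / (b - a) = t.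
Proof. intros ab. field. lra. Qed.

Lemma sc_out a b f t : a < b -> homeo_plus f -> t <= a \/ b <= t -> sc a b f t = t.
Proof.
  intros ab Hf Ht. unfold sc. rewrite (hp_out f); auto; [now apply sc_arg|].
  assert (E := sc_arg a b t ab). set (x := (t - a) / (b - a)) in *.
  destruct Ht; [left|right]; nra.
Qed.

Lemma sc_hp a b f : 0 <= a -> a < b -> b <= 1 -> homeo_plus f -> homeo_plus (sc a b f).
Proof.
  intros a0 ab b1 Hf. apply hp_intro.
  - intros s t st. unfold sc. apply Rplus_lt_compat_l, Rmult_lt_compat_l; [lra|].
    apply hp_incr; auto. apply Rmult_lt_compat_r; [apply Rinv_0_lt_compat|]; lra.
  - intros y. exists (a + (b - a) * finv f ((y - a) / (b - a))). unfold sc.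
    rewrite sc_arg' by auto. rewrite finv_r by auto. now apply sc_arg.
  - intros t Ht. apply sc_out; auto. lra.
Qed.

Lemma sc_comp a b f g : a < b -> sc a b (comp f g) = comp (sc a b f) (sc a b g).
Proof.
  intros ab. apply functional_extensionality; intros t. unfold comp, sc. now rewrite sc_arg'.
Qed.

Lemma sc_id a b : a < b -> sc a b idf = idf.
Proof. intros ab. apply functional_extensionality; intros t. now apply sc_arg. Qed.

Lemma sc_finv a b f : 0 <= a -> a < b -> b <= 1 -> homeo_plus f ->
  finv (sc a b f) = sc a b (finv f).
Proof.
  intros a0 ab b1 Hf. apply functional_extensionality; intros t.
  apply finv_unique; [now apply sc_hp|].
  change (comp (sc a b f) (sc a b (finv f)) t = t). rewrite <- sc_comp by auto.
  rewrite comp_finv_r by auto. now rewrite sc_id.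
Qed.

(** The length [b - a] need not be a power of 2: division by it cancels, so slopes are kept and the
    additive constants stay dyadic. *)
Lemma sc_F a b f : dyadic a -> dyadic b -> 0 <= a -> a < b -> b <= 1 -> thompsonF f ->
  thompsonF (sc a b f).
Proof.
  intros Da Db a0 ab b1 Hf. apply thompsonF_iff.
  split; [apply sc_hp; auto; now apply thompsonF_hp|].
  intros t. set (x := (t - a) / (b - a)). assert (Ex : a + (b - a) * x = t) by now apply sc_arg.
  destruct (thompsonF_PLat f x Hf) as
    (k & c & k' & c' & Hc & Hc' & (e & He & Hr) & (e' & He' & Hl) & Hd).
  exists k, (a - p2 k * a + (b - a) * c), k', (a - p2 k' * a + (b - a) * c').
  split; [dyad|]. split; [dyad|]. split; [|split].
  - exists ((b - a) * e). split; [nra|]. intros s Hs. unfold sc.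
    assert (Ey : a + (b - a) * ((s - a) / (b - a)) = s) by now apply sc_arg.
    set (y := (s - a) / (b - a)) in *. rewrite Hr; [|nra].
    rewrite <- Ey. ring.
  - exists ((b - a) * e'). split; [nra|]. intros s Hs. unfold sc.
    assert (Ey : a + (b - a) * ((s - a) / (b - a)) = s) by now apply sc_arg.
    set (y := (s - a) / (b - a)) in *. rewrite Hl; [|nra].
    rewrite <- Ey. ring.
  - destruct Hd as [Hd|(-> & ->)]; auto. left. rewrite <- Ex. dyad.
Qed.

Definition bump (a b : R) : R -> R := sc a b x0.

Lemma bump_lt a b t : a < t < b -> bump a b t < t.
Proof.
  intros Ht. unfold bump, sc. rewrite <- (sc_arg a b t) at 2 by lra.
  assert (E := sc_arg a b t ltac:(lra)).
  set (x := (t - a) / (b - a)) in *. assert (x0 x < x) by (apply x0_lt; nra). nra.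
Qed.

Definition Fc (f : R -> R) : Prop :=
  thompsonF f /\ exists e, 0 < e /\ forall t, t <= e \/ 1 - e <= t -> f t = t.

Lemma Fc_F f : Fc f -> thompsonF f.
Proof. intros H; apply H. Qed.

Lemma Fc_hp f : Fc f -> homeo_plus f.
Proof. intros H; now apply thompsonF_hp, Fc_F. Qed.

Lemma subgroup_Fc : is_subgroup Fc.
Proof.
  assert (HF := subgroup_thompsonF).
  apply subgroup_intro.
  - apply Fc_hp.
  - split; [now apply subgroup_id|]. exists 1. split; [lra|]. reflexivity.
  - intros f g (Hf & e & He & H) (Hg & e' & He' & H'). split; [now apply subgroup_comp|].
    exists (Rmin e e'). assert (A := Rmin_l e e'). assert (B := Rmin_r e e').
    split; [apply Rmin_glb_lt; auto|]. intros t Ht. unfold comp.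
    rewrite (H' t) by lra. apply H. lra.
  - intros f (Hf & e & He & H). split; [now apply subgroup_finv|]. exists e. split; auto.
    intros t Ht. apply finv_unique; [now apply thompsonF_hp|now apply H].
Qed.

Lemma bump_Fc a b : dyadic a -> dyadic b -> 0 < a -> a < b -> b < 1 -> Fc (bump a b).
Proof.
  intros Da Db a0 ab b1. split; [apply sc_F; auto; try lra; apply x0_F|].
  exists (Rmin a (1 - b)). split; [apply Rmin_glb_lt; lra|].
  intros t Ht. assert (A := Rmin_l a (1 - b)). assert (B := Rmin_r a (1 - b)).
  apply sc_out; auto; [apply x0_hp|]. lra.
Qed.

(** A power of [bump a b] brings [d] below [u]. A power of the inverse of [bump a b'] then lifts the
    image of [c] above [u]; it fixes [b'], which lies between [u] and [v], and so keeps the image of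
    [d] below [v]. *)
Lemma Fc_push c d u v : 0 < c -> c <= d -> d < 1 -> 0 < u -> u < v -> v < 1 ->
  exists g, Fc g /\ u < g c /\ g d < v.
Proof.
  intros c0 cd d1 u0 uv v1.
  destruct (dyadic_between 0 (Rmin c u)) as (a & Da & Ha); [apply Rmin_glb_lt; lra|].
  assert (A := Rmin_l c u). assert (B := Rmin_r c u).
  destruct (dyadic_between d 1) as (b & Db & Hb); auto.
  destruct (dyadic_between u v) as (b' & Db' & Hb'); auto.
  assert (H1 : Fc (bump a b)) by (apply bump_Fc; auto; lra).
  assert (H2 : Fc (bump a b')) by (apply bump_Fc; auto; lra).
  assert (P1 := Fc_hp _ H1). assert (P2 := Fc_hp _ H2).
  destruct (push_down (bump a b) a b d u) as (n & Hn); auto; try lra.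
  { apply bump_lt. }
  set (g1 := fpow (bump a b) n) in *.
  assert (Q1 : homeo_plus g1) by now apply fpow_hp.
  assert (Ea : g1 a = a). { apply fpow_fix. apply sc_out; [lra|apply x0_hp|lra]. }
  assert (L1 : a < g1 c). { rewrite <- Ea at 1. apply hp_incr; auto; lra. }
  assert (L2 : g1 c <= g1 d) by (apply hp_le; auto).
  destruct (push_up (finv (bump a b')) a b' (g1 c) u) as (m & Hm); auto; try lra.
  { now apply hp_finv. }
  { intros t Ht. apply (hp_lt_inv (bump a b')); auto. rewrite finv_r by auto. now apply bump_lt. }
  set (g2 := fpow (finv (bump a b')) m) in *.
  assert (Q2 : homeo_plus g2) by now apply fpow_hp, hp_finv.
  assert (Eb : g2 b' = b').
  { apply fpow_fix. apply finv_unique; auto. apply sc_out; [lra|apply x0_hp|lra]. }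
  exists (comp g2 g1). assert (HF := subgroup_Fc). split; [|split].
  - apply subgroup_comp; auto; apply subgroup_fpow; auto. now apply subgroup_finv.
  - exact Hm.
  - unfold comp. assert (g2 (g1 d) < g2 b') by (apply hp_incr; auto; lra). lra.
Qed.

(** * Words and trees *)

Inductive tree := Leaf | Node (A B : tree).

(* An interval is coded by its left endpoint and its length. *)
Fixpoint leaves (T : tree) (a l : R) : list (R * R) :=
  match T with
  | Leaf => [(a, l)]
  | Node A B => leaves A a (l / 2) ++ leaves B (a + l / 2) (l / 2)
  end.

Definition maps_affinely (g : R -> R) : list (R * R) -> list (R * R) -> Prop :=
  Forall2 (fun p q => forall s, 0 <= s <= 1 -> g (fst p + s * snd p) = fst q + s * snd q).

Lemma maps_leaves g T a l a' l' : (forall s, 0 <= s <= 1 -> g (a + s * l) = a' + s * l') ->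
  maps_affinely g (leaves T a l) (leaves T a' l').
Proof.
  revert a l a' l'. induction T; intros a l a' l' H; simpl.
  - constructor; [exact H|constructor].
  - apply Forall2_app.
    + apply IHT1. intros s Hs. replace (a + s * (l / 2)) with (a + (s / 2) * l) by field.
      rewrite H by lra. field.
    + apply IHT2. intros s Hs. replace (a + l / 2 + s * (l / 2)) with (a + ((1 + s) / 2) * l) by field.
      rewrite H by lra. field.
Qed.

Lemma maps_comp g h L1 L2 L3 : maps_affinely g L1 L2 -> maps_affinely h L2 L3 ->
  maps_affinely (comp h g) L1 L3.
Proof.
  intros H12. revert L3. induction H12 as [|p q L1 L2 H _ IH]; intros L3 H23; inversion H23; subst.
  - constructor.
  - constructor; [|now apply IH]. intros s Hs. unfold comp. rewrite H by auto. auto.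
Qed.

Lemma leaves_affine T al be a l : leaves T (al + be * a) (be * l) =
  map (fun p => (al + be * fst p, be * snd p)) (leaves T a l).
Proof.
  revert a l. induction T; intros a l; simpl; auto.
  rewrite map_app, <- IHT1, <- IHT2. f_equal; f_equal; field.
Qed.

(** The generators of the standard infinite presentation of [F]; [ev] evaluates positive words in
    them. *)
Fixpoint xn (n : nat) : R -> R := match n with O => x0 | S m => sc (1/2) 1 (xn m) end.

Fixpoint ev (w : list nat) : R -> R :=
  match w with [] => idf | n :: w' => comp (xn n) (ev w') end.

Lemma xn_F n : thompsonF (xn n).
Proof.
  induction n; [apply x0_F|]. simpl. apply sc_F; auto; try lra; [|apply (dyadic_IZR 1)].
  apply (dyadic_half 1), (dyadic_IZR 1).
Qed.

Lemma ev_F w : thompsonF (ev w).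
Proof.
  assert (HF := subgroup_thompsonF).
  induction w; simpl; [now apply subgroup_id|apply subgroup_comp; auto; apply xn_F].
Qed.

Lemma ev_map_S w : ev (map S w) = sc (1/2) 1 (ev w).
Proof. induction w; simpl; [rewrite sc_id; auto; lra|]. rewrite IHw, sc_comp; auto; lra. Qed.

Fixpoint vine (n : nat) : tree := match n with O => Leaf | S m => Node Leaf (vine m) end.

Definition from_vine (T : tree) : Prop :=
  exists w n, maps_affinely (ev w) (leaves (vine n) 0 1) (leaves T 0 1).

(** Induction on the left subtree, for all right subtrees. If it is a leaf, raising every index by
    one makes the word for [C] act on [[1/2,1]]. If it is [Node A1 A2], both hypotheses give
    [Node A1 (Node A2 C)], and [x0] performs the rotation to [Node (Node A1 A2) C]. *)
Lemma from_vine_Node A : forall C, from_vine C -> from_vine (Node A C).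
Proof.
  induction A as [|A1 IH1 A2 IH2]; intros C HC.
  - destruct HC as (w & n & H). exists (map S w), (S n). rewrite ev_map_S. simpl.
    assert (Hp := thompsonF_hp _ (ev_F w)).
    constructor.
    + intros s Hs. simpl. rewrite sc_out; auto; lra.
    + assert (LA : forall T, leaves T (0 + 1 / 2) (1 / 2) =
        map (fun p => (1/2 + 1/2 * fst p, 1/2 * snd p)) (leaves T 0 1)).
      { intros T. rewrite <- leaves_affine. f_equal; lra. }
      rewrite !LA.
      revert H. generalize (leaves (vine n) 0 1) (leaves C 0 1). intros L1 L2 H.
      induction H as [|p q L1 L2 H _ IH]; simpl; constructor; auto.
      intros s Hs. simpl. unfold sc.
      replace ((1 / 2 + 1 / 2 * fst p + s * (1 / 2 * snd p) - 1 / 2) / (1 - 1 / 2))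
        with (fst p + s * snd p) by field.
      rewrite H by auto. field.
  - destruct (IH1 _ (IH2 _ HC)) as (w & n & H). exists (0%nat :: w), n. simpl ev.
    apply (maps_comp _ _ _ _ _ H). simpl.
    rewrite <- app_assoc. apply Forall2_app; [|apply Forall2_app]; apply maps_leaves;
    intros s Hs; unfold x0; repeat destruct Rle_dec; lra.
Qed.

Lemma from_vine_all T : from_vine T.
Proof.
  induction T as [|A _ C HC]; [|now apply from_vine_Node].
  exists [], 0%nat. simpl. constructor; [|constructor]. reflexivity.
Qed.

Lemma vine_length n a l : length (leaves (vine n) a l) = S n.
Proof. revert a l. induction n; intros; simpl; auto. Qed.

Lemma maps_agree g h T a l L : maps_affinely g (leaves T a l) L -> maps_affinely h (leaves T a l) L ->
  0 < l -> forall t, a <= t <= a + l -> g t = h t.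
Proof.
  intros Hg Hh.
  assert (A : Forall (fun p => forall s, 0 <= s <= 1 -> g (fst p + s * snd p) = h (fst p + s * snd p))
     (leaves T a l)).
  { revert Hg Hh. generalize (leaves T a l). intros L1 Hg. induction Hg; intros Hh; inversion Hh; subst; constructor; auto.
    intros s Hs. rewrite H, H3; auto. }
  clear Hg Hh. revert a l A. induction T; intros a l A Hl t Ht; simpl in A.
  - inversion A; subst. simpl in *. specialize (H1 ((t - a) / l)).
    replace (a + (t - a) / l * l) with t in H1 by (field; lra). apply H1.
    split; [apply Rmult_le_pos; [lra|]; left; apply Rinv_0_lt_compat; lra|].
    apply (Rmult_le_reg_r l); auto. unfold Rdiv. rewrite Rmult_assoc, Rinv_l by lra. lra.
  - apply Forall_app in A. destruct A as [A1 A2].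
    destruct (Rle_dec t (a + l / 2)); [apply (IHT1 a (l/2))|apply (IHT2 (a + l/2) (l/2))]; auto; lra.
Qed.

(** Standard dyadic intervals, the kind that repeated halving of [[0,1]] produces. *)
Definition std (p : R * R) : Prop := exists (j : Z) (k : nat), p = (IZR j / 2 ^ k, / 2 ^ k).

Fixpoint chain (a : R) (D : list (R * R)) (b : R) : Prop :=
  match D with [] => a = b | p :: D' => fst p = a /\ chain (a + snd p) D' b end.

Lemma chain_app a D1 D2 b c : chain a D1 b -> chain b D2 c -> chain a (D1 ++ D2) c.
Proof.
  revert a. induction D1; simpl; intros x H1 H2; [now subst|]. destruct H1. split; auto.
Qed.

Lemma maps_chain g T a l D : maps_affinely g (leaves T a l) D -> chain (g a) D (g (a + l)).
Proof.
  revert a l D. induction T; intros a l D H; simpl in H.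
  - inversion H; subst. inversion H4; subst. simpl in *.
    assert (A := H2 0 ltac:(lra)). assert (B := H2 1 ltac:(lra)).
    rewrite Rmult_0_l, !Rplus_0_r, Rmult_0_l, Rplus_0_r in A. rewrite !Rmult_1_l in B. lra.
  - apply Forall2_app_inv_l in H. destruct H as (D1 & D2 & H1 & H2 & ->).
    apply chain_app with (g (a + l / 2)); [now apply IHT1|].
    replace (a + l) with (a + l/2 + l/2) by field. now apply IHT2.
Qed.

Lemma std_pos p : std p -> 0 < snd p.
Proof. intros (j & k & ->). simpl. apply Rinv_0_lt_compat, pow2_pos. Qed.

Lemma chain_le a D b : Forall std D -> chain a D b -> a <= b.
Proof.
  revert a. induction D as [|p D IH]; simpl; intros a HD H; [lra|].
  inversion HD; subst. destruct H as [_ H]. apply IH in H; auto. assert (P := std_pos p H2). lra.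
Qed.

Lemma chain_In a D b p : Forall std D -> chain a D b -> In p D -> snd p <= b - a.
Proof.
  revert a. induction D as [|q D IH]; simpl; intros a HD H Hi; [easy|].
  inversion HD; subst. destruct H as [_ H]. assert (P := std_pos q H2). destruct Hi as [->|Hi].
  - apply chain_le in H; auto. lra.
  - specialize (IH _ H3 H Hi). lra.
Qed.

Lemma dyadic_refine (j : Z) (k k' : nat) : (k <= k')%nat ->
  IZR j / 2 ^ k = IZR (j * 2 ^ Z.of_nat (k' - k)) / 2 ^ k'.
Proof.
  intros H. rewrite mult_IZR, IZR_pow2. replace (2 ^ k') with (2 ^ (k' - k) * 2 ^ k).
  - field. split; apply Rgt_not_eq, pow2_pos.
  - rewrite <- pow_add. f_equal. lia.
Qed.

(** Over the common denominator [2^k] a strict inequality of integers leaves room for one unit: a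
    dyadic number of level [n] is never interior to a cell of a level [k >= n]. *)
Lemma cell_side (j : Z) (k : nat) (m : Z) (n : nat) : (n <= k)%nat -> IZR j / 2 ^ k < IZR m / 2 ^ n ->
  IZR j / 2 ^ k + / 2 ^ k <= IZR m / 2 ^ n.
Proof.
  intros Hk H. rewrite (dyadic_refine m n k) in * by auto. assert (P := pow2_pos k).
  set (M := (m * _)%Z) in *.
  assert (j < M)%Z.
  { apply lt_IZR. apply (Rmult_lt_reg_r (/ 2 ^ k)); [now apply Rinv_0_lt_compat|]. exact H. }
  assert (IZR (j + 1) <= IZR M) by (apply IZR_le; lia). rewrite plus_IZR in H1.
  replace (IZR j / 2 ^ k + / 2 ^ k) with ((IZR j + 1) * / 2 ^ k) by (field; lra).
  apply Rmult_le_compat_r; auto. left. now apply Rinv_0_lt_compat.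
Qed.

Lemma inv_pow_lt k k' : / 2 ^ k' < / 2 ^ k -> (k < k')%nat.
Proof.
  intros H. apply Nat.nle_gt. intros H'.
  assert (2 ^ k' <= 2 ^ k) by (apply Rle_pow; [lra|auto]).
  apply Rinv_le_contravar in H0; [lra|apply pow2_pos].
Qed.

Lemma chain_split m n a D b : Forall (fun p => exists j k, (n <= k)%nat /\ p = (IZR j / 2 ^ k, / 2 ^ k)) D ->
  chain a D b -> a <= IZR m / 2 ^ n <= b ->
  exists D1 D2, D = D1 ++ D2 /\ chain a D1 (IZR m / 2 ^ n) /\ chain (IZR m / 2 ^ n) D2 b.
Proof.
  revert a. induction D as [|p D IH]; intros a HD H Hm.
  - simpl in H. exists [], []. simpl. repeat split; lra.
  - destruct (Req_dec a (IZR m / 2 ^ n)) as [->|Hne].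
    + exists [], (p :: D). repeat split; auto; apply H.
    + inversion HD as [|? ? (j & k & Hk & ->) HD']; subst. destruct H as [<- H]. simpl in *.
      assert (IZR j / 2 ^ k + / 2 ^ k <= IZR m / 2 ^ n) by (apply cell_side; auto; lra).
      destruct (IH _ HD' H ltac:(lra)) as (D1 & D2 & -> & H1 & H2).
      exists ((IZR j / 2 ^ k, / 2 ^ k) :: D1), D2. simpl. auto.
Qed.

(** If at least two intervals tile a standard interval, each is shorter than it and so has a deeper
    level. The midpoint is then interior to none of them, and the list splits there into tilings of
    the two halves. [N] bounds the length for the induction. *)
Lemma tree_of_chain N : forall D i k, (length D <= N)%nat -> Forall std D ->
  chain (IZR i / 2 ^ k) D (IZR i / 2 ^ k + / 2 ^ k) -> exists T, D = leaves T (IZR i / 2 ^ k) (/ 2 ^ k).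
Proof.
  induction N; intros D i k Hl HD Hc; assert (P := pow2_pos k);
    assert (P' := Rinv_0_lt_compat _ P).
  - destruct D; simpl in *; [lra|lia].
  - destruct D as [|p [|q D]].
    + simpl in *. lra.
    + exists Leaf. simpl in *. destruct p as [x y]; simpl in *. f_equal. f_equal; lra.
    + set (E := p :: q :: D) in *.
      assert (HE : Forall (fun p => exists j k', (S k <= k')%nat /\ p = (IZR j / 2 ^ k', / 2 ^ k')) E).
      { apply Forall_forall. intros r Hr. assert (Sr : std r) by (revert r Hr; now apply Forall_forall).
        assert (snd r < / 2 ^ k).
        { inversion HD as [|? ? Sp HD']; subst. inversion HD' as [|? ? Sq _]; subst.
          destruct Hc as [_ Hc]. assert (Q := chain_In _ _ _ q HD' Hc ltac:(now left)).
          assert (Pq := std_pos q Sq). assert (Pp := std_pos p Sp). destruct Hr as [->|Hr]; [lra|].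
          assert (Q' := chain_In _ _ _ r HD' Hc Hr). lra. }
        destruct Sr as (j & k' & ->). exists j, k'. split; auto. now apply inv_pow_lt. }
      assert (Em : IZR i / 2 ^ k + / 2 ^ k / 2 = IZR (2 * i + 1) / 2 ^ S k).
      { rewrite plus_IZR, mult_IZR. simpl. field. lra. }
      assert (Ea : IZR i / 2 ^ k = IZR (2 * i) / 2 ^ S k).
      { rewrite mult_IZR. simpl. field. lra. }
      assert (El : / 2 ^ k / 2 = / 2 ^ S k) by (simpl; field; lra).
      destruct (chain_split (2 * i + 1) (S k) _ _ _ HE Hc ltac:(lra)) as (D1 & D2 & EE & H1 & H2).
      assert (length D1 <> 0%nat). { destruct D1; [|easy]. cbn [chain] in H1. lra. }
      assert (length D2 <> 0%nat). { destruct D2; [|easy]. cbn [chain] in H2. lra. }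
      assert (LE : length E = (length D1 + length D2)%nat) by (rewrite EE; apply length_app).
      rewrite EE in HD. apply Forall_app in HD. destruct HD as [HD1 HD2].
      destruct (IHN D1 (2 * i)%Z (S k)) as (T1 & E1); auto; [lia| |].
      { rewrite <- Ea, <- El. now rewrite Em. }
      destruct (IHN D2 (2 * i + 1)%Z (S k)) as (T2 & E2); auto; [lia| |].
      { rewrite <- El, <- Em. rewrite <- Em in H2. 
        replace (IZR i / 2 ^ k + / 2 ^ k / 2 + / 2 ^ k / 2) with (IZR i / 2 ^ k + / 2 ^ k) by lra. auto. }
      exists (Node T1 T2). rewrite EE. simpl leaves. rewrite Em, El, Ea. now f_equal.
Qed.

Definition affine_cell (f : R -> R) (i : Z) (n : nat) : Prop :=
  exists (j : Z) (k : nat), forall s, 0 <= s <= 1 ->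
    f (IZR i / 2 ^ n + s * / 2 ^ n) = IZR j / 2 ^ k + s * / 2 ^ k.

Lemma affine_cells f x : thompsonF f -> dyadic_part f x ->
  exists N, forall n i, (N <= n)%nat -> (0 <= i)%Z -> IZR i / 2 ^ n + / 2 ^ n <= x -> affine_cell f i n.
Proof.
  intros Hf. induction 1 as [|x y k c Hx IH xy Hy Ht].
  - exists 0%nat. intros n i _ Hi H. exfalso. apply IZR_le in Hi. assert (P := pow2_pos n).
    assert (P' := Rinv_0_lt_compat _ P). unfold Rdiv in H. nra.
  - destruct IH as (N & IH). assert (Dx := dyadic_part_dyadic _ _ Hx).
    assert (Dc : dyadic c).
    { replace c with (f x - p2 k * x) by (rewrite Ht; lra).
      assert (dyadic (f x)) by (apply PLat_dyadic; auto; now apply thompsonF_PLat). dyad. }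
    destruct Dx as (mx & nx & Ex). destruct Dc as (mc & nc & Ec).
    (* Level at least [nx] keeps a cell from straddling [x]; level [n] at least [nc] plus the
       absolute value of [k] makes [c] an integer multiple of [2^-(n - k)], the length of the image
       cell. *)
    exists (N + nx + nc + Z.to_nat (Z.abs k))%nat. intros n i Hn Hi Hin.
    destruct (Rlt_dec (IZR i / 2 ^ n) x) as [L|L].
    + apply IH; auto; [lia|]. rewrite Ex in *. apply cell_side; auto. lia.
    + assert (P := pow2_pos n). assert (P' := Rinv_0_lt_compat _ P).
      set (k' := Z.to_nat (Z.of_nat n - k)).
      assert (Ek : p2 k * / 2 ^ n = / 2 ^ k').
      { assert (Q := pow2_pos k'). apply (Rmult_eq_reg_r (2 ^ k')); [|lra].
        rewrite Rinv_l by lra. unfold k'. rewrite !pow_powerRZ. rewrite Z2Nat.id by lia.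
        replace (p2 k * / p2 (Z.of_nat n) * p2 (Z.of_nat n - k)) with
          ((p2 k * p2 (Z.of_nat n - k)) * / p2 (Z.of_nat n)) by ring.
        rewrite <- p2_add. replace (k + (Z.of_nat n - k))%Z with (Z.of_nat n) by lia.
        apply Rinv_r. apply Rgt_not_eq, p2_pos. }
      exists (i + mc * 2 ^ Z.of_nat (k' - nc))%Z, k'. intros s Hs.
      rewrite Ht by nra. rewrite Ec, (dyadic_refine mc nc k') by lia.
      rewrite plus_IZR. set (M := IZR (mc * _)).
      replace (p2 k * (IZR i / 2 ^ n + s * / 2 ^ n) + M / 2 ^ k') with
        ((IZR i + s) * (p2 k * / 2 ^ n) + M * / 2 ^ k') by (unfold Rdiv; ring).
      rewrite Ek. unfold Rdiv; ring.
Qed.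

Fixpoint full (n : nat) : tree := match n with O => Leaf | S m => Node (full m) (full m) end.

Lemma full_affine f d : forall i n, (0 <= i)%Z -> IZR i / 2 ^ n + / 2 ^ n <= 1 ->
  (forall j, (0 <= j)%Z -> IZR j / 2 ^ (n + d) + / 2 ^ (n + d) <= 1 -> affine_cell f j (n + d)) ->
  exists D, maps_affinely f (leaves (full d) (IZR i / 2 ^ n) (/ 2 ^ n)) D /\ Forall std D.
Proof.
  induction d; intros i n Hi Hin H.
  - rewrite Nat.add_0_r in H. destruct (H i Hi Hin) as (j & k & Hjk).
    exists [(IZR j / 2 ^ k, / 2 ^ k)]. split; constructor; try constructor; auto.
    now exists j, k.
  - assert (P := pow2_pos n). assert (P' := Rinv_0_lt_compat _ P).
    assert (Em : IZR i / 2 ^ n + / 2 ^ n / 2 = IZR (2 * i + 1) / 2 ^ S n).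
    { rewrite plus_IZR, mult_IZR. simpl. field. lra. }
    assert (Ea : IZR i / 2 ^ n = IZR (2 * i) / 2 ^ S n).
    { rewrite mult_IZR. simpl. field. lra. }
    assert (El : / 2 ^ n / 2 = / 2 ^ S n) by (simpl; field; lra).
    replace (n + S d)%nat with (S n + d)%nat in H by lia.
    destruct (IHd (2 * i)%Z (S n)) as (D1 & M1 & S1); auto; [lia|lra|].
    destruct (IHd (2 * i + 1)%Z (S n)) as (D2 & M2 & S2); auto; [lia|lra|].
    exists (D1 ++ D2). split; [|apply Forall_app; auto].
    simpl leaves. rewrite Em, El, Ea. now apply Forall2_app.
Qed.

(* Both [f o ev w1] and [ev w2] carry a vine affinely onto the same tree. *)
Lemma thompsonF_words f : thompsonF f -> exists w1 w2, comp f (ev w1) = ev w2.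
Proof.
  intros Hf. assert (Hp := thompsonF_hp _ Hf).
  assert (Hd : dyadic_part f 1).
  { apply dyadic_part_exists. intros t. now apply thompsonF_PLat. }
  destruct (affine_cells f 1 Hf Hd) as (N & HN).
  destruct (full_affine f N 0 0) as (D & HD & SD); [lia|simpl; lra| |].
  { intros j Hj H. apply HN; auto. }
  assert (E0 : IZR 0 / 2 ^ 0 = 0) by (simpl; field).
  assert (E1 : / 2 ^ 0 = 1) by (simpl; field).
  destruct (tree_of_chain (length D) D 0 0) as (T & ET); auto.
  { assert (C := maps_chain _ _ _ _ _ HD). rewrite E0, E1 in *.
    now rewrite !hp_out in C by (auto; lra). }
  rewrite E0, E1 in *.
  destruct (from_vine_all (full N)) as (w1 & n1 & H1).
  destruct (from_vine_all T) as (w2 & n2 & H2).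
  exists w1, w2. rewrite ET in HD.
  (* An affine correspondence preserves the number of leaves, and a vine is determined by that
     number. *)
  assert (n1 = n2).
  { apply Forall2_length in H1, H2, HD. rewrite vine_length in *. lia. }
  subst n2. assert (H3 := maps_comp _ _ _ _ _ H1 HD).
  assert (Q1 := thompsonF_hp _ (ev_F w1)). assert (Q2 := thompsonF_hp _ (ev_F w2)).
  apply functional_extensionality. intros t.
  destruct (Rle_dec t 0) as [t0|t0]; [|destruct (Rle_dec 1 t) as [t1|t1]].
  1,2: unfold comp; rewrite (hp_out (ev w1)), (hp_out f), (hp_out (ev w2)); auto.
  apply (maps_agree _ _ _ _ _ _ H3 H2); lra.
Qed.

(** * Germs at the endpoints and perfectness *)

(** The additive constants 0 here and [1 - p2 k] in [rho] are those forced by fixing the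
    endpoint. *)
Definition lam (f : R -> R) (k : Z) : Prop := rgerm f 0 k 0.
Definition rho (f : R -> R) (k : Z) : Prop := lgerm f 1 k (1 - p2 k).

Lemma lam_exists f : thompsonF f -> exists k, lam f k.
Proof.
  intros Hf. destruct (thompsonF_PLat f 0 Hf) as (k & c & _ & _ & _ & _ & H & _).
  exists k. assert (E := rgerm_at _ _ _ _ H). rewrite hp_out in E by (try apply thompsonF_hp; auto; lra).
  unfold lam. now replace c with 0 in H by lra.
Qed.

Lemma rho_exists f : thompsonF f -> exists k, rho f k.
Proof.
  intros Hf. destruct (thompsonF_PLat f 1 Hf) as (_ & _ & k & c & _ & _ & _ & H & _).
  exists k. assert (E := lgerm_at _ _ _ _ H). rewrite hp_out in E by (try apply thompsonF_hp; auto; lra).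
  unfold rho. now replace (1 - p2 k) with c by lra.
Qed.

Lemma lam_unique f j k : lam f j -> lam f k -> j = k.
Proof. apply rgerm_unique. Qed.

Lemma rho_unique f j k : rho f j -> rho f k -> j = k.
Proof.
  intros (e & He & H) (e' & He' & H'). set (m := Rmin e e').
  assert (0 < m) by (apply Rmin_glb_lt; auto).
  assert (m <= e) by apply Rmin_l. assert (m <= e') by apply Rmin_r.
  apply p2_inj. assert (B := H (1 - m) ltac:(lra)). rewrite (H' (1 - m) ltac:(lra)) in B. nra.
Qed.

Lemma lam_at f k : lam f k -> f 0 = 0.
Proof. intros H. apply rgerm_at in H. lra. Qed.

Lemma rho_at f k : rho f k -> f 1 = 1.
Proof. intros H. apply lgerm_at in H. lra. Qed.

Lemma lam_comp f g j k : lam f j -> lam g k -> lam (comp f g) (j + k).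
Proof.
  intros Hf Hg. unfold lam. replace 0 with (p2 j * 0 + 0) at 2 by ring.
  apply rgerm_comp; auto. now rewrite (lam_at g k).
Qed.

Lemma rho_comp f g j k : rho f j -> rho g k -> rho (comp f g) (j + k).
Proof.
  intros Hf Hg. unfold rho. rewrite p2_add.
  replace (1 - p2 j * p2 k) with (p2 j * (1 - p2 k) + (1 - p2 j)) by ring.
  apply lgerm_comp; auto. now rewrite (rho_at g k).
Qed.

Lemma lam_finv f k : homeo_plus f -> lam f k -> lam (finv f) (- k).
Proof.
  intros Hf H. unfold lam. replace 0 with (- (p2 (- k) * 0)) at 2 by ring.
  rewrite <- (lam_at f k H) at 1. apply rgerm_inv; auto. intros s. now apply finv_l.
Qed.

Lemma rho_finv f k : homeo_plus f -> rho f k -> rho (finv f) (- k).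
Proof.
  intros Hf H. unfold rho.
  replace (1 - p2 (- k)) with (- (p2 (- k) * (1 - p2 k))) by (assert (Q := p2_oppl k); lra).
  rewrite <- (rho_at f k H) at 1. apply lgerm_inv; auto. intros s. now apply finv_l.
Qed.

Lemma lam_id : lam idf 0.
Proof. exists 1. split; [lra|]. intros s _. unfold idf; simpl; lra. Qed.

Lemma rho_id : rho idf 0.
Proof. exists 1. split; [lra|]. intros s _. unfold idf; simpl; lra. Qed.

Lemma lam_zero f : homeo_plus f -> lam f 0 <-> exists e, 0 < e /\ forall t, t <= e -> f t = t.
Proof.
  intros Hf. split; intros (e & He & H); exists e; split; auto; intros t Ht.
  - destruct (Rle_dec t 0); [apply hp_out; auto|]. rewrite H; simpl; lra.
  - rewrite H; simpl; lra.
Qed.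

Lemma rho_zero f : homeo_plus f -> rho f 0 <-> exists e, 0 < e /\ forall t, 1 - e <= t -> f t = t.
Proof.
  intros Hf. split; intros (e & He & H); exists e; split; auto; intros t Ht.
  - destruct (Rle_dec 1 t); [apply hp_out; auto|]. rewrite H; simpl; lra.
  - rewrite H; simpl; lra.
Qed.

Lemma Fc_iff f : Fc f <-> thompsonF f /\ lam f 0 /\ rho f 0.
Proof.
  split.
  - intros (Hf & e & He & H). assert (Hp := thompsonF_hp _ Hf). split; auto.
    split; [apply lam_zero|apply rho_zero]; auto; exists e; split; auto.
  - intros (Hf & H1 & H2). assert (Hp := thompsonF_hp _ Hf). split; auto.
    apply lam_zero in H1; auto. apply rho_zero in H2; auto.
    destruct H1 as (e & He & H1). destruct H2 as (e' & He' & H2).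
    exists (Rmin e e'). assert (A := Rmin_l e e'). assert (B := Rmin_r e e').
    split; [apply Rmin_glb_lt; auto|]. intros t [Ht|Ht]; [apply H1|apply H2]; lra.
Qed.

Lemma lam_xn n : lam (xn n) (match n with O => -1 | S _ => 0 end).
Proof.
  destruct n.
  - exists (1/2). split; [lra|]. intros s Hs. simpl. unfold x0. repeat destruct Rle_dec; lra.
  - apply lam_zero; [apply thompsonF_hp, xn_F|]. exists (1/2). split; [lra|]. intros t Ht.
    simpl. apply sc_out; [lra|apply thompsonF_hp, xn_F|lra].
Qed.

Lemma rho_xn n : rho (xn n) 1.
Proof.
  induction n as [|n (e & He & H)].
  - exists (1/4). split; [lra|]. intros s Hs. simpl. unfold x0. repeat destruct Rle_dec; lra.
  - exists (e / 2). split; [lra|]. intros s Hs. simpl xn. unfold sc.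
    set (y := (s - 1/2) / (1 - 1/2)). assert (Ey : y = 2 * s - 1) by (unfold y; field).
    rewrite H by lra. simpl. rewrite Ey. lra.
Qed.

Fixpoint zeros (w : list nat) : nat :=
  match w with [] => 0 | O :: w' => S (zeros w') | S _ :: w' => zeros w' end.

Fixpoint nonzeros (w : list nat) : nat :=
  match w with [] => 0 | O :: w' => nonzeros w' | S _ :: w' => S (nonzeros w') end.

Lemma lam_ev w : lam (ev w) (- Z.of_nat (zeros w)).
Proof.
  induction w as [|n w IH]; [apply lam_id|]. simpl ev.
  assert (H := lam_comp _ _ _ _ (lam_xn n) IH).
  replace (- Z.of_nat (zeros (n :: w)))%Z with
    (match n with O => -1 | S _ => 0 end + - Z.of_nat (zeros w))%Z; auto. destruct n; simpl zeros; lia.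
Qed.

(** Every letter has slope 2 at 1, while only the letter 0 has a nontrivial germ at 0. Hence the two
    germs of a word determine both letter counts. *)
Lemma rho_ev w : rho (ev w) (Z.of_nat (zeros w + nonzeros w)).
Proof.
  induction w as [|n w IH]; [apply rho_id|]. simpl ev.
  assert (H := rho_comp _ _ _ _ (rho_xn n) IH).
  replace (Z.of_nat (zeros (n :: w) + nonzeros (n :: w))) with
    (1 + Z.of_nat (zeros w + nonzeros w))%Z; auto. destruct n; cbn [zeros nonzeros]; lia.
Qed.

Definition commf (u v : R -> R) : R -> R := comp u (comp v (comp (finv u) (finv v))).

Lemma conj_comm g a b : homeo_plus g -> homeo_plus a -> homeo_plus b ->
  conjf g (commf a b) = commf (conjf g a) (conjf g b).
Proof. intros Hg Ha Hb. unfold commf. now rewrite !conj_comp, !conj_finv. Qed.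

Lemma subgroup_commf S u v : is_subgroup S -> S u -> S v -> S (commf u v).
Proof.
  intros HS Hu Hv. unfold commf. apply subgroup_comp; auto. apply subgroup_comp; auto.
  apply subgroup_comp; auto; now apply subgroup_finv.
Qed.

(** The support of [xn (S (S n))] lies in [[3/4,1]], where [x0] is the affine map onto [[1/2,1]].
    Thus all generators of positive index are conjugate under powers of [x0]. *)
Lemma x0_conj_xn n : conjf x0 (xn (S (S n))) = xn (S n).
Proof.
  assert (H0 := x0_hp). assert (Hn := thompsonF_hp _ (xn_F n)).
  assert (H1 := thompsonF_hp _ (xn_F (S n))).
  apply functional_extensionality. intros y. rewrite <- (finv_r x0 y) by auto.
  rewrite conj_app by auto. generalize (finv x0 y). clear y. intros t.
  change (xn (S (S n))) with (sc (1/2) 1 (xn (S n))).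
  destruct (Rle_dec t (3/4)) as [H|H]; [|destruct (Rle_dec 1 t) as [H'|H']].
  - assert (E : sc (1/2) 1 (xn (S n)) t = t).
    { unfold sc. simpl xn. rewrite sc_out; auto; [field|lra|]. left.
      replace ((t - 1/2) / (1 - 1/2)) with (2 * t - 1) by field. lra. }
    rewrite E. simpl xn. rewrite sc_out; auto; [lra|]. left.
    apply (Rle_trans _ (x0 (3/4))); [now apply hp_le|].
    unfold x0. repeat destruct Rle_dec; lra.
  - rewrite sc_out by (auto; lra). rewrite (hp_out x0 t) by (auto; lra).
    rewrite hp_out; auto.
  - assert (E : x0 t = 2 * t - 1) by (unfold x0; repeat destruct Rle_dec; lra).
    rewrite E. simpl xn. unfold sc.
    replace (((t - 1 / 2) / (1 - 1 / 2) - 1 / 2) / (1 - 1 / 2)) with (4 * t - 3) by field.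
    replace ((2 * t - 1 - 1 / 2) / (1 - 1 / 2)) with (4 * t - 3) by field.
    assert (A : xn n 0 < xn n (4 * t - 3)) by (apply hp_incr; auto; lra).
    assert (B : xn n (4 * t - 3) < xn n 1) by (apply hp_incr; auto; lra).
    rewrite (hp_out (xn n) 0) in A by (auto; lra). rewrite (hp_out (xn n) 1) in B by (auto; lra).
    set (z := xn n (4 * t - 3)) in *. unfold x0. repeat destruct Rle_dec; lra.
Qed.

(** * Perfectness of [Fc] *)

Section Perfect.

(** An arbitrary subgroup containing the commutators of [Fc] replaces the derived subgroup. It need
    not lie inside [Fc], which lets the result be applied to any property that commutators have and
    that is closed under the group operations. *)
Variable N : (R -> R) -> Prop.
Hypothesis HN : is_subgroup N.
Hypothesis HNc : forall u v, Fc u -> Fc v -> N (commf u v).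

Let eqN (u v : R -> R) : Prop := N (comp u (finv v)).

Lemma perfect_conj u n : Fc u -> Fc n -> N n -> N (conjf u n).
Proof.
  intros Hu Hn Nn. assert (Hn' := Fc_hp _ Hn).
  replace (conjf u n) with (comp (commf u n) n).
  - apply subgroup_comp; auto.
  - apply functional_extensionality; intros t. unfold conjf, commf, comp. now rewrite finv_l.
Qed.

Lemma eqN_refl u : Fc u -> eqN u u.
Proof. intros Hu. unfold eqN. rewrite comp_finv_r by now apply Fc_hp. now apply subgroup_id. Qed.

Lemma eqN_sym u v : Fc u -> Fc v -> eqN u v -> eqN v u.
Proof.
  intros Hu Hv H. apply Fc_hp in Hu, Hv. unfold eqN in *. apply subgroup_finv in H; auto.
  rewrite finv_comp, finv_finv in H; auto. now apply hp_finv.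
Qed.

Lemma eqN_trans u v w : Fc u -> Fc v -> Fc w -> eqN u v -> eqN v w -> eqN u w.
Proof.
  intros Hu Hv Hw H1 H2. apply Fc_hp in Hu, Hv, Hw. unfold eqN in *.
  replace (comp u (finv w)) with (comp (comp u (finv v)) (comp v (finv w))).
  - now apply subgroup_comp.
  - apply functional_extensionality; intros t. unfold comp. now rewrite finv_l.
Qed.

Lemma eqN_comp u v u' v' : Fc u -> Fc v -> Fc u' -> Fc v' -> eqN u v -> eqN u' v' ->
  eqN (comp u u') (comp v v').
Proof.
  intros Hu Hv Hu' Hv' H H'. assert (G := subgroup_Fc).
  assert (K : Fc (comp u' (finv v'))) by (apply subgroup_comp; auto; now apply subgroup_finv).
  unfold eqN in *. apply (perfect_conj u) in H'; auto.
  apply Fc_hp in Hu, Hv, Hu', Hv'.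
  rewrite finv_comp by auto.
  replace (comp (comp u u') (comp (finv v') (finv v))) with
    (comp (conjf u (comp u' (finv v'))) (comp u (finv v))).
  - now apply subgroup_comp.
  - apply functional_extensionality; intros t. unfold conjf, comp. now rewrite finv_l.
Qed.

Lemma eqN_swap u v : Fc u -> Fc v -> eqN (comp u v) (comp v u).
Proof.
  intros Hu Hv. unfold eqN. rewrite finv_comp by now apply Fc_hp. now apply HNc.
Qed.

Lemma eqN_conj u v : Fc u -> Fc v -> eqN (conjf u v) v.
Proof. intros Hu Hv. unfold eqN. now apply (HNc u v). Qed.

(** The generators have slope 2 at 1 and are not in [Fc]; their copies in [[1/4,1/2]] are. *)
Let yn n := sc (1/4) (1/2) (xn n).
Let Y w := sc (1/4) (1/2) (ev w).

Lemma sc_quarter_Fc f : thompsonF f -> Fc (sc (1/4) (1/2) f).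
Proof.
  intros Hf. assert (D : dyadic (1/2)) by apply (dyadic_half 1), (dyadic_IZR 1).
  assert (D' : dyadic (1/4)) by (replace (1/4) with (1/2/2) by field; now apply dyadic_half).
  split; [apply sc_F; auto; lra|]. exists (1/4). split; [lra|].
  intros t Ht. apply sc_out; [lra|now apply thompsonF_hp|lra].
Qed.

(** The copy of [x0] conjugates [yn (S (S n))] to [yn (S n)], and elements conjugate in [Fc] differ
    by a commutator. *)
Lemma yn_eq n : eqN (yn (S n)) (yn 1%nat).
Proof.
  assert (HY : forall n, Fc (yn n)) by (intros; apply sc_quarter_Fc, xn_F).
  induction n; [now apply eqN_refl|].
  apply (eqN_trans _ (yn (S n))); auto.
  apply eqN_sym; auto.
  replace (yn (S n)) with (conjf (yn 0%nat) (yn (S (S n)))); [now apply eqN_conj|].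
  unfold yn, conjf. rewrite sc_finv by (try lra; apply x0_hp).
  rewrite <- !sc_comp by lra. f_equal. apply x0_conj_xn.
Qed.

(** Modulo [N] letters commute and letters of positive index coincide, so only the two counts of a
    word survive. *)
Lemma Y_eq w : eqN (Y w) (comp (fpow (yn 0%nat) (zeros w)) (fpow (yn 1%nat) (nonzeros w))).
Proof.
  assert (HY : forall n, Fc (yn n)) by (intros; apply sc_quarter_Fc, xn_F).
  assert (HYw : forall w, Fc (Y w)) by (intros; apply sc_quarter_Fc, ev_F).
  assert (G := subgroup_Fc).
  assert (HP : forall n m, Fc (fpow (yn n) m)) by (intros; now apply subgroup_fpow).
  induction w as [|n w IH].
  - unfold Y. simpl. rewrite sc_id by lra. apply (eqN_refl idf). now apply subgroup_id.
  - assert (E : Y (n :: w) = comp (yn n) (Y w)) by (unfold Y; simpl; now rewrite sc_comp by lra).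
    rewrite E. set (p := fpow (yn 0%nat) (zeros w)) in *. set (q := fpow (yn 1%nat) (nonzeros w)) in *.
    assert (Hp : Fc p) by apply HP. assert (Hq : Fc q) by apply HP.
    assert (Hpq : Fc (comp p q)) by (apply subgroup_comp; auto).
    destruct n; simpl.
    + change (comp (comp (yn 0%nat) p) q) with (comp (yn 0%nat) (comp p q)).
      apply (eqN_comp (yn 0%nat) (yn 0%nat) (Y w) (comp p q)); auto. now apply eqN_refl.
    + change (comp p (comp (yn 1%nat) q)) with (comp (comp p (yn 1%nat)) q).
      assert (H1 : Fc (comp p (yn 1%nat))) by (apply subgroup_comp; auto).
      assert (H2 : Fc (comp (yn 1%nat) p)) by (apply subgroup_comp; auto).
      assert (H3 : Fc (comp (comp p (yn 1%nat)) q)) by (apply subgroup_comp; auto).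
      assert (H4 : Fc (comp (comp (yn 1%nat) p) q)) by (apply subgroup_comp; auto).
      assert (H5 : Fc (comp (yn (S n)) (Y w))) by (apply subgroup_comp; auto).
      apply (eqN_trans _ (comp (comp (yn 1%nat) p) q)); auto.
      * change (comp (comp (yn 1%nat) p) q) with (comp (yn 1%nat) (comp p q)).
        apply (eqN_comp (yn (S n)) (yn 1%nat) (Y w) (comp p q)); auto. apply yn_eq.
      * apply (eqN_comp (comp (yn 1%nat) p) (comp p (yn 1%nat)) q q); auto; [now apply eqN_swap|now apply eqN_refl].
Qed.

(** Magnification by [t -> 4 t - 1]. Its slope is a power of 2, so dyadic germs are respected, and
    the margins [1/4 < a] and [b < 1/2] leave the magnified map trivial near 0 and 1. *)
Lemma unscale f a b : Fc f -> 1/4 < a -> b < 1/2 -> (forall t, t <= a \/ b <= t -> f t = t) ->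
  exists f0, Fc f0 /\ f = sc (1/4) (1/2) f0.
Proof.
  intros Hf Ha Hb H. assert (Hp := Fc_hp _ Hf). assert (HF := Fc_F _ Hf).
  set (al := fun t => p2 (-2) * t + 1/4). set (al' := fun t => p2 2 * t + -1).
  assert (P2 : p2 2 = 4) by (simpl; lra). assert (P2' : p2 (-2) = 1/4) by (simpl; field).
  assert (PL : forall t, PLat al t).
  { intros t. apply (PLat_affine _ _ (-2) (1/4) 1); [lra| |reflexivity].
    exists 1%Z, 2%nat. simpl. field. }
  assert (PL' : forall t, PLat al' t).
  { intros t. apply (PLat_affine _ _ 2 (-1) 1); [lra|apply (dyadic_IZR (-1))|reflexivity]. }
  exists (comp al' (comp f al)). split.
  - split.
    + apply thompsonF_iff. split.
      * apply hp_intro; unfold comp, al, al'; rewrite P2, P2'.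
        -- intros s t st. assert (f (1 / 4 * s + 1 / 4) < f (1 / 4 * t + 1 / 4)) by (apply hp_incr; auto; lra).
           lra.
        -- intros y. exists (4 * finv f ((y + 1) / 4) - 1).
           replace (1 / 4 * (4 * finv f ((y + 1) / 4) - 1) + 1 / 4) with (finv f ((y + 1) / 4)) by field.
           rewrite finv_r by auto. field.
        -- intros t Ht. rewrite H by lra. lra.
      * intros t. apply PLat_comp; auto. apply PLat_comp; auto. now apply thompsonF_PLat.
    + exists (Rmin (4 * a - 1) (2 - 4 * b)).
      assert (A := Rmin_l (4 * a - 1) (2 - 4 * b)). assert (B := Rmin_r (4 * a - 1) (2 - 4 * b)).
      split; [apply Rmin_glb_lt; lra|]. intros t Ht. unfold comp, al, al'. rewrite P2, P2', H; lra.
  - apply functional_extensionality; intros t. unfold sc, comp, al, al'. rewrite P2, P2'.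
    replace (1 / 4 * ((t - 1 / 4) / (1 / 2 - 1 / 4)) + 1 / 4) with t by field. field.
Qed.

(** Conjugate [f] so that it lives strictly inside [[1/4,1/2]], and magnify it to [f0], a quotient
    of two positive words. Since [f0] has trivial germs at both ends, the two words have equal
    counts, so their copies agree modulo [N], and these copies differ by the conjugate of [f]. *)
Lemma Fc_perfect : subset Fc N.
Proof.
  intros f Hf. assert (G := subgroup_Fc). assert (Hp := Fc_hp _ Hf).
  destruct (Hf) as (_ & e & He & H).
  set (e1 := Rmin e (1/4)). assert (e1 <= e) by apply Rmin_l. assert (e1 <= 1/4) by apply Rmin_r.
  assert (0 < e1) by (apply Rmin_glb_lt; lra).
  destruct (Fc_push e1 (1 - e1) (1/4) (1/2)) as (g & Hg & g1 & g2); try lra.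
  assert (Hpg := Fc_hp _ Hg).
  assert (Hf' : Fc (conjf g f)) by now apply subgroup_conj.
  destruct (unscale (conjf g f) (g e1) (g (1 - e1))) as (f0 & Hf0 & E); auto.
  { intros t Ht. rewrite <- (finv_r g t) in Ht |- * by auto. rewrite conj_app by auto. f_equal. apply H.
    destruct Ht as [Ht|Ht]; apply (hp_le_inv g) in Ht; auto; lra. }
  apply Fc_iff in Hf0. destruct Hf0 as (F0 & L0 & R0).
  destruct (thompsonF_words f0 F0) as (w1 & w2 & Ew).
  assert (Z1 : zeros w1 = zeros w2).
  { assert (A := lam_comp _ _ _ _ L0 (lam_ev w1)). rewrite Ew in A.
    assert (B := lam_unique _ _ _ A (lam_ev w2)). lia. }
  assert (Z2 : nonzeros w1 = nonzeros w2).
  { assert (A := rho_comp _ _ _ _ R0 (rho_ev w1)). rewrite Ew in A.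
    assert (B := rho_unique _ _ _ A (rho_ev w2)). lia. }
  assert (HYw : forall w, Fc (Y w)) by (intros; apply sc_quarter_Fc, ev_F).
  assert (HP : forall n m, Fc (fpow (yn n) m)).
  { intros. apply subgroup_fpow; auto. apply sc_quarter_Fc, xn_F. }
  assert (EY : eqN (Y w2) (Y w1)).
  { assert (A1 := Y_eq w1). assert (A2 := Y_eq w2). rewrite Z1, Z2 in A1.
    apply (eqN_trans _ (comp (fpow (yn 0%nat) (zeros w2)) (fpow (yn 1%nat) (nonzeros w2)))); auto.
    - now apply subgroup_comp.
    - apply eqN_sym; auto. now apply subgroup_comp. }
  assert (Nf' : N (conjf g f)).
  { unfold eqN in EY. replace (conjf g f) with (comp (Y w2) (finv (Y w1))); auto.
    replace (Y w2) with (comp (conjf g f) (Y w1)).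
    - apply functional_extensionality; intros t. unfold comp. rewrite finv_r; auto. now apply Fc_hp.
    - rewrite E. unfold Y. rewrite <- sc_comp by lra. now rewrite Ew. }
  rewrite <- (conj_finvK g f) by auto. apply perfect_conj; auto. now apply subgroup_finv.
Qed.

End Perfect.

(* Conjugate [a] and [b] into an interval that [n] moves off itself: there [a n a^-1 n^-1] acts
   as [a], so its commutator with [b] is the commutator of [a] and [b]. *)
Lemma Fc_in_normalized N n : is_subgroup N -> (forall u f, Fc u -> N f -> N (conjf u f)) ->
  N n -> n <> idf -> subset Fc N.
Proof.
  intros HN Hc Nn Hne. apply Fc_perfect; auto. intros a b Ha Hb.
  assert (G := subgroup_Fc).
  assert (Hn := subgroup_hp _ _ HN Nn).
  assert (exists t, n t <> t) as (t & Ht).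
  { apply NNPP. intros Hno. apply Hne. apply functional_extensionality. intros t.
    apply NNPP. intros H. apply Hno. now exists t. }
  assert (It : 0 < t < 1).
  { apply NNPP. intros H. apply Ht. apply hp_out; auto. lra. }
  assert (Int : 0 < n t < 1).
  { assert (A : n 0 < n t) by (apply hp_incr; auto; lra).
    assert (B : n t < n 1) by (apply hp_incr; auto; lra).
    rewrite (hp_out n 0) in A by (auto; lra). rewrite (hp_out n 1) in B by (auto; lra). lra. }
  set (u := Rmin t (n t)). set (v := Rmax t (n t)).
  assert (Huv : 0 < u /\ u < v /\ v < 1).
  { unfold u, v, Rmin, Rmax. destruct Rle_dec; lra. }
  assert (exists g, Fc g /\ (forall t, t <= u \/ v <= t -> conjf g a t = t)
     /\ (forall t, t <= u \/ v <= t -> conjf g b t = t)) as (g & Hg & Sa & Sb).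
  { destruct Ha as (_ & e & He & H). destruct Hb as (_ & e' & He' & H').
    set (e1 := Rmin (Rmin e e') (1/4)).
    assert (e1 <= Rmin e e') by apply Rmin_l. assert (e1 <= 1/4) by apply Rmin_r.
    assert (A := Rmin_l e e'). assert (B := Rmin_r e e').
    assert (0 < e1) by (repeat apply Rmin_glb_lt; lra).
    destruct (Fc_push e1 (1 - e1) u v) as (g & Hg & g1 & g2); try lra.
    assert (Hpg := Fc_hp _ Hg).
    exists g. split; auto. split; intros s Hs; rewrite <- (finv_r g s) by auto; rewrite conj_app by auto;
    f_equal; [apply H|apply H'].
    all: rewrite <- (finv_r g s) in Hs by auto;
    destruct Hs as [Hs|Hs]; [left; assert (finv g s < e1)|right; assert (1 - e1 < finv g s)];
    try apply (hp_lt_inv g); auto; lra. }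
  assert (Hpg := Fc_hp _ Hg).
  assert (Ha' : Fc (conjf g a)) by now apply subgroup_conj.
  assert (Hb' : Fc (conjf g b)) by now apply subgroup_conj.
  set (a' := conjf g a) in *. set (b' := conjf g b) in *.
  assert (Pa := Fc_hp _ Ha'). assert (Pb := Fc_hp _ Hb').
  (* Supported in the image of [(u, v)] under [n], which is disjoint from [(u, v)]; so [m] commutes
     with [b']. *)
  set (m := conjf n (finv a')).
  assert (Hm : homeo_plus m) by (apply hp_conj; auto; now apply hp_finv).
  assert (Ca : forall r, r <= u \/ v <= r -> finv a' r = r) by (intros; apply finv_unique; auto).
  assert (C : forall s, m (b' s) = b' (m s)).
  { intros s. destruct (Rtotal_order t (n t)) as [L|[L|L]]; [|lra|].
    - assert (Eu : u = t) by (unfold u, Rmin; destruct Rle_dec; lra).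
      assert (Ev : v = n t) by (unfold v, Rmax; destruct Rle_dec; lra).
      assert (Mi : forall s, s <= v -> m s = s).
      { intros r Hr. rewrite <- (finv_r n r) by auto. unfold m. rewrite conj_app by auto. f_equal.
        apply Ca. left. rewrite Eu. apply (hp_le_inv n); auto. rewrite finv_r by auto. lra. }
      destruct (Rle_dec s v) as [Hs|Hs].
      + assert (b' s <= b' v) by (now apply hp_le). rewrite (Sb v) in H by lra. now rewrite !Mi.
      + rewrite (Sb s) by lra. assert (m v <= m s) by (apply hp_le; auto; lra).
        rewrite (Mi v) in H by lra. rewrite Sb; auto.
    - assert (Eu : u = n t) by (unfold u, Rmin; destruct Rle_dec; lra).
      assert (Ev : v = t) by (unfold v, Rmax; destruct Rle_dec; lra).
      assert (Mi : forall s, u <= s -> m s = s).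
      { intros r Hr. rewrite <- (finv_r n r) by auto. unfold m. rewrite conj_app by auto. f_equal.
        apply Ca. right. rewrite Ev. apply (hp_le_inv n); auto. rewrite finv_r by auto. lra. }
      destruct (Rle_dec u s) as [Hs|Hs].
      + assert (b' u <= b' s) by (now apply hp_le). rewrite (Sb u) in H by lra. now rewrite !Mi.
      + rewrite (Sb s) by lra. assert (m s <= m u) by (apply hp_le; auto; lra).
        rewrite (Mi u) in H by lra. rewrite Sb; auto. }
  set (k := comp a' m).
  assert (Nk : N k).
  { change k with (comp (conjf a' n) (finv n)). apply subgroup_comp; auto. now apply subgroup_finv. }
  assert (Hk := subgroup_hp _ _ HN Nk).
  assert (Nab : N (commf a' b')).
  { replace (commf a' b') with (comp k (conjf b' (finv k))).
    - apply subgroup_comp; auto. apply Hc; auto. now apply subgroup_finv.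
    - unfold k. rewrite finv_comp by auto. apply functional_extensionality. intros s.
      unfold conjf, commf, comp. rewrite C. now rewrite finv_r. }
  rewrite <- (conj_finvK g (commf a b)) by auto. apply Hc; [now apply subgroup_finv|].
  rewrite conj_comm by (auto; now apply Fc_hp). exact Nab.
Qed.

(** * Finite index subgroups and centralizers *)

Lemma pigeonhole_lt n (c : nat -> nat) : (forall m, (m <= n)%nat -> (c m < n)%nat) ->
  exists a b, (a < b <= n)%nat /\ c a = c b.
Proof.
  intros Hc. apply NNPP. intros Hno.
  assert (ND : NoDup (map c (seq 0 (S n)))).
  { apply NoDup_map_NoDup_ForallPairs; [|apply seq_NoDup].
    intros a b Ha Hb E. apply in_seq in Ha, Hb.
    destruct (Nat.lt_trichotomy a b) as [L|[L|L]]; auto; exfalso; apply Hno;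
    [exists a, b|exists b, a]; split; auto; lia. }
  assert (I : incl (map c (seq 0 (S n))) (seq 0 n)).
  { intros x Hx. apply in_map_iff in Hx. destruct Hx as (m & <- & Hm). apply in_seq in Hm.
    apply in_seq. specialize (Hc m ltac:(lia)). lia. }
  apply NoDup_incl_length in I; auto. rewrite length_map, !length_seq in I. lia.
Qed.

Lemma fact_multiple m n : (0 < m <= n)%nat -> exists q, fact n = (q * m)%nat.
Proof.
  induction n; intros H; [lia|]. destruct (Nat.eq_dec m (S n)) as [->|].
  - exists (fact n). simpl. lia.
  - destruct IHn as (q & E); [lia|]. exists (S n * q)%nat. simpl fact. rewrite E. lia.
Qed.

(** Among the powers of [f] with exponents 0 to [n] two lie in the same coset, so some [fpow f d]
    with [0 < d <= n] is in [H]. Such a [d] divides [n!], which therefore serves for all [f] at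
    once. *)
Lemma finite_index_power H : is_subgroup H -> finite_index H thompsonF ->
  exists M, (0 < M)%nat /\ forall f, thompsonF f -> H (fpow f M).
Proof.
  intros HH (n & g & Hg & Hcov). exists (fact n). split; [apply lt_O_fact|].
  intros f Hf. assert (HF := subgroup_thompsonF).
  set (P := fun m i => (i < n)%nat /\ exists h, H h /\ fpow f m = comp (g i) h).
  assert (HP : forall m, P m (epsilon (inhabits 0%nat) (P m))).
  { intros m. apply epsilon_spec. destruct (Hcov (fpow f m)) as (i & h & Hi & Hh & E).
    - now apply subgroup_fpow.
    - exists i. split; auto. now exists h. }
  destruct (pigeonhole_lt n (fun m => epsilon (inhabits 0%nat) (P m))) as (a & b & Hab & E).
  { intros m _. apply HP. }
  destruct (HP a) as (Hi & h1 & H1 & E1). destruct (HP b) as (_ & h2 & H2 & E2).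
  rewrite <- E in E2. set (i := epsilon _ _) in *.
  assert (Hp := thompsonF_hp _ Hf). assert (Hpg := thompsonF_hp _ (Hg i Hi)).
  assert (Hd : H (fpow f (b - a))).
  { replace (fpow f (b - a)) with (comp (finv h1) h2).
    - apply subgroup_comp; auto. now apply subgroup_finv.
    - assert (Hh1 := subgroup_hp _ _ HH H1).
      replace b with (a + (b - a))%nat in E2 by lia. rewrite fpow_add, E1 in E2.
      apply functional_extensionality. intros t. apply finv_unique; auto.
      apply (hp_inj (g i)); auto. apply (f_equal (fun u => u t)) in E2. exact E2. }
  destruct (fact_multiple (b - a) n) as (q & ->); [lia|].
  rewrite fpow_mul. now apply subgroup_fpow.
Qed.

Lemma fpow_x0_lt n : fpow x0 (S n) (1/2) < 1/2.
Proof.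
  assert (H0 := x0_hp).
  induction n.
  - simpl. apply x0_lt. lra.
  - apply (Rlt_trans _ (x0 (1/2))); [|apply x0_lt; lra].
    change (x0 (fpow x0 (S n) (1/2)) < x0 (1/2)). apply hp_incr; auto.
Qed.

(** [N] is the normal core of [H] in [F]. It is nontrivial because it contains the power
    [fpow x0 M]: all conjugates of this element are [M]-th powers too. *)
Lemma finite_index_Fc H : is_subgroup H -> finite_index H thompsonF -> subset Fc H.
Proof.
  intros HH Hi. destruct (finite_index_power H HH Hi) as (M & HM & Hpow).
  assert (HF := subgroup_thompsonF).
  set (N := fun f => thompsonF f /\ forall u, thompsonF u -> H (conjf u f)).
  assert (HN : subset Fc N).
  { apply (Fc_in_normalized N (fpow x0 M)).
    - apply subgroup_intro.
      + intros f (Hf & _). now apply thompsonF_hp.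
      + split; [now apply subgroup_id|]. intros u Hu. rewrite conj_of_id by now apply thompsonF_hp.
        now apply subgroup_id.
      + intros f g (Hf & Hf') (Hg & Hg'). split; [now apply subgroup_comp|].
        intros u Hu. rewrite conj_comp by now apply thompsonF_hp. apply subgroup_comp; auto.
      + intros f (Hf & Hf'). split; [now apply subgroup_finv|]. intros u Hu.
        rewrite conj_finv by now apply thompsonF_hp. apply subgroup_finv; auto.
    - intros u f Hu (Hf & Hf'). apply Fc_F in Hu. split; [now apply subgroup_conj|].
      intros v Hv. rewrite conj_conj by now apply thompsonF_hp. apply Hf'. now apply subgroup_comp.
    - split; [apply subgroup_fpow; auto; apply x0_F|]. intros u Hu.
      rewrite conj_fpow by now apply thompsonF_hp. apply Hpow. apply subgroup_conj; auto. apply x0_F.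
    - intros E. destruct M; [lia|]. assert (L := fpow_x0_lt M). rewrite E in L. unfold idf in L. lra. }
  intros f Hf. rewrite <- (conj_id f). apply HN; auto. now apply subgroup_id.
Qed.

(** Conjugation by the reflection [t -> 1 - t]. It exchanges the endpoints, so results at one end
    are transferred to the other. *)
Definition flip (f : R -> R) (t : R) : R := 1 - f (1 - t).

Lemma flip_flip f : flip (flip f) = f.
Proof.
  apply functional_extensionality. intros t. unfold flip.
  replace (1 - (1 - t)) with t by ring. ring.
Qed.

Lemma flip_hp f : homeo_plus f -> homeo_plus (flip f).
Proof.
  intros Hf. apply hp_intro; unfold flip.
  - intros s t st. assert (f (1 - t) < f (1 - s)) by (apply hp_incr; auto; lra). lra.
  - intros y. exists (1 - finv f (1 - y)). replace (1 - (1 - finv f (1 - y))) with (finv f (1 - y)) by ring.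
    rewrite finv_r by auto. ring.
  - intros t Ht. rewrite (hp_out f); auto; lra.
Qed.

Lemma flip_comp f g : flip (comp f g) = comp (flip f) (flip g).
Proof.
  apply functional_extensionality. intros t. unfold flip, comp.
  replace (1 - (1 - g (1 - t))) with (g (1 - t)) by ring. ring.
Qed.

Lemma flip_finv f : homeo_plus f -> flip (finv f) = finv (flip f).
Proof.
  intros Hf. apply functional_extensionality. intros t. symmetry.
  apply finv_unique; [now apply flip_hp|].
  change (comp (flip f) (flip (finv f)) t = t). rewrite <- flip_comp, comp_finv_r by auto.
  unfold flip, idf. ring.
Qed.

Lemma flip_conj g f : homeo_plus g -> flip (conjf g f) = conjf (flip g) (flip f).
Proof. intros Hg. unfold conjf. now rewrite !flip_comp, flip_finv. Qed.

Lemma flip_rgerm f t k c : lgerm f (1 - t) k c -> rgerm (flip f) t k (1 - p2 k - c).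
Proof.
  intros (e & He & H). exists e. split; auto. intros s Hs. unfold flip. rewrite H by lra. ring.
Qed.

Lemma flip_lgerm f t k c : rgerm f (1 - t) k c -> lgerm (flip f) t k (1 - p2 k - c).
Proof.
  intros (e & He & H). exists e. split; auto. intros s Hs. unfold flip. rewrite H by lra. ring.
Qed.

Lemma flip_PLat f t : PLat f (1 - t) -> PLat (flip f) t.
Proof.
  intros (k & c & k' & c' & Hc & Hc' & Hr & Hl & Hd). assert (D1 := dyadic_IZR 1).
  exists k', (1 - p2 k' - c'), k, (1 - p2 k - c).
  split; [dyad|]. split; [dyad|].
  split; [now apply flip_rgerm|]. split; [now apply flip_lgerm|].
  destruct Hd as [Hd|(-> & ->)]; auto. left. replace t with (1 - (1 - t)) by ring. dyad.
Qed.

Lemma flip_F f : thompsonF f -> thompsonF (flip f).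
Proof.
  intros Hf. apply thompsonF_iff. split; [now apply flip_hp, thompsonF_hp|].
  intros t. now apply flip_PLat, thompsonF_PLat.
Qed.

Lemma flip_rho f k : lam f k -> rho (flip f) k.
Proof.
  intros H. unfold rho, lam in *. replace (1 - p2 k) with (1 - p2 k - 0) by ring.
  apply flip_lgerm. now replace (1 - 1) with 0 by ring.
Qed.

Lemma flip_lam f k : rho f k -> lam (flip f) k.
Proof.
  intros H. unfold rho, lam in *. replace 0 with (1 - p2 k - (1 - p2 k)) at 2 by ring.
  apply flip_rgerm. now replace (1 - 0) with 1 by ring.
Qed.

Lemma flip_Fc f : Fc f -> Fc (flip f).
Proof.
  intros Hf. apply Fc_iff in Hf. destruct Hf as (H1 & H2 & H3). apply Fc_iff.
  split; [now apply flip_F|]. split; [now apply flip_lam|now apply flip_rho].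
Qed.

(** * Centralizers in [F] *)

Definition commute (z h : R -> R) : Prop := comp z h = comp h z.

Lemma commute_app z h t : commute z h -> z (h t) = h (z t).
Proof. intros E. apply (f_equal (fun u => u t)) in E. exact E. Qed.

Lemma commute_intro z h : (forall t, z (h t) = h (z t)) -> commute z h.
Proof. intros E. now apply functional_extensionality. Qed.

Lemma commute_finv z h : homeo_plus h -> commute z h -> commute z (finv h).
Proof.
  intros Hh C. apply commute_intro. intros t. apply (hp_inj h); auto.
  rewrite <- commute_app by auto. now rewrite !finv_r.
Qed.

Lemma commute_comp z h k : commute z h -> commute z k -> commute z (comp h k).
Proof.
  intros H K. apply commute_intro. intros t. unfold comp.
  now rewrite (commute_app _ _ _ H), (commute_app _ _ _ K).
Qed.

Lemma commute_fpow z h n : commute z h -> commute z (fpow h n).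
Proof. intros H. induction n; simpl; [reflexivity|now apply commute_comp]. Qed.

Lemma commute_conj g z h : homeo_plus g -> commute z h -> commute (conjf g z) (conjf g h).
Proof. intros Hg C. unfold commute. rewrite <- !conj_comp by auto. now rewrite C. Qed.

Lemma commute_flip z h : commute z h -> commute (flip z) (flip h).
Proof. intros C. unfold commute. rewrite <- !flip_comp. now rewrite C. Qed.

(** A map commuting with [u] permutes the fixed points of [u]. Everything from [e] on is fixed and
    everything just below [e] is moved, so shifting [e] either way would mix the two kinds of
    points. *)
Lemma fixes_sup_support z u e' e : homeo_plus z -> e' < e -> commute z u ->
  (forall s, e <= s -> u s = s) -> (forall s, e' < s < e -> u s <> s) -> z e = e.
Proof.
  intros Hz He C Hid Hne. destruct (Rtotal_order (z e) e) as [L|[L|L]]; auto; exfalso.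
  - set (y := (Rmax e' (z e) + e) / 2).
    assert (A := Rmax_l e' (z e)). assert (B := Rmax_r e' (z e)).
    assert (Rmax e' (z e) < e) by (apply Rmax_lub_lt; auto).
    apply (Hne y); [unfold y; lra|].
    rewrite <- (finv_r z y) by auto. rewrite <- commute_app by auto. f_equal. apply Hid.
    left. apply (hp_lt_inv z); auto. rewrite finv_r by auto. unfold y. lra.
  - assert (finv z e < e). { apply (hp_lt_inv z); auto. now rewrite finv_r. }
    set (s := Rmax (finv z e) ((e' + e) / 2)).
    assert (A := Rmax_l (finv z e) ((e' + e) / 2)). assert (B := Rmax_r (finv z e) ((e' + e) / 2)).
    assert (s < e) by (apply Rmax_lub_lt; lra).
    apply (Hne s); [unfold s in *; lra|]. apply (hp_inj z); auto.
    rewrite commute_app by auto. apply Hid. rewrite <- (finv_r z e) at 1 by auto. now apply hp_le.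
Qed.

(* [z] commutes with the commutator of [f] and [h], so it fixes the right end of its support and
   the images of that point under [h], which accumulate at 1, where [z] is affine. *)
Lemma centralizer_up h c : homeo_plus h -> 0 <= c < 1 -> (forall t, c < t < 1 -> t < h t) ->
  exists f e, Fc f /\ 0 < e < 1 /\ forall z, thompsonF z -> commute z h -> commute z (conjf f h) ->
    forall t, e <= t -> z t = t.
Proof.
  intros Hh Hc Hup.
  destruct (dyadic_between c 1) as (a & Da & Ha); [lra|].
  assert (Hha : a < h a) by (apply Hup; lra).
  assert (Hb1 : h a < 1). { rewrite <- (hp_out h 1) by (auto; lra). apply hp_incr; auto; lra. }
  (* With [b < h a] the support [(a, b)] of the bump and its image [(h a, h b)] are disjoint, so on
     the latter the commutator of [f] and [h] has no fixed point and [h b] is the right end of its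
     support. *)
  destruct (dyadic_between a (h a)) as (b & Db & Hb); auto.
  assert (Hf : Fc (bump a b)) by (apply bump_Fc; auto; lra).
  set (f := bump a b) in *. assert (Hpf := Fc_hp _ Hf).
  assert (Hhb : h a < h b) by (apply hp_incr; auto; lra).
  assert (Hhb1 : h b < 1). { rewrite <- (hp_out h 1) by (auto; lra). apply hp_incr; auto; lra. }
  assert (Hfo : forall t, b <= t -> f t = t).
  { intros t Ht. apply sc_out; [lra|apply x0_hp|auto]. }
  exists f, (h b). split; auto. split; [lra|].
  intros z Hz C1 C2. assert (Hpz := thompsonF_hp _ Hz).
  set (u := comp (conjf f h) (finv h)).
  assert (Cu : commute z u) by (apply commute_comp; auto; now apply commute_finv).
  assert (Ze : z (h b) = h b).
  { apply (fixes_sup_support z u (h a)); auto.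
    - intros s Hs. unfold u, conjf, comp.
      assert (b <= finv h s) by (apply (hp_le_inv h); auto; rewrite finv_r; auto).
      rewrite (finv_unique f (finv h s)); auto. rewrite finv_r by auto. apply Hfo. lra.
    - intros s Hs E. unfold u, conjf, comp in E.
      assert (L : finv h s < finv f (finv h s)).
      { apply (hp_lt_inv f); auto. rewrite finv_r by auto. apply bump_lt.
        split; apply (hp_lt_inv h); auto; rewrite finv_r by auto; lra. }
      apply (hp_incr h) in L; auto. rewrite finv_r in L by auto. rewrite Hfo in E by lra. lra. }
  destruct (rho_exists z Hz) as (k & d & Hd & Hk).
  destruct (push_up h c 1 (h b) (1 - d)) as (n & Hn); auto; try lra.
  set (g := fpow h n) in *. assert (Hg : homeo_plus g) by now apply fpow_hp.
  assert (Cg : commute z g) by now apply commute_fpow.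
  (* Near 1, where [z] is affine, it fixes [g (h b)] besides 1, so its slope there is 1. *)
  assert (Ek : p2 k = 1).
  { assert (Zg : z (g (h b)) = g (h b)) by (rewrite commute_app; auto; now rewrite Ze).
    assert (g (h b) < 1). { rewrite <- (hp_out g 1) by (auto; lra). apply hp_incr; auto; lra. }
    rewrite Hk in Zg by lra. nra. }
  intros t Ht. destruct (Rle_dec 1 t); [apply hp_out; auto|].
  (* [g] commutes with [z] and carries [[h b, 1)] into the region where [z] is now known to be
     trivial, so triviality pulls back. *)
  apply (hp_inj g); auto. rewrite <- commute_app by auto.
  assert (g (h b) <= g t) by (now apply hp_le).
  assert (g t < 1). { rewrite <- (hp_out g 1) by (auto; lra). apply hp_incr; auto; lra. }
  rewrite Hk by lra. rewrite Ek. ring.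
Qed.

(** A slope below 1 at 1 means that [h] moves points near 1 up. A slope above 1 is reduced to this
    case by passing to the inverse, which commutes with the same elements. *)
Lemma centralizer_right h : thompsonF h -> ~ rho h 0 ->
  exists f e, Fc f /\ 0 < e < 1 /\ forall z, thompsonF z -> commute z h -> commute z (conjf f h) ->
    forall t, e <= t -> z t = t.
Proof.
  intros Hh Hr. assert (Hp := thompsonF_hp _ Hh).
  assert (Hneg : forall g k, homeo_plus g -> rho g k -> (k < 0)%Z ->
      exists c, 0 <= c < 1 /\ forall t, c < t < 1 -> t < g t).
  { intros g k Hg (e & He & H) Hk. exists (Rmax 0 (1 - e)).
    assert (A := Rmax_l 0 (1 - e)). assert (B := Rmax_r 0 (1 - e)).
    split; [split; [lra|apply Rmax_lub_lt; lra]|]. intros t Ht. rewrite H by lra.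
    assert (p2 k < p2 0) by now apply p2_lt. simpl in H0. nra. }
  destruct (rho_exists h Hh) as (k & Hk).
  destruct (Z.lt_trichotomy k 0) as [L|[->|L]]; [|contradiction|].
  - destruct (Hneg h k Hp Hk L) as (c & Hc & Hup). now apply (centralizer_up h c).
  - assert (Hi := hp_finv _ Hp).
    destruct (Hneg (finv h) (- k)%Z Hi (rho_finv _ _ Hp Hk) ltac:(lia)) as (c & Hc & Hup).
    destruct (centralizer_up (finv h) c Hi Hc Hup) as (f & e & Hf & He & H).
    exists f, e. split; auto. split; auto. intros z Hz C1 C2. apply H; auto.
    + now apply commute_finv.
    + assert (Hpf := Fc_hp _ Hf). rewrite conj_finv by auto. apply commute_finv; auto. now apply hp_conj.
Qed.

Lemma centralizer_left h : thompsonF h -> ~ lam h 0 ->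
  exists f e, Fc f /\ 0 < e < 1 /\ forall z, thompsonF z -> commute z h -> commute z (conjf f h) ->
    forall t, t <= e -> z t = t.
Proof.
  intros Hh Hl.
  destruct (centralizer_right (flip h)) as (f & e & Hf & He & H).
  { now apply flip_F. }
  { intros R0. apply Hl. rewrite <- (flip_flip h). now apply flip_lam. }
  exists (flip f), (1 - e). split; [now apply flip_Fc|]. split; [lra|].
  intros z Hz C1 C2 t Ht.
  assert (E : flip z (1 - t) = 1 - t).
  { apply H; [now apply flip_F|now apply commute_flip| |lra].
    apply commute_flip in C2. rewrite flip_conj, flip_flip in C2; auto. now apply flip_hp, Fc_hp. }
  unfold flip in E. replace (1 - (1 - t)) with t in E by ring. lra.
Qed.

(** The one-sided results make [z] trivial on [[e1, 1]] and on [[0, e2]], with a possible gap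
    between. Conjugating the first pair of maps by [g] replaces [e1] by [g e1 < e2] and closes the
    gap; this explains the list [[g; comp g f1; idf; f2]]. *)
Lemma centralizer_trivial h : thompsonF h -> ~ lam h 0 -> ~ rho h 0 ->
  exists l, (forall f, In f l -> Fc f) /\
    forall z, thompsonF z -> (forall f, In f l -> commute z (conjf f h)) -> z = idf.
Proof.
  intros Hh Hl Hr.
  destruct (centralizer_right h Hh Hr) as (f1 & e1 & Hf1 & He1 & H1).
  destruct (centralizer_left h Hh Hl) as (f2 & e2 & Hf2 & He2 & H2).
  destruct (Fc_push e1 e1 (e2 / 2) e2) as (g & Hg & _ & Hge); try lra.
  assert (G := subgroup_Fc). assert (HF := subgroup_thompsonF).
  assert (Hpg := Fc_hp _ Hg). assert (Hpf1 := Fc_hp _ Hf1).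
  exists [g; comp g f1; idf; f2]. split.
  { intros f [<-|[<-|[<-|[<-|[]]]]]; auto; [apply subgroup_comp; auto|now apply subgroup_id]. }
  intros z Hz C. assert (Hpz := thompsonF_hp _ Hz).
  apply functional_extensionality. intros t. unfold idf.
  destruct (Rle_dec t e2) as [L|L].
  - apply H2; auto.
    + rewrite <- (conj_id h). apply C. simpl; auto.
    + apply C. simpl; auto.
  - assert (E : conjf (finv g) z (finv g t) = finv g t).
    { apply H1.
      - apply subgroup_conj; auto. apply subgroup_finv; auto. now apply Fc_F.
      - rewrite <- (conj_finvK g h) by auto. apply commute_conj; [now apply hp_finv|]. apply C. simpl; auto.
      - rewrite <- (conj_finvK g (conjf f1 h)) by auto. apply commute_conj; [now apply hp_finv|].
        rewrite conj_conj by auto. apply C. simpl; auto.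
      - apply (hp_le_inv g); auto. rewrite finv_r by auto. lra. }
    rewrite conj_app in E by now apply hp_finv. now apply (hp_inj (finv g)) in E; [|apply hp_finv].
Qed.

(** * Actions with geometrically proper generating sets *)

Lemma subgroup_gen X : subset X homeo_plus -> is_subgroup (gen X).
Proof.
  intros HX. apply subgroup_intro.
  - intros f Hf. apply Hf; auto. apply subgroup_homeo.
  - intros S HS _. now apply subgroup_id.
  - intros f g Hf Hg S HS HXS. apply subgroup_comp; auto; [apply Hf|apply Hg]; auto.
  - intros f Hf S HS HXS. apply subgroup_finv; auto. apply Hf; auto.
Qed.

Lemma gen_incl X : subset X (gen X).
Proof. intros f Hf S HS HXS. auto. Qed.

(** * One-sided germs at a common fixed point *)

Definition triv_right (g : R -> R) (p : R) : Prop := exists e, 0 < e /\ forall t, p <= t <= p + e -> g t = t.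
Definition triv_left (g : R -> R) (q : R) : Prop := exists e, 0 < e /\ forall t, q - e <= t <= q -> g t = t.

Lemma triv_flip g q : triv_right (flip g) (1 - q) -> triv_left g q.
Proof.
  intros (e & He & H). exists e. split; auto. intros t Ht.
  assert (E := H (1 - t) ltac:(lra)). unfold flip in E.
  replace (1 - (1 - t)) with t in E by ring. lra.
Qed.

Lemma triv_flip' g q : triv_left g q -> triv_right (flip g) (1 - q).
Proof.
  intros (e & He & H). exists e. split; auto. intros t Ht. unfold flip. rewrite H; lra.
Qed.

Lemma near_right g p e : homeo_plus g -> g p = p -> 0 < e ->
  exists d, 0 < d /\ forall t, p <= t <= p + d -> p <= g t <= p + e.
Proof.
  intros Hg Ep He. exists (finv g (p + e) - p). split.
  - assert (p < finv g (p + e)); [|lra]. apply (hp_lt_inv g); auto. rewrite finv_r by auto. lra.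
  - intros t Ht. split.
    + rewrite <- Ep at 1. apply hp_le; auto; lra.
    + rewrite <- (finv_r g (p + e)) by auto. apply hp_le; auto; lra.
Qed.

(** Commutation of germs: the radius depends on the pair, so nothing uniform over an infinite [X] is
    claimed. *)
Definition commute_right (p : R) (g h : R -> R) : Prop :=
  exists e, 0 < e /\ forall t, p <= t <= p + e -> g (h t) = h (g t).

Lemma commute_right_sym p g h : commute_right p g h -> commute_right p h g.
Proof. intros (e & He & H). exists e. split; auto. intros t Ht. now rewrite H. Qed.

Lemma gen_fix X p : subset X homeo_plus -> (forall x, X x -> x p = p) ->
  forall g, gen X g -> g p = p.
Proof.
  intros HX Hp g Hg. assert (HS : is_subgroup (fun g => homeo_plus g /\ g p = p)).
  { apply subgroup_intro.
    - now intros f (H & _).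
    - split; [apply hp_id|reflexivity].
    - intros f h (H1 & H2) (H3 & H4). split; [now apply hp_comp|]. unfold comp. congruence.
    - intros f (H1 & H2). split; [now apply hp_finv|]. now apply finv_unique. }
  apply (Hg _ HS). intros x Hx. auto.
Qed.

Lemma commute_right_gen X p h : subset X homeo_plus -> (forall x, X x -> x p = p) ->
  homeo_plus h -> h p = p -> (forall x, X x -> commute_right p x h) ->
  forall g, gen X g -> commute_right p g h.
Proof.
  intros HX Hp Hh Ehp Hc g Hg.
  assert (HS : is_subgroup (fun g => homeo_plus g /\ g p = p /\ commute_right p g h)).
  { apply subgroup_intro.
    - now intros f (H & _).
    - split; [apply hp_id|]. split; [reflexivity|]. exists 1. split; [lra|reflexivity].
    - intros f k (F1 & F2 & e & He & F3) (K1 & K2 & e' & He' & K3).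
      split; [now apply hp_comp|]. split; [unfold comp; congruence|].
      destruct (near_right k p e K1 K2 He) as (d & Hd & Hk).
      exists (Rmin d e'). assert (A := Rmin_l d e'). assert (B := Rmin_r d e').
      split; [apply Rmin_glb_lt; auto|]. intros t Ht. unfold comp.
      rewrite K3 by lra. apply F3. apply Hk. lra.
    - intros f (F1 & F2 & e & He & F3). assert (Fi := hp_finv _ F1).
      assert (Ei : finv f p = p) by now apply finv_unique.
      split; auto. split; auto.
      destruct (near_right (finv f) p e Fi Ei He) as (d & Hd & Hk).
      exists d. split; auto. intros t Ht. apply finv_unique; auto.
      rewrite F3 by now apply Hk. now rewrite finv_r. }
  apply (Hg _ HS). intros x Hx. auto.
Qed.

(* Only one generator has a nontrivial germ at [p+], so the germs of the whole group commute. *)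
Lemma commutator_triv_right X p : subset X homeo_plus -> (forall x, X x -> x p = p) ->
  (forall x y, X x -> X y -> ~ triv_right x p -> ~ triv_right y p -> x = y) ->
  forall g h, gen X g -> gen X h -> triv_right (commf g h) p.
Proof.
  intros HX Hp Hu g h Hg Hh. assert (HG := subgroup_gen X HX).
  assert (Triv : forall x y, homeo_plus y -> y p = p -> triv_right x p -> commute_right p x y).
  { intros x y Hy Ey (e & He & H). destruct (near_right y p e Hy Ey He) as (d & Hd & Hk).
    exists (Rmin d e). assert (A := Rmin_l d e). assert (B := Rmin_r d e).
    split; [apply Rmin_glb_lt; auto|]. intros t Ht. rewrite (H t) by lra. apply H, Hk. lra. }
  assert (C1 : forall x y, X x -> X y -> commute_right p x y).
  { intros x y Hx Hy. destruct (classic (triv_right x p)) as [T|T]; [apply Triv; auto|].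
    destruct (classic (triv_right y p)) as [T'|T']; [apply commute_right_sym, Triv; auto|].
    rewrite (Hu x y); auto. exists 1. split; [lra|auto]. }
  assert (C2 : forall x, X x -> commute_right p g x).
  { intros x Hx. apply (commute_right_gen X); auto. }
  assert (Hg' := subgroup_hp _ _ HG Hg). assert (Hh' := subgroup_hp _ _ HG Hh).
  assert (Eg : g p = p) by now apply (gen_fix X). assert (Eh : h p = p) by now apply (gen_fix X).
  assert (C3 : commute_right p h g).
  { apply (commute_right_gen X); auto. intros x Hx. now apply commute_right_sym, C2. }
  destruct C3 as (e & He & C3).
  assert (Hk : homeo_plus (comp (finv g) (finv h))) by (apply hp_comp; now apply hp_finv).
  destruct (near_right _ p e Hk) as (d & Hd & Hd'); auto.
  { unfold comp. rewrite (finv_unique h p p), (finv_unique g p p); auto. }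
  exists d. split; auto. intros t Ht. specialize (Hd' t Ht). unfold commf, comp in *.
  rewrite <- C3 by auto. rewrite (finv_r g) by auto. now rewrite finv_r.
Qed.

Lemma gen_flip X g : subset X homeo_plus -> gen X g -> gen (fun x => X (flip x)) (flip g).
Proof.
  intros HX Hg.
  assert (HX' : subset (fun x => X (flip x)) homeo_plus).
  { intros x Hx. rewrite <- (flip_flip x). apply flip_hp. auto. }
  assert (HG' := subgroup_gen _ HX').
  assert (HS : is_subgroup (fun g => homeo_plus g /\ gen (fun x => X (flip x)) (flip g))).
  { apply subgroup_intro.
    - now intros f (H & _).
    - split; [apply hp_id|]. replace (flip idf) with idf; [now apply subgroup_id|].
      apply functional_extensionality. intros t. unfold flip, idf. ring.
    - intros f h (H1 & H2) (H3 & H4). split; [now apply hp_comp|]. rewrite flip_comp.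
      now apply subgroup_comp.
    - intros f (H1 & H2). split; [now apply hp_finv|]. rewrite flip_finv by auto. now apply subgroup_finv. }
  apply (Hg _ HS). intros x Hx. split; auto. apply gen_incl. now rewrite flip_flip.
Qed.

Lemma commutator_triv_left X q : subset X homeo_plus -> (forall x, X x -> x q = q) ->
  (forall x y, X x -> X y -> ~ triv_left x q -> ~ triv_left y q -> x = y) ->
  forall g h, gen X g -> gen X h -> triv_left (commf g h) q.
Proof.
  intros HX Hq Hu g h Hg Hh. apply triv_flip.
  assert (HG := subgroup_gen X HX).
  assert (Hg' := subgroup_hp _ _ HG Hg). assert (Hh' := subgroup_hp _ _ HG Hh).
  replace (flip (commf g h)) with (commf (flip g) (flip h))
    by (unfold commf; now rewrite !flip_comp, !flip_finv).
  apply (commutator_triv_right (fun x => X (flip x))).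
  - intros x Hx. rewrite <- (flip_flip x). apply flip_hp. auto.
  - intros x Hx. apply Hq in Hx. unfold flip in Hx. lra.
  - intros x y Hx Hy Tx Ty. rewrite <- (flip_flip x), <- (flip_flip y). f_equal.
    apply Hu; auto; intros T; apply triv_flip' in T; rewrite flip_flip in T; auto.
  - now apply gen_flip.
  - now apply gen_flip.
Qed.

Lemma disjoint_commute p q r w y : homeo_plus w -> homeo_plus y -> p <= r <= q ->
  w p = p -> y p = p -> w q = q -> y q = q ->
  (forall t, r <= t <= q -> w t = t) -> (forall t, p <= t <= r -> y t = t) ->
  forall t, p <= t <= q -> w (y t) = y (w t).
Proof.
  intros Hw Hy Hr wp yp wq yq Hw' Hy' t Ht.
  assert (Iw : p <= w t <= q).
  { split; [rewrite <- wp at 1|rewrite <- wq]; apply hp_le; auto; lra. }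
  assert (Iy : p <= y t <= q).
  { split; [rewrite <- yp at 1|rewrite <- yq]; apply hp_le; auto; lra. }
  destruct (Rle_dec t r) as [L|L].
  - assert (w t <= w r) by now apply hp_le. rewrite (Hw' r) in H by lra.
    rewrite (Hy' t) by lra. rewrite (Hy' (w t)) by lra. auto.
  - assert (y r <= y t) by (apply hp_le; auto; lra). rewrite (Hy' r) in H by lra.
    rewrite (Hw' t) by lra. rewrite (Hw' (y t)) by lra. auto.
Qed.

(** Perfectness applied to the trivial subgroup: an abelian [Fc] would be trivial, but it contains a
    bump. *)
Lemma Fc_noncommuting : exists a b, Fc a /\ Fc b /\ commf a b <> idf.
Proof.
  apply NNPP. intros Hno.
  assert (D : dyadic (1/2)) by apply (dyadic_half 1), (dyadic_IZR 1).
  assert (D' : dyadic (1/4)) by (replace (1/4) with (1/2/2) by field; now apply dyadic_half).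
  assert (HB : Fc (bump (1/4) (1/2))) by (apply bump_Fc; auto; lra).
  assert (bump (1/4) (1/2) = idf).
  { apply (Fc_perfect (fun f => f = idf)); auto.
    - apply subgroup_intro.
      + intros f ->. apply hp_id.
      + auto.
      + now intros f g -> ->.
      + intros f ->. apply finv_idf.
    - intros u v Hu Hv. apply NNPP. intros H. apply Hno. now exists u, v. }
  assert (L := bump_lt (1/4) (1/2) (3/8) ltac:(lra)). rewrite H in L. unfold idf in L. lra.
Qed.

Lemma triv_right_conj g f p : homeo_plus g -> g p = p -> triv_right f p -> triv_right (conjf g f) p.
Proof.
  intros Hg Ep (e & He & H).
  destruct (near_right (finv g) p e (hp_finv _ Hg) (finv_unique g p p Hg Ep) He) as (d & Hd & Hd').
  exists d. split; auto. intros t Ht. unfold conjf, comp. rewrite H by auto. now apply finv_r.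
Qed.

Lemma triv_left_conj g f q : homeo_plus g -> g q = q -> triv_left f q -> triv_left (conjf g f) q.
Proof.
  intros Hg Eq T. apply triv_flip. rewrite flip_conj by auto. apply triv_right_conj.
  - now apply flip_hp.
  - unfold flip. replace (1 - (1 - q)) with q by ring. lra.
  - now apply triv_flip'.
Qed.

Lemma lam_conj g f k : thompsonF g -> lam f k -> lam (conjf g f) k.
Proof.
  intros Hg Hf. destruct (lam_exists g Hg) as (j & Hj). assert (Hp := thompsonF_hp _ Hg).
  replace k with (j + (k + - j))%Z by lia. apply lam_comp; auto. apply lam_comp; auto. now apply lam_finv.
Qed.

Lemma rho_conj g f k : thompsonF g -> rho f k -> rho (conjf g f) k.
Proof.
  intros Hg Hf. destruct (rho_exists g Hg) as (j & Hj). assert (Hp := thompsonF_hp _ Hg).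
  replace k with (j + (k + - j))%Z by lia. apply rho_comp; auto. apply rho_comp; auto. now apply rho_finv.
Qed.

Lemma lam_fpow f k n : lam f k -> lam (fpow f n) (Z.of_nat n * k).
Proof.
  intros H. induction n; [apply lam_id|].
  replace (Z.of_nat (S n) * k)%Z with (k + Z.of_nat n * k)%Z by lia. now apply lam_comp.
Qed.

Lemma rho_fpow f k n : rho f k -> rho (fpow f n) (Z.of_nat n * k).
Proof.
  intros H. induction n; [apply rho_id|].
  replace (Z.of_nat (S n) * k)%Z with (k + Z.of_nat n * k)%Z by lia. now apply rho_comp.
Qed.

(** * Germs of the elements of [H] that correspond to generators *)

Section Isomorphism.

Variables (H X : (R -> R) -> Prop) (phi : (R -> R) -> (R -> R)) (M : nat).
Hypothesis HH : is_subgroup H.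
Hypothesis HHF : subset H thompsonF.
Hypothesis HFc : subset Fc H.
Hypothesis M_pos : (0 < M)%nat.
Hypothesis H_pow : forall f, thompsonF f -> H (fpow f M).
Hypothesis HX : subset X homeo_plus.
Hypothesis X_proper : geometrically_proper X.
Hypothesis phi_gen : forall f, H f -> gen X (phi f).
Hypothesis phi_inj : forall f g, H f -> H g -> phi f = phi g -> f = g.
Hypothesis phi_surj : forall g, gen X g -> exists f, H f /\ phi f = g.
Hypothesis phi_comp : forall f g, H f -> H g -> phi (comp f g) = comp (phi f) (phi g).

Lemma phi_hp f : H f -> homeo_plus (phi f).
Proof. intros Hf. apply (subgroup_hp (gen X)); auto. now apply subgroup_gen. Qed.

Lemma phi_id : phi idf = idf.
Proof.
  assert (Hi : H idf) by now apply subgroup_id.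
  assert (E := phi_comp idf idf Hi Hi). change (comp idf idf) with idf in E.
  apply functional_extensionality. intros t. apply (f_equal (fun u => u t)) in E.
  apply (hp_inj (phi idf)); [now apply phi_hp|]. symmetry. exact E.
Qed.

Lemma phi_finv f : H f -> phi (finv f) = finv (phi f).
Proof.
  intros Hf. apply functional_extensionality. intros t. symmetry.
  apply finv_unique; [now apply phi_hp|].
  change (comp (phi f) (phi (finv f)) t = t). rewrite <- phi_comp; auto; [|now apply subgroup_finv].
  rewrite comp_finv_r by now apply (subgroup_hp H). now rewrite phi_id.
Qed.

Lemma phi_conj g f : H g -> H f -> phi (conjf g f) = conjf (phi g) (phi f).
Proof.
  intros Hg Hf. assert (Hi : H (finv g)) by now apply subgroup_finv.
  unfold conjf. rewrite !phi_comp, phi_finv; auto. apply subgroup_comp; auto.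
Qed.

Lemma phi_commf g f : H g -> H f -> phi (commf g f) = commf (phi g) (phi f).
Proof.
  intros Hg Hf. assert (Hi : H (finv g)) by now apply subgroup_finv.
  assert (Hi' : H (finv f)) by now apply subgroup_finv.
  assert (H1 : H (comp (finv g) (finv f))) by (apply subgroup_comp; auto).
  assert (H2 : H (comp f (comp (finv g) (finv f)))) by (apply subgroup_comp; auto).
  unfold commf. now rewrite !phi_comp, !phi_finv.
Qed.

(** The images of the elements of [H] in [S] form a subgroup containing [X], hence all of [gen X].
    So a property closed under the group operations is checked only on the preimages of
    generators. *)
Lemma phi_generation S : is_subgroup S -> (forall h, H h -> X (phi h) -> S h) -> subset H S.
Proof.
  intros HS HXS h Hh.
  assert (HS' : is_subgroup (fun g => homeo_plus g /\ exists f, H f /\ S f /\ phi f = g)).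
  { apply subgroup_intro.
    - now intros f (K & _).
    - split; [apply hp_id|]. exists idf. split; [now apply subgroup_id|].
      split; [now apply subgroup_id|apply phi_id].
    - intros f g (F1 & f' & F2 & F3 & F4) (G1 & g' & G2 & G3 & G4). split; [now apply hp_comp|].
      exists (comp f' g'). split; [apply subgroup_comp; auto|]. split; [apply subgroup_comp; auto|].
      rewrite phi_comp by auto. congruence.
    - intros f (F1 & f' & F2 & F3 & F4). split; [now apply hp_finv|].
      exists (finv f'). split; [now apply subgroup_finv|]. split; [now apply subgroup_finv|].
      rewrite phi_finv by auto. congruence. }
  destruct (phi_gen h Hh _ HS') as (_ & f & F1 & F2 & F3).
  - intros x Hx. split; auto. destruct (phi_surj x) as (f & Hf & <-); [now apply gen_incl|].
    exists f. auto.
  - apply phi_inj in F3; auto. now subst.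
Qed.

(* [p] and [q] are the infimum and the supremum of the orbit of a point moved by the image of a
   commutator of [Fc]; the kernel of the action on [[p, q]] is normal, so it would contain [Fc]. *)
Lemma faithful_orbital : exists p q, 0 <= p /\ p < q /\ q <= 1 /\
  (forall g, gen X g -> g p = p /\ g q = q) /\
  (forall d r, d < q -> p < r -> exists g, gen X g /\ g d < r) /\
  (forall d r, p < d -> r < q -> exists g, gen X g /\ r < g d) /\
  (forall h, H h -> (forall t, p <= t <= q -> phi h t = t) -> h = idf).
Proof.
  assert (HG := subgroup_gen X HX).
  destruct Fc_noncommuting as (a & b & Ha & Hb & Hab).
  set (w0 := commf a b) in *.
  assert (Hw0 : Fc w0) by (apply subgroup_commf; auto; apply subgroup_Fc).
  assert (Hw : H w0) by auto.
  assert (exists t0, phi w0 t0 <> t0) as (t0 & Ht0).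
  { apply NNPP. intros Hno. apply Hab. apply phi_inj; auto; [now apply subgroup_id|].
    rewrite phi_id. apply functional_extensionality. intros t. apply NNPP. intros K. apply Hno. now exists t. }
  set (w := phi w0) in *. assert (Gw : gen X w) by (apply phi_gen; auto).
  assert (Hpw : homeo_plus w) by now apply phi_hp.
  assert (It : 0 < t0 < 1).
  { apply NNPP. intros K. apply Ht0. apply hp_out; auto. lra. }
  assert (Hin : forall g, gen X g -> 0 <= g t0 <= 1).
  { intros g Hg. assert (Hpg := subgroup_hp _ _ HG Hg).
    assert (A : g 0 <= g t0) by (apply hp_le; auto; lra).
    assert (B : g t0 <= g 1) by (apply hp_le; auto; lra).
    rewrite (hp_out g 0) in A by (auto; lra). rewrite (hp_out g 1) in B by (auto; lra). lra. }
  assert (Gid : gen X idf) by now apply subgroup_id.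
  destruct (completeness (fun r => forall g, gen X g -> r <= g t0)) as (p & Hp1 & Hp2).
  { exists t0. intros r Hr. apply (Hr idf Gid). }
  { exists 0. intros g Hg. apply Hin; auto. }
  destruct (completeness (fun r => exists g, gen X g /\ r = g t0)) as (q & Hq1 & Hq2).
  { exists 1. intros r (g & Hg & ->). apply Hin; auto. }
  { exists t0. exists idf. auto. }
  assert (Hp : forall g, gen X g -> p <= g t0).
  { intros g Hg. apply Hp2. intros r Hr. auto. }
  assert (Hq : forall g, gen X g -> g t0 <= q).
  { intros g Hg. apply Hq1. now exists g. }
  assert (Hp' : forall r, p < r -> exists g, gen X g /\ g t0 < r).
  { intros r Hr. apply NNPP. intros Hno. assert (r <= p); [|lra]. apply Hp1. intros g Hg.
    apply Rnot_lt_le. intros K. apply Hno. now exists g. }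
  assert (Hq' : forall r, r < q -> exists g, gen X g /\ r < g t0).
  { intros r Hr. apply NNPP. intros Hno. assert (q <= r); [|lra]. apply Hq2. intros x (g & Hg & ->).
    apply Rnot_lt_le. intros K. apply Hno. now exists g. }
  assert (Lp : forall g, gen X g -> g p <= p).
  { intros g Hg. assert (Hpg := subgroup_hp _ _ HG Hg). apply Hp1. intros g' Hg'.
    rewrite <- (finv_r g (g' t0)) by auto. apply hp_le; auto.
    apply (Hp (comp (finv g) g')). apply subgroup_comp; auto. now apply subgroup_finv. }
  assert (Fp : forall g, gen X g -> g p = p).
  { intros g Hg. assert (Hpg := subgroup_hp _ _ HG Hg). apply Rle_antisym; auto.
    rewrite <- (finv_r g p) at 1 by auto. apply hp_le; auto. apply Lp. now apply subgroup_finv. }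
  assert (Lq : forall g, gen X g -> q <= g q).
  { intros g Hg. assert (Hpg := subgroup_hp _ _ HG Hg). apply Hq2. intros x (g' & Hg' & ->).
    rewrite <- (finv_r g (g' t0)) by auto. apply hp_le; auto.
    apply (Hq (comp (finv g) g')). apply subgroup_comp; auto. now apply subgroup_finv. }
  assert (Fq : forall g, gen X g -> g q = q).
  { intros g Hg. assert (Hpg := subgroup_hp _ _ HG Hg). apply Rle_antisym; auto.
    rewrite <- (finv_r g q) at 2 by auto. apply hp_le; auto. apply Lq. now apply subgroup_finv. }
  assert (Bt : p <= t0 <= q) by (split; [apply (Hp idf)|apply (Hq idf)]; auto).
  assert (Nt : t0 <> p) by (intros ->; apply Ht0; auto).
  assert (Nq : t0 <> q) by (intros ->; apply Ht0; auto).
  exists p, q.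
  split. { apply Hp1. intros g Hg. apply Hin; auto. }
  split; [lra|].
  split. { apply Hq2. intros x (g & Hg & ->). apply Hin; auto. }
  split; [auto|].
  split.
  { intros d r Hd Hr. destruct (Hq' d Hd) as (g1 & G1 & L1). destruct (Hp' r Hr) as (g2 & G2 & L2).
    assert (P1 := subgroup_hp _ _ HG G1). assert (P2 := subgroup_hp _ _ HG G2).
    exists (comp g2 (finv g1)). split; [apply subgroup_comp; auto; now apply subgroup_finv|].
    unfold comp. apply Rlt_trans with (g2 t0); auto. apply hp_incr; auto.
    apply (hp_lt_inv g1); auto. now rewrite finv_r. }
  split.
  { intros d r Hd Hr. destruct (Hp' d Hd) as (g1 & G1 & L1). destruct (Hq' r Hr) as (g2 & G2 & L2).
    assert (P1 := subgroup_hp _ _ HG G1). assert (P2 := subgroup_hp _ _ HG G2).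
    exists (comp g2 (finv g1)). split; [apply subgroup_comp; auto; now apply subgroup_finv|].
    unfold comp. apply Rlt_trans with (g2 t0); auto. apply hp_incr; auto.
    apply (hp_lt_inv g1); auto. now rewrite finv_r. }
  intros h Hh Hid. apply NNPP. intros Hne. apply Ht0.
  set (N := fun f => H f /\ forall t, p <= t <= q -> phi f t = t).
  assert (Ran : forall g, gen X g -> forall t, p <= t <= q -> p <= g t <= q).
  { intros g Hg t Ht. assert (Hpg := subgroup_hp _ _ HG Hg).
    split; [rewrite <- (Fp g Hg) at 1|rewrite <- (Fq g Hg)]; apply hp_le; auto; lra. }
  assert (SN : subset Fc N).
  { apply (Fc_in_normalized N h); auto; [| |now split].
    - apply subgroup_intro.
      + intros f (K & _). now apply (subgroup_hp H).
      + split; [now apply subgroup_id|]. intros t _. now rewrite phi_id.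
      + intros f g (F1 & F2) (G1 & G2). split; [apply subgroup_comp; auto|].
        intros t Ht. rewrite phi_comp by auto. unfold comp. rewrite G2; auto.
      + intros f (F1 & F2). split; [now apply subgroup_finv|]. intros t Ht. rewrite phi_finv by auto.
        apply finv_unique; auto. now apply phi_hp.
    - intros u f Hu (F1 & F2). assert (Hu' := HFc _ Hu). split; [now apply subgroup_conj|].
      intros t Ht. rewrite phi_conj by auto. unfold conjf, comp.
      rewrite F2; [apply finv_r; now apply phi_hp|]. apply Ran; auto.
      apply subgroup_finv; auto. }
  apply SN; auto.
Qed.

Section Orbital.

Variables p q : R.
Hypothesis p_ge : 0 <= p.
Hypothesis pq : p < q.
Hypothesis q_le : q <= 1.
Hypothesis fixpq : forall g, gen X g -> g p = p /\ g q = q.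
Hypothesis pushp : forall d r, d < q -> p < r -> exists g, gen X g /\ g d < r.
Hypothesis pushq : forall d r, p < d -> r < q -> exists g, gen X g /\ r < g d.
Hypothesis faithful : forall h, H h -> (forall t, p <= t <= q -> phi h t = t) -> h = idf.

(** The commutator acts trivially on [[p, q]], hence is trivial by faithfulness. What the images do
    outside [[p, q]] is irrelevant. *)
Lemma commute_faithful z h : H z -> H h ->
  (forall t, p <= t <= q -> phi z (phi h t) = phi h (phi z t)) -> commute z h.
Proof.
  intros Hz Hh C. assert (Pz := subgroup_hp _ _ HH Hz). assert (Ph := subgroup_hp _ _ HH Hh).
  assert (Qz := phi_hp z Hz). assert (Qh := phi_hp h Hh).
  assert (E : commf z h = idf).
  { apply faithful; [now apply subgroup_commf|]. intros t Ht. rewrite phi_commf by auto.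
    unfold commf, comp.
    assert (G : gen X (comp (finv (phi z)) (finv (phi h)))).
    { assert (HG := subgroup_gen X HX).
      apply subgroup_comp; auto; apply subgroup_finv; auto. }
    assert (R1 : p <= comp (finv (phi z)) (finv (phi h)) t <= q).
    { destruct (fixpq _ G) as (Ep & Eq). assert (PG := subgroup_hp _ _ (subgroup_gen X HX) G).
      split; [rewrite <- Ep at 1|rewrite <- Eq]; apply hp_le; auto; lra. }
    unfold comp in R1. rewrite C by auto. rewrite (finv_r (phi z)) by auto. now apply finv_r. }
  apply commute_intro. intros t. apply (f_equal (fun u => u (h (z t)))) in E.
  unfold commf, comp, idf in E. rewrite (finv_l h), (finv_l z) in E by auto. auto.
Qed.

Lemma not_triv_right x : X x -> ~ triv_right x p -> left_transition x p.
Proof.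
  intros Hx Hn. assert (Ex : x p = p) by (apply fixpq; now apply gen_incl).
  split; [unfold in_I; lra|]. split; [intros (_ & K); auto|].
  intros eps He. apply NNPP. intros Hno. apply Hn. exists (eps / 2). split; [lra|].
  intros t Ht. apply NNPP. intros K. apply Hno. exists t.
  assert (t <> p) by (intros ->; auto). split; [lra|]. split; auto.
  apply NNPP. intros K'. apply K. apply hp_out; auto. unfold in_I in K'. lra.
Qed.

Lemma not_triv_left x : X x -> ~ triv_left x q -> right_transition x q.
Proof.
  intros Hx Hn. assert (Ex : x q = q) by (apply fixpq; now apply gen_incl).
  split; [unfold in_I; lra|]. split; [intros (_ & K); auto|].
  intros eps He. apply NNPP. intros Hno. apply Hn. exists (eps / 2). split; [lra|].
  intros t Ht. apply NNPP. intros K. apply Hno. exists t.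
  assert (t <> q) by (intros ->; auto). split; [lra|]. split; auto.
  apply NNPP. intros K'. apply K. apply hp_out; auto. unfold in_I in K'. lra.
Qed.

(** Together with its mirror image [unique_left], the place where geometric properness enters. *)
Lemma unique_right x y : X x -> X y -> ~ triv_right x p -> ~ triv_right y p -> x = y.
Proof.
  intros Hx Hy Tx Ty. destruct X_proper as [U _].
  apply (U x y p); auto; now apply not_triv_right.
Qed.

Lemma unique_left x y : X x -> X y -> ~ triv_left x q -> ~ triv_left y q -> x = y.
Proof.
  intros Hx Hy Tx Ty. destruct X_proper as [_ U].
  apply (U x y q); auto; now apply not_triv_left.
Qed.

Lemma compact_support : exists w1 c d, H w1 /\ w1 <> idf /\ p < c < q /\ p < d < q /\
  (forall t, p <= t <= c \/ d <= t <= q -> phi w1 t = t).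
Proof.
  destruct Fc_noncommuting as (a & b & Ha & Hb & Hab).
  assert (FX : forall x, X x -> x p = p /\ x q = q) by (intros; apply fixpq; now apply gen_incl).
  destruct (commutator_triv_right X p HX (fun x Hx => proj1 (FX x Hx)) unique_right (phi a) (phi b))
    as (e & He & E); auto.
  destruct (commutator_triv_left X q HX (fun x Hx => proj2 (FX x Hx)) unique_left (phi a) (phi b))
    as (e' & He' & E'); auto.
  exists (commf a b), (p + Rmin e ((q - p) / 2)), (q - Rmin e' ((q - p) / 2)).
  assert (A := Rmin_l e ((q - p) / 2)). assert (B := Rmin_r e ((q - p) / 2)).
  assert (A' := Rmin_l e' ((q - p) / 2)). assert (B' := Rmin_r e' ((q - p) / 2)).
  assert (0 < Rmin e ((q - p) / 2)) by (apply Rmin_glb_lt; lra).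
  assert (0 < Rmin e' ((q - p) / 2)) by (apply Rmin_glb_lt; lra).
  split; [apply subgroup_commf; auto|]. split; auto. split; [lra|]. split; [lra|].
  intros t Ht. rewrite phi_commf by auto. destruct Ht; [apply E|apply E']; lra.
Qed.

Lemma conj_nontrivial g f : homeo_plus g -> conjf g f = idf -> f = idf.
Proof.
  intros Hg E. rewrite <- (conj_finvK g f) by auto. rewrite E. apply conj_of_id. now apply hp_finv.
Qed.

Lemma lift_conj g f : gen X g -> H f -> exists u, H u /\ phi (conjf u f) = conjf g (phi f).
Proof.
  intros Hg Hf. destruct (phi_surj g Hg) as (u & Hu & <-). exists u. split; auto. now apply phi_conj.
Qed.

(** A common neighbourhood of [p] exists because the list is finite; for this reason
    [centralizer_trivial] provides finitely many conjugators. *)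
Lemma triv_right_list l h : H h -> (forall f, In f l -> Fc f) -> triv_right (phi h) p ->
  exists e, 0 < e /\ forall f, In f l -> forall t, p <= t <= p + e -> phi (conjf f h) t = t.
Proof.
  intros Hh Hl T. induction l as [|f l IH].
  - exists 1. split; [lra|]. intros f [].
  - destruct IH as (e & He & E); [intros g Hg; apply Hl; now right|].
    assert (Hf : H f) by (apply HFc, Hl; now left).
    destruct (triv_right_conj (phi f) (phi h) p) as (e' & He' & E'); auto.
    { now apply phi_hp. } { apply fixpq; auto. }
    exists (Rmin e e'). assert (A := Rmin_l e e'). assert (B := Rmin_r e e').
    split; [apply Rmin_glb_lt; auto|]. intros g [<-|Hg] t Ht.
    + rewrite phi_conj by auto. apply E'. lra.
    + apply E; auto. lra.
Qed.

Lemma triv_left_list l h : H h -> (forall f, In f l -> Fc f) -> triv_left (phi h) q ->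
  exists e, 0 < e /\ forall f, In f l -> forall t, q - e <= t <= q -> phi (conjf f h) t = t.
Proof.
  intros Hh Hl T. induction l as [|f l IH].
  - exists 1. split; [lra|]. intros f [].
  - destruct IH as (e & He & E); [intros g Hg; apply Hl; now right|].
    assert (Hf : H f) by (apply HFc, Hl; now left).
    destruct (triv_left_conj (phi f) (phi h) q) as (e' & He' & E'); auto.
    { now apply phi_hp. } { apply fixpq; auto. }
    exists (Rmin e e'). assert (A := Rmin_l e e'). assert (B := Rmin_r e e').
    split; [apply Rmin_glb_lt; auto|]. intros g [<-|Hg] t Ht.
    + rewrite phi_conj by auto. apply E'. lra.
    + apply E; auto. lra.
Qed.

(* A compactly supported element pushed towards the end where [phi h] is trivial commutes with
   any prescribed finite set of conjugates of [phi h]. *)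
Lemma one_sided_triv h : H h -> triv_right (phi h) p \/ triv_left (phi h) q -> lam h 0 \/ rho h 0.
Proof.
  intros Hh T. apply NNPP. intros Hno.
  destruct (centralizer_trivial h) as (l & Hl & Hc); auto.
  assert (HG := subgroup_gen X HX).
  destruct compact_support as (w1 & c & d & Hw1 & Hne & Hcq & Hdq & Hw).
  (* If [r] separates the image of a conjugate of [w1] from the images of all listed conjugates of
     [h], that conjugate commutes with all of them and is trivial by the choice of [l],
     contradicting [w1 <> idf]. *)
  assert (Fin : forall u r, H u -> p <= r <= q ->
     ((forall t, r <= t <= q -> phi (conjf u w1) t = t) /\
       (forall f, In f l -> forall t, p <= t <= r -> phi (conjf f h) t = t)) \/
     ((forall t, p <= t <= r -> phi (conjf u w1) t = t) /\
       (forall f, In f l -> forall t, r <= t <= q -> phi (conjf f h) t = t)) -> False).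
  { intros u r Hu Hr D. apply Hne. assert (Pu := subgroup_hp _ _ HH Hu).
    assert (Hz : H (conjf u w1)) by now apply subgroup_conj.
    apply (conj_nontrivial u); auto. apply Hc; auto. intros f Hf.
    assert (Hk : H (conjf f h)) by (apply subgroup_conj; auto).
    destruct (fixpq _ (phi_gen _ Hz)) as (zp & zq). destruct (fixpq _ (phi_gen _ Hk)) as (kp & kq).
    apply commute_faithful; auto. intros t Ht. destruct D as [(D1 & D2)|(D1 & D2)].
    - apply (disjoint_commute p q r); auto; now apply phi_hp.
    - symmetry. apply (disjoint_commute p q r); auto; now apply phi_hp. }
  destruct T as [T|T].
  - destruct (triv_right_list l h Hh Hl T) as (e & He & E).
    set (r := p + Rmin e (q - p)).
    assert (A := Rmin_l e (q - p)). assert (B := Rmin_r e (q - p)).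
    assert (0 < Rmin e (q - p)) by (apply Rmin_glb_lt; lra).
    destruct (pushp d r) as (g & Hg & Lg); try (unfold r; lra).
    destruct (lift_conj g w1 Hg Hw1) as (u & Hu & Eu). assert (Pg := subgroup_hp _ _ HG Hg).
    destruct (fixpq g Hg) as (gp & gq).
    apply (Fin u r); auto; [unfold r; lra|]. left. split.
    + intros t Ht. rewrite Eu. rewrite <- (finv_r g t) by auto. rewrite conj_app by auto. f_equal.
      apply Hw. right. split; apply (hp_le_inv g); auto; rewrite finv_r by auto; lra.
    + intros f Hf t Ht. apply E; auto. unfold r in Ht. lra.
  - destruct (triv_left_list l h Hh Hl T) as (e & He & E).
    set (r := q - Rmin e (q - p)).
    assert (A := Rmin_l e (q - p)). assert (B := Rmin_r e (q - p)).
    assert (0 < Rmin e (q - p)) by (apply Rmin_glb_lt; lra).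
    destruct (pushq c r) as (g & Hg & Lg); try (unfold r; lra).
    destruct (lift_conj g w1 Hg Hw1) as (u & Hu & Eu). assert (Pg := subgroup_hp _ _ HG Hg).
    destruct (fixpq g Hg) as (gp & gq).
    apply (Fin u r); auto; [unfold r; lra|]. right. split.
    + intros t Ht. rewrite Eu. rewrite <- (finv_r g t) by auto. rewrite conj_app by auto. f_equal.
      apply Hw. left. split; apply (hp_le_inv g); auto; rewrite finv_r by auto; lra.
    + intros f Hf t Ht. apply E; auto. unfold r in Ht. lra.
Qed.

(** As [phi k] is trivial at both ends, [k] itself plays the role of the compactly supported
    element: a conjugate of it, pushed towards [p], commutes with [k] and with [conjf f k]. If [k]
    had a nontrivial germ at 0, the one-sided centralizer result would make this conjugate trivial
    near 0; but conjugation in [F] preserves the slope at 0. The same push serves at 1. *)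
Lemma two_sided_triv k : H k -> triv_right (phi k) p -> triv_left (phi k) q -> Fc k.
Proof.
  intros Hk Tr Tl. assert (HG := subgroup_gen X HX).
  assert (Push : forall f, Fc f -> exists u, H u /\ commute (conjf u k) k /\ commute (conjf u k) (conjf f k)).
  { intros f Hf. assert (Hf' := HFc _ Hf).
    destruct (triv_right_list [idf; f] k Hk) as (e & He & E); auto.
    { intros g [<-|[<-|[]]]; auto. apply subgroup_id, subgroup_Fc. }
    destruct Tl as (e' & He' & E').
    set (r := p + Rmin e (q - p)).
    assert (A := Rmin_l e (q - p)). assert (B := Rmin_r e (q - p)).
    assert (0 < Rmin e (q - p)) by (apply Rmin_glb_lt; lra).
    destruct (pushp (q - e') r) as (g & Hg & Lg); try (unfold r; lra).
    destruct (lift_conj g k Hg Hk) as (u & Hu & Eu). assert (Pg := subgroup_hp _ _ HG Hg).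
    destruct (fixpq g Hg) as (gp & gq).
    assert (Hz : H (conjf u k)) by now apply subgroup_conj.
    assert (Z : forall t, r <= t <= q -> phi (conjf u k) t = t).
    { intros t Ht. rewrite Eu. rewrite <- (finv_r g t) by auto. rewrite conj_app by auto. f_equal.
      apply E'. split; apply (hp_le_inv g); auto; rewrite finv_r by auto; lra. }
    assert (C : forall g, In g [idf; f] -> commute (conjf u k) (conjf g k)).
    { intros g' Hg'.
      assert (Hk' : H (conjf g' k)).
      { apply subgroup_conj; auto. destruct Hg' as [<-|[<-|[]]]; auto. now apply subgroup_id. }
      destruct (fixpq _ (phi_gen _ Hz)) as (zp & zq). destruct (fixpq _ (phi_gen _ Hk')) as (kp & kq).
      apply commute_faithful; auto. apply (disjoint_commute p q r); auto.
      1,2: now apply phi_hp. 1: unfold r; lra.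
      intros t Ht. apply E; auto. unfold r in Ht. lra. }
    exists u. split; auto. split; [rewrite <- (conj_id k) at 2|]; apply C; simpl; auto. }
  apply Fc_iff. split; auto. split; apply NNPP; intros Hn.
  - destruct (centralizer_left k) as (f & e & Hf & He & Hz); auto.
    destruct (Push f Hf) as (u & Hu & C1 & C2).
    assert (HFu := HHF _ Hu). assert (Pu := thompsonF_hp _ HFu).
    assert (Fz : thompsonF (conjf u k)) by (apply HHF; now apply subgroup_conj).
    apply Hn. rewrite <- (conj_finvK u k) by auto. apply lam_conj.
    { apply subgroup_finv; auto. apply subgroup_thompsonF. }
    apply lam_zero; [now apply thompsonF_hp|]. exists e. split; [lra|]. apply Hz; auto.
  - destruct (centralizer_right k) as (f & e & Hf & He & Hz); auto.
    destruct (Push f Hf) as (u & Hu & C1 & C2).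
    assert (HFu := HHF _ Hu). assert (Pu := thompsonF_hp _ HFu).
    assert (Fz : thompsonF (conjf u k)) by (apply HHF; now apply subgroup_conj).
    apply Hn. rewrite <- (conj_finvK u k) by auto. apply rho_conj.
    { apply subgroup_finv; auto. apply subgroup_thompsonF. }
    apply rho_zero; [now apply thompsonF_hp|]. exists (1 - e). split; [lra|].
    intros t Ht. apply Hz; auto. lra.
Qed.

Lemma generator_germs h : H h -> X (phi h) -> lam h 0 \/ rho h 0.
Proof.
  intros Hh HXh. destruct (classic (triv_right (phi h) p \/ triv_left (phi h) q)) as [T|T];
    [now apply one_sided_triv|].
  exfalso. apply not_or_and in T. destruct T as [T1 T2].
  destruct (lam_exists h (HHF _ Hh)) as (u & Hu). destruct (rho_exists h (HHF _ Hh)) as (v & Hv).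
  (* All other generators are in [Fc], so the germs of [H] at 0 and 1 are proportional to those of
     [h], although [H] has finite index. *)
  assert (S : subset H (fun f => homeo_plus f /\ exists a b, lam f a /\ rho f b /\ (a * v = b * u)%Z)).
  { apply phi_generation.
    - apply subgroup_intro.
      + now intros f (K & _).
      + split; [apply hp_id|]. exists 0%Z, 0%Z. split; [apply lam_id|]. split; [apply rho_id|lia].
      + intros f g (F1 & a & b & F2 & F3 & F4) (G1 & a' & b' & G2 & G3 & G4).
        split; [now apply hp_comp|]. exists (a + a')%Z, (b + b')%Z.
        split; [now apply lam_comp|]. split; [now apply rho_comp|lia].
      + intros f (F1 & a & b & F2 & F3 & F4). split; [now apply hp_finv|].
        exists (- a)%Z, (- b)%Z. split; [now apply lam_finv|]. split; [now apply rho_finv|lia].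
    - intros k Hk HXk. split; [now apply (subgroup_hp H)|].
      destruct (classic (k = h)) as [->|Hkh]; [exists u, v; repeat split; auto; lia|].
      assert (Hphi : phi k <> phi h) by (intros E; apply Hkh; auto).
      assert (Fk : Fc k).
      { apply two_sided_triv; auto; apply NNPP; intros K; apply Hphi;
        [now apply unique_right|now apply unique_left]. }
      apply Fc_iff in Fk. destruct Fk as (_ & L & R0). exists 0%Z, 0%Z. auto. }
  (* [xn 1] has exponents 0 at 0 and 1 at 1, its reflection the opposite. Their [M]-th powers lie in
     [H] with exponents [(0, M)] and [(M, 0)]; both are proportional to [(u, v)] only if
     [u = v = 0]. *)
  assert (Ha : thompsonF (flip (xn 1))) by apply flip_F, xn_F.
  assert (Hb := xn_F 1).
  destruct (S _ (H_pow _ Hb)) as (_ & a & b & L1 & R1 & E1).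
  destruct (S _ (H_pow _ Ha)) as (_ & a' & b' & L2 & R2 & E2).
  assert (a = Z.of_nat M * 0)%Z by (apply (lam_unique _ _ _ L1), lam_fpow, (lam_xn 1)).
  assert (b = Z.of_nat M * 1)%Z by (apply (rho_unique _ _ _ R1), rho_fpow, (rho_xn 1)).
  assert (a' = Z.of_nat M * 1)%Z by (apply (lam_unique _ _ _ L2), lam_fpow, flip_lam, (rho_xn 1)).
  assert (b' = Z.of_nat M * 0)%Z by (apply (rho_unique _ _ _ R2), rho_fpow, flip_rho, (lam_xn 1)).
  assert (u = 0%Z) by nia. subst u.
  assert (v = 0%Z) by nia. subst v.
  assert (Fh : Fc h) by (apply Fc_iff; auto).
  assert (FX : forall x, X x -> x p = p /\ x q = q) by (intros; apply fixpq; now apply gen_incl).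
  apply T1.
  (* Now [h] is in [Fc]. Images of commutators are trivial near [p], so by perfectness the image of
     all of [Fc] is, in contradiction to the choice of [h]. *)
  assert (SK : subset Fc (fun k => H k /\ triv_right (phi k) p)).
  { apply Fc_perfect.
    - apply subgroup_intro.
      + intros f (K & _). now apply (subgroup_hp H).
      + split; [now apply subgroup_id|]. rewrite phi_id. exists 1. split; [lra|reflexivity].
      + intros f g (F1 & e & He & F2) (G1 & e' & He' & G2). split; [apply subgroup_comp; auto|].
        rewrite phi_comp by auto. exists (Rmin e e').
        assert (A := Rmin_l e e'). assert (B := Rmin_r e e').
        split; [apply Rmin_glb_lt; auto|]. intros t Ht. unfold comp. rewrite G2 by lra. apply F2. lra.
      + intros f (F1 & e & He & F2). split; [now apply subgroup_finv|]. rewrite phi_finv by auto.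
        exists e. split; auto. intros t Ht. apply finv_unique; auto. now apply phi_hp.
    - intros a0 b0 Ha0 Hb0. split; [apply subgroup_commf; auto|]. rewrite phi_commf by auto.
      apply (commutator_triv_right X); auto; [apply FX|apply unique_right]. }
  apply SK; auto.
Qed.

End Orbital.

Lemma generators_one_sided h : H h -> X (phi h) -> lam h 0 \/ rho h 0.
Proof.
  destruct faithful_orbital as (p & q & H1 & H2 & H3 & H4 & H5 & H6 & H7).
  now apply (generator_germs p q).
Qed.

(** In a word over the generators, replace those with trivial germ at 0 by the identity. The germ at
    0 is unchanged, and every generator that remains has trivial germ at 1. Hence the pairs of
    exponents occurring in [H] form the product of their two projections. *)
Lemma germ_split h k : H h -> lam h k -> exists h1, H h1 /\ lam h1 k /\ rho h1 0.
Proof.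
  intros Hh Hk.
  assert (S : subset H (fun f => homeo_plus f /\ exists f1 a, H f1 /\ lam f a /\ lam f1 a /\ rho f1 0)).
  { apply phi_generation.
    - apply subgroup_intro.
      + now intros f (K & _).
      + split; [apply hp_id|]. exists idf, 0%Z. split; [now apply subgroup_id|].
        split; [apply lam_id|]. split; [apply lam_id|apply rho_id].
      + intros f g (F1 & f1 & a & F2 & F3 & F4 & F5) (G1 & g1 & b & G2 & G3 & G4 & G5).
        split; [now apply hp_comp|]. exists (comp f1 g1), (a + b)%Z.
        split; [apply subgroup_comp; auto|]. split; [now apply lam_comp|].
        split; [now apply lam_comp|now apply (rho_comp _ _ 0 0)].
      + intros f (F1 & f1 & a & F2 & F3 & F4 & F5). split; [now apply hp_finv|].
        assert (P1 := subgroup_hp _ _ HH F2).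
        exists (finv f1), (- a)%Z. split; [now apply subgroup_finv|]. split; [now apply lam_finv|].
        split; [now apply lam_finv|now apply (rho_finv _ 0)].
    - intros f Hf HXf. split; [now apply (subgroup_hp H)|].
      destruct (generators_one_sided f Hf HXf) as [L|L].
      + exists idf, 0%Z. split; [now apply subgroup_id|]. split; auto. split; [apply lam_id|apply rho_id].
      + destruct (lam_exists f (HHF _ Hf)) as (a & Ha). exists f, a. auto. }
  destruct (S h Hh) as (_ & h1 & a & K1 & K2 & K3 & K4). exists h1.
  rewrite (lam_unique _ _ _ Hk K2). auto.
Qed.

End Isomorphism.

(** * Rescaling germs at the endpoints *)

Record breaks (u : nat -> R) : Prop := {
  breaks_0 : u 0%nat = 1/2;
  breaks_decr : forall i, u (S i) < u i;
  breaks_pos : forall i, 0 < u i;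
  breaks_lim : forall e, 0 < e -> exists i, u i < e }.

Lemma breaks_le u i j : breaks u -> (i <= j)%nat -> u j <= u i.
Proof. intros Hu. induction 1; [lra|]. assert (A := breaks_decr u Hu m). lra. Qed.

Lemma breaks_index u t : breaks u -> 0 < t <= 1/2 -> exists i, u (S i) < t <= u i.
Proof.
  intros Hu Ht. destruct (breaks_lim u Hu t ltac:(lra)) as (n & Hn).
  induction n.
  - rewrite breaks_0 in Hn by auto. lra.
  - destruct (Rlt_dec (u n) t) as [L|L]; auto. exists n. lra.
Qed.

(** The piecewise linear map taking the break points [u i], which accumulate at 0, to the [v i]. The
    index is chosen by [epsilon]; half-open cells make it unique. *)
Definition interp (u v : nat -> R) (t : R) : R :=
  if Rle_dec t 0 then t else if Rle_dec (1/2) t then t else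
  let i := epsilon (inhabits 0%nat) (fun i => u (S i) < t <= u i) in
  v (S i) + (t - u (S i)) * ((v i - v (S i)) / (u i - u (S i))).

Lemma interp_on u v i t : breaks u -> breaks v -> u (S i) <= t <= u i ->
  interp u v t = v (S i) + (t - u (S i)) * ((v i - v (S i)) / (u i - u (S i))).
Proof.
  intros Hu Hv Ht. unfold interp.
  assert (P := breaks_pos u Hu (S i)). assert (D := breaks_decr u Hu i).
  assert (L := breaks_le u 0 i Hu ltac:(lia)). rewrite breaks_0 in L by auto.
  destruct Rle_dec as [A|A]; [lra|]. destruct Rle_dec as [B|B].
  - assert (i = 0%nat).
    { destruct i; auto. exfalso. assert (K := breaks_decr u Hu 0). rewrite breaks_0 in K by auto.
      assert (K' := breaks_le u 1 (S i) Hu ltac:(lia)). lra. }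
    subst i. assert (E : t = u 0%nat) by (rewrite breaks_0 in * by auto; lra).
    replace (v 1%nat + (t - u 1%nat) * ((v 0%nat - v 1%nat) / (u 0%nat - u 1%nat))) with (v 0%nat).
    + rewrite E. now rewrite !breaks_0.
    + rewrite E. field. lra.
  - assert (S1 : exists j, u (S j) < t <= u j) by (apply breaks_index; auto; lra).
    apply (epsilon_spec (inhabits 0%nat)) in S1. set (j := epsilon _ _) in *. cbv zeta.
    destruct (Nat.lt_trichotomy i j) as [K|[K|K]].
    (* Here [t] is the left end [u (S i)] of the given cell, so the chosen index is that of the next
       cell; both formulas give [v (S i)]. *)
    + assert (K1 := breaks_le u (S i) j Hu ltac:(lia)).
      assert (E : t = u (S i)) by lra.
      assert (j = S i).
      { destruct (Nat.eq_dec j (S i)); auto. exfalso.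
        assert (K2 := breaks_le u (S (S i)) j Hu ltac:(lia)). assert (K3 := breaks_decr u Hu (S i)). lra. }
      subst j. rewrite H, E. assert (K3 := breaks_decr u Hu (S i)). field. lra.
    + now rewrite K.
    + assert (K1 := breaks_le u (S j) i Hu ltac:(lia)). lra.
Qed.

Lemma interp_cell u v i t : breaks u -> breaks v -> u (S i) <= t <= u i ->
  v (S i) <= interp u v t <= v i.
Proof.
  intros Hu Hv Ht. rewrite (interp_on u v i) by auto.
  assert (D := breaks_decr u Hu i). assert (D' := breaks_decr v Hv i).
  set (x := (t - u (S i)) / (u i - u (S i))).
  replace ((t - u (S i)) * ((v i - v (S i)) / (u i - u (S i)))) with (x * (v i - v (S i)))
    by (unfold x; field; lra).
  assert (Ex : x * (u i - u (S i)) = t - u (S i)) by (unfold x; field; lra).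
  assert (0 <= x <= 1) by nra. nra.
Qed.

Lemma interp_out u v t : t <= 0 \/ 1/2 <= t -> interp u v t = t.
Proof. intros Ht. unfold interp. repeat destruct Rle_dec; auto; lra. Qed.

Lemma interp_inv u v t : breaks u -> breaks v -> interp v u (interp u v t) = t.
Proof.
  intros Hu Hv.
  destruct (Rle_dec t 0); [rewrite (interp_out u v t) by auto; apply interp_out; auto|].
  destruct (Rle_dec (1/2) t); [rewrite (interp_out u v t) by auto; apply interp_out; auto|].
  destruct (breaks_index u t Hu ltac:(lra)) as (i & Hi).
  rewrite (interp_on v u i); auto.
  - rewrite (interp_on u v i) by (auto; lra).
    assert (D := breaks_decr u Hu i). assert (D' := breaks_decr v Hv i). field. lra.
  - apply interp_cell; auto; lra.
Qed.

Lemma interp_hp u v : breaks u -> breaks v -> homeo_plus (interp u v).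
Proof.
  intros Hu Hv.
  assert (Hr : forall t, 0 < t < 1/2 -> 0 < interp u v t <= 1/2).
  { intros t Ht. destruct (breaks_index u t Hu ltac:(lra)) as (i & Hi).
    assert (A := interp_cell u v i t Hu Hv ltac:(lra)). assert (B := breaks_pos v Hv (S i)).
    assert (C := breaks_le v 0 i Hv ltac:(lia)). rewrite breaks_0 in C by auto. lra. }
  apply hp_intro.
  - assert (W : forall s t, s < t -> interp u v s <= interp u v t).
    { intros s t st.
      destruct (Rle_dec s 0); [rewrite (interp_out u v s) by auto|
      destruct (Rle_dec (1/2) s); [rewrite (interp_out u v s) by auto|]];
      (destruct (Rle_dec t 0); [rewrite (interp_out u v t) by auto|
      destruct (Rle_dec (1/2) t); [rewrite (interp_out u v t) by auto|]]); try lra.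
      - specialize (Hr t ltac:(lra)). lra.
      - specialize (Hr s ltac:(lra)). lra.
      - destruct (breaks_index u s Hu ltac:(lra)) as (i & Hi).
        destruct (breaks_index u t Hu ltac:(lra)) as (j & Hj).
        assert (A := interp_cell u v i s Hu Hv ltac:(lra)).
        assert (B := interp_cell u v j t Hu Hv ltac:(lra)).
        destruct (Nat.lt_trichotomy i j) as [K|[K|K]].
        + assert (K1 := breaks_le u (S i) j Hu ltac:(lia)). lra.
        + subst j. rewrite !(interp_on u v i) by (auto; lra). apply Rplus_le_compat_l.
          assert (D := breaks_decr u Hu i). assert (D' := breaks_decr v Hv i).
          apply Rmult_le_compat_r; [|lra]. left. apply Rdiv_lt_0_compat; lra.
        + assert (K1 := breaks_le v (S j) i Hv ltac:(lia)). lra. }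
    intros s t st. destruct (W s t st) as [L|L]; auto. exfalso.
    rewrite <- (interp_inv u v s), <- (interp_inv u v t) in st by auto. rewrite L in st. lra.
  - intros y. exists (interp v u y). now apply interp_inv.
  - intros t Ht. apply interp_out. lra.
Qed.

Lemma interp_PLat u v t : breaks u -> breaks v ->
  (forall i, dyadic (u i)) -> (forall i, dyadic (v i)) ->
  (forall i, exists k, (v i - v (S i)) / (u i - u (S i)) = p2 k) ->
  t <> 0 -> PLat (interp u v) t.
Proof.
  intros Hu Hv Du Dv Hk Ht. assert (Hp := interp_hp u v Hu Hv).
  destruct (Rlt_dec t 0); [apply PLat_outside; auto|].
  destruct (Rlt_dec (1/2) t).
  { apply (PLat_affine _ _ 0 0 (t - 1/2)); [lra|apply (dyadic_IZR 0)|].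
    intros s Hs. rewrite interp_out by lra. simpl. lra. }
  assert (Aff : forall i, exists k c, dyadic c /\
     forall s, u (S i) <= s <= u i -> interp u v s = p2 k * s + c).
  { intros i. destruct (Hk i) as (k & Ek). exists k, (v (S i) - p2 k * u (S i)).
    assert (D1 := Du (S i)). assert (D2 := Dv (S i)). split; [dyad|].
    intros s Hs. rewrite (interp_on u v i) by auto. rewrite Ek. ring. }
  destruct (breaks_index u t Hu ltac:(lra)) as (i & Hi).
  destruct (Aff i) as (k & c & Dc & Hc).
  destruct (Req_dec t (u i)) as [Et|Et].
  - assert (exists k c, dyadic c /\ rgerm (interp u v) t k c) as (k' & c' & Dc' & Hc').
    { destruct i.
      - exists 0%Z, 0. split; [apply (dyadic_IZR 0)|]. exists 1. split; [lra|].
        intros s Hs. rewrite breaks_0 in Et by auto. rewrite interp_out by lra. simpl. lra.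
      - destruct (Aff i) as (k' & c' & Dc' & Hc'). exists k', c'. split; auto.
        assert (D := breaks_decr u Hu i). exists (u i - u (S i)). split; [lra|].
        intros s Hs. apply Hc'. lra. }
    exists k', c', k, c. split; auto. split; auto. split; auto. split.
    + exists (u i - u (S i)). split; [lra|]. intros s Hs. apply Hc. lra.
    + left. rewrite Et. auto.
  - assert (A := Rmin_l (t - u (S i)) (u i - t)). assert (B := Rmin_r (t - u (S i)) (u i - t)).
    apply (PLat_affine _ _ k c (Rmin (t - u (S i)) (u i - t))); auto.
    + apply Rmin_glb_lt; lra.
    + intros s Hs. apply Hc. lra.
Qed.

Lemma half_pow n : (1/2) ^ n = p2 (- Z.of_nat n).
Proof.
  replace (1/2) with (/ 2) by field. rewrite pow_inv.
  assert (Q := p2_oppl (Z.of_nat n)). rewrite <- pow_powerRZ in Q. assert (P := pow2_pos n).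
  apply (Rmult_eq_reg_r (2 ^ n)); [|lra]. rewrite Q. field. lra.
Qed.

Lemma half_pow_lim e : 0 < e -> exists n, (1/2) ^ n < e.
Proof.
  intros He. destruct (pow2_large (/ e)) as (n & Hn). exists n.
  replace (1/2) with (/ 2) by field. rewrite pow_inv. rewrite <- (Rinv_inv e).
  apply Rinv_lt_contravar; auto. apply Rmult_lt_0_compat; [now apply Rinv_0_lt_compat|apply pow2_pos].
Qed.

Definition ubreak (i : nat) : R := (1/2) ^ (S i).

(* On each block of [a] steps the values halve once, in steps whose lengths are powers of 2. *)
Definition vbreak (a i : nat) : R := (1/2) ^ (i / a) * ((1 + (1/2) ^ (i mod a)) / 4).

Lemma ubreak_breaks : breaks ubreak.
Proof.
  split; unfold ubreak.
  - simpl; lra.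
  - intros i. assert (0 < (1/2) ^ (S i)) by (apply pow_lt; lra).
    change ((1/2) ^ S (S i)) with ((1/2) * (1/2) ^ S i). lra.
  - intros i. apply pow_lt; lra.
  - intros e He. destruct (half_pow_lim e He) as (n & Hn). exists n.
    assert (0 < (1/2) ^ n) by (apply pow_lt; lra). simpl. lra.
Qed.

Lemma vbreak_step a i : (0 < a)%nat -> exists k, vbreak a i - vbreak a (S i) = p2 k.
Proof.
  intros Ha. unfold vbreak.
  assert (E := Nat.div_mod i a ltac:(lia)). assert (L := Nat.mod_upper_bound i a ltac:(lia)).
  set (q := (i / a)%nat) in *. set (r := (i mod a)%nat) in *.
  destruct (Nat.eq_dec (S r) a) as [Er|Er].
  - assert (Eq : (S i / a = S q)%nat).
    { symmetry. apply (Nat.div_unique (S i) a (S q) 0); lia. }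
    assert (Em : (S i mod a = 0)%nat).
    { symmetry. apply (Nat.mod_unique (S i) a (S q) 0); lia. }
    (* Within a block the values approach [(1/2)^q / 4]. At its end they jump to this limit, so the
       last gap [(1/2)^q * (1/2)^r / 4] is again a power of 2. *)
    rewrite Eq, Em. exists (- Z.of_nat (q + r + 2))%Z. rewrite <- half_pow, !pow_add. simpl. field.
  - assert (Eq : (S i / a = q)%nat).
    { symmetry. apply (Nat.div_unique (S i) a q (S r)); lia. }
    assert (Em : (S i mod a = S r)%nat).
    { symmetry. apply (Nat.mod_unique (S i) a q (S r)); lia. }
    rewrite Eq, Em. exists (- Z.of_nat (q + r + 3))%Z. rewrite <- half_pow, !pow_add. simpl. field.
Qed.

Lemma vbreak_breaks a : (0 < a)%nat -> breaks (vbreak a).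
Proof.
  intros Ha. split.
  - unfold vbreak. rewrite Nat.Div0.div_0_l, Nat.Div0.mod_0_l. simpl. field.
  - intros i. destruct (vbreak_step a i Ha) as (k & E). assert (P := p2_pos k). lra.
  - intros i. unfold vbreak. apply Rmult_lt_0_compat; [apply pow_lt; lra|].
    assert (0 < (1/2) ^ (i mod a)) by (apply pow_lt; lra). lra.
  - intros e He. destruct (half_pow_lim e He) as (n & Hn). exists (n * a)%nat. unfold vbreak.
    rewrite Nat.div_mul, Nat.Div0.mod_mul by lia. simpl.
    assert (0 < (1/2) ^ n) by (apply pow_lt; lra). lra.
Qed.

Lemma vbreak_shift a i : (0 < a)%nat -> vbreak a (i + a) = vbreak a i / 2.
Proof.
  intros Ha. unfold vbreak. replace (i + a)%nat with (i + 1 * a)%nat by lia.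
  rewrite Nat.div_add, Nat.Div0.mod_add by lia. rewrite pow_add. simpl. field.
Qed.

Lemma ubreak_shift a i : ubreak (i + a) = p2 (- Z.of_nat a) * ubreak i.
Proof.
  rewrite <- half_pow. unfold ubreak. rewrite <- pow_add. f_equal. lia.
Qed.

(* Conjugation by [rescale a] turns the germ [2^a] at 0 into the germ [2]. *)
Definition rescale (a : nat) : R -> R := interp ubreak (vbreak a).

Lemma rescale_hp a : (0 < a)%nat -> homeo_plus (rescale a).
Proof. intros Ha. apply interp_hp; [apply ubreak_breaks|now apply vbreak_breaks]. Qed.

Lemma rescale_PLat a t : (0 < a)%nat -> t <> 0 -> PLat (rescale a) t.
Proof.
  intros Ha Ht. assert (Hv := vbreak_breaks a Ha). assert (Hu := ubreak_breaks).
  assert (Dh : forall n, dyadic ((1/2) ^ n)) by (intros; rewrite half_pow; apply dyadic_p2).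
  assert (D1 := dyadic_IZR 1).
  apply interp_PLat; auto.
  - intros i. apply Dh.
  - intros i. unfold vbreak. apply dyadic_mult; auto.
    replace ((1 + (1 / 2) ^ (i mod a)) / 4) with ((1 + (1 / 2) ^ (i mod a)) / 2 / 2) by field.
    apply dyadic_half, dyadic_half, dyadic_plus; auto.
  - intros i. destruct (vbreak_step a i Ha) as (k & ->).
    (* The cell of [ubreak] has length [2^-(i + 2)]. *)
    exists (k + Z.of_nat (i + 2))%Z. rewrite p2_add. unfold ubreak.
    assert (Q := p2_oppl (Z.of_nat (i + 2))). rewrite <- half_pow in Q.
    assert (0 < (1/2) ^ i) by (apply pow_lt; lra).
    set (y := p2 (Z.of_nat (i + 2))) in *. rewrite pow_add in Q. simpl in Q |- *.
    set (z := (1/2) ^ i) in *.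
    replace (1 / 2 * z - 1 / 2 * (1 / 2 * z)) with (z / 4) by field.
    unfold Rdiv. f_equal. apply (Rmult_eq_reg_l (z / 4)); [|lra].
    unfold Rdiv. rewrite Rinv_r by lra. lra.
Qed.

(** Raising the index by [a] multiplies [ubreak] by [2^-a] and halves [vbreak]; affine interpolation
    on the cells inherits this. *)
Lemma rescale_half a t : (0 < a)%nat -> 0 <= t <= 1/2 -> rescale a (p2 (- Z.of_nat a) * t) = rescale a t / 2.
Proof.
  intros Ha Ht. assert (Hv := vbreak_breaks a Ha). assert (Hu := ubreak_breaks). unfold rescale.
  destruct (Req_dec t 0) as [->|Hne]; [rewrite Rmult_0_r, !interp_out by lra; lra|].
  destruct (breaks_index ubreak t Hu ltac:(lra)) as (i & Hi).
  assert (P := p2_pos (- Z.of_nat a)).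
  assert (E1 := ubreak_shift a i). assert (E2 := ubreak_shift a (S i)).
  assert (E3 := vbreak_shift a i Ha). assert (E4 := vbreak_shift a (S i) Ha).
  simpl Nat.add in E2, E4.
  rewrite (interp_on _ _ (i + a)); auto.
  - rewrite (interp_on _ _ i) by (auto; lra). rewrite E1, E2, E3, E4.
    assert (D := breaks_decr _ Hu i). set (y := p2 (- Z.of_nat a)) in *.
    assert (0 < y * (ubreak i - ubreak (S i))) by (apply Rmult_lt_0_compat; lra).
    field. repeat split; lra.
  - rewrite E1, E2. split; apply Rmult_le_compat_l; lra.
Qed.

(** Negative [m] by iterating [rescale_half]; positive [m] by reading the negative case backwards
    from the point [p2 (Z.of_nat a * m) * t], which must therefore stay in [[0, 1/2]]. *)
Lemma rescale_selfsim a m t : (0 < a)%nat -> 0 <= t <= 1/2 -> p2 (Z.of_nat a * m) * t <= 1/2 ->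
  rescale a (p2 (Z.of_nat a * m) * t) = p2 m * rescale a t.
Proof.
  intros Ha.
  assert (N : forall (n : nat) t, 0 <= t <= 1/2 ->
     0 <= p2 (Z.of_nat a * - Z.of_nat n) * t <= 1/2 /\
     rescale a (p2 (Z.of_nat a * - Z.of_nat n) * t) = p2 (- Z.of_nat n) * rescale a t).
  { induction n; intros s Hs.
    - simpl. rewrite Z.mul_0_r. simpl. rewrite !Rmult_1_l. split; auto.
    - destruct (IHn s Hs) as (I1 & I2).
      replace (p2 (Z.of_nat a * - Z.of_nat (S n)) * s) with
        (p2 (- Z.of_nat a) * (p2 (Z.of_nat a * - Z.of_nat n) * s)).
      + split.
        * assert (P := p2_pos (- Z.of_nat a)). assert (p2 (- Z.of_nat a) < p2 0) by (apply p2_lt; lia).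
          simpl in H. nra.
        * rewrite rescale_half by auto. rewrite I2.
          replace (- Z.of_nat (S n))%Z with (-1 + - Z.of_nat n)%Z by lia. rewrite p2_add. simpl. field.
      + rewrite <- Rmult_assoc, <- p2_add. do 2 f_equal. lia. }
  intros Ht Hm. destruct (Z.le_gt_cases 0 m) as [K|K].
  - assert (Em : m = Z.of_nat (Z.to_nat m)) by lia.
    set (y := p2 (Z.of_nat a * m) * t) in *.
    assert (Ey : p2 (Z.of_nat a * - m) * y = t).
    { unfold y. rewrite <- Rmult_assoc, <- p2_add.
      replace (Z.of_nat a * - m + Z.of_nat a * m)%Z with 0%Z by lia. simpl. ring. }
    assert (Hy : 0 <= y <= 1/2).
    { split; auto. apply Rmult_le_pos; [left; apply p2_pos|lra]. }
    destruct (N (Z.to_nat m) y Hy) as (_ & E). rewrite <- Em, Ey in E. rewrite E.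
    rewrite <- Rmult_assoc, <- p2_add. replace (m + - m)%Z with 0%Z by lia. simpl. ring.
  - assert (Em : m = (- Z.of_nat (Z.to_nat (- m)))%Z) by lia.
    destruct (N (Z.to_nat (- m)) t Ht) as (_ & E). now rewrite <- Em in E.
Qed.

(** Away from 0 the conjugating map has dyadic germs, so the conjugate does too; at 0 its germ is
    supplied by the hypothesis on [lam]. Near 1 the conjugating map is the identity and the germ of
    [f] is kept. *)
Lemma conj_locally_PL phi f m : homeo_plus phi -> (forall t, t <> 0 -> PLat phi t) ->
  (forall t, 1/2 <= t -> phi t = t) -> thompsonF f -> lam (conjf phi f) m ->
  thompsonF (conjf phi f) /\ forall k, rho f k -> rho (conjf phi f) k.
Proof.
  intros Hphi HPL Hid Hf Hl. assert (Hp := thompsonF_hp _ Hf).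
  assert (Hc : homeo_plus (conjf phi f)) by now apply hp_conj.
  assert (Hne : forall g t, homeo_plus g -> t <> 0 -> g t <> 0).
  { intros g t Hg Ht E. apply Ht. apply (hp_inj g); auto. rewrite E. symmetry. apply hp_out; auto. lra. }
  split.
  - apply thompsonF_iff. split; auto. intros t. destruct (Req_dec t 0) as [->|Ht].
    + exists m, 0, 0%Z, 0. assert (D0 := dyadic_IZR 0). repeat split; auto.
      exists 1. split; [lra|]. intros s Hs. rewrite hp_out by (auto; lra). simpl; lra.
    + assert (Hi := hp_finv _ Hphi). unfold conjf. apply PLat_comp; [apply PLat_comp|].
      * rewrite <- (finv_r phi t) by auto. apply PLat_inv; [|apply HPL; now apply Hne].
        intros s. now apply finv_l.
      * now apply thompsonF_PLat.
      * apply HPL. unfold comp. apply Hne; auto.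
  (* From [x] on, both [s] and [f s] are at least 1/2, where the conjugating map is the identity. *)
  - intros k (e & He & Hk). set (x := Rmax (1/2) (finv f (1/2))).
    assert (A := Rmax_l (1/2) (finv f (1/2))). assert (B := Rmax_r (1/2) (finv f (1/2))).
    assert (x < 1).
    { apply Rmax_lub_lt; [lra|]. apply (hp_lt_inv f); auto. rewrite finv_r by auto. rewrite (hp_out f 1) by (auto; lra). lra. }
    exists (Rmin e (1 - x)). assert (C := Rmin_l e (1 - x)). assert (D := Rmin_r e (1 - x)).
    split; [apply Rmin_glb_lt; lra|]. intros s Hs.
    assert (x <= s) by lra. unfold x in H0.
    assert (1/2 <= f s). { rewrite <- (finv_r f (1/2)) by auto. apply hp_le; auto. lra. }
    unfold conjf, comp. rewrite (finv_unique phi s s) by (auto; apply Hid; lra).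
    rewrite Hid by auto. apply Hk. lra.
Qed.

Lemma lam_rescale a f m : (0 < a)%nat -> thompsonF f -> lam f (Z.of_nat a * m) -> lam (conjf (rescale a) f) m.
Proof.
  intros Ha Hf (e & He & H). assert (Hp := rescale_hp a Ha).
  (* Below [x] the map [f] is linear, and both the point and its image [p2 (Z.of_nat a * m) * t]
     stay in [[0, 1/2]], as self-similarity requires. *)
  set (x := Rmin e (Rmin (1/2) (p2 (- (Z.of_nat a * m)) / 2))).
  assert (A := Rmin_l e (Rmin (1/2) (p2 (- (Z.of_nat a * m)) / 2))).
  assert (B := Rmin_r e (Rmin (1/2) (p2 (- (Z.of_nat a * m)) / 2))).
  assert (C := Rmin_l (1/2) (p2 (- (Z.of_nat a * m)) / 2)).
  assert (D := Rmin_r (1/2) (p2 (- (Z.of_nat a * m)) / 2)).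
  assert (P := p2_pos (- (Z.of_nat a * m))). assert (P' := p2_pos (Z.of_nat a * m)).
  assert (Q := p2_oppl (Z.of_nat a * m)).
  assert (0 < x) by (repeat apply Rmin_glb_lt; lra).
  assert (L : rescale a 0 < rescale a x) by (apply hp_incr; auto).
  rewrite (hp_out (rescale a) 0) in L by (auto; lra).
  exists (rescale a x). split; auto. intros s Hs. unfold conjf, comp.
  assert (Hs' : 0 <= finv (rescale a) s <= x).
  { split; apply (hp_le_inv (rescale a)); auto; rewrite finv_r by auto; [|lra].
    rewrite hp_out by (auto; lra). lra. }
  set (t := finv (rescale a) s) in *. fold x in A, B. rewrite H by lra. rewrite !Rplus_0_r.
  rewrite rescale_selfsim; auto; [|lra|].
  - unfold t. now rewrite finv_r.
  - assert (p2 (Z.of_nat a * m) * t <= p2 (Z.of_nat a * m) * (p2 (- (Z.of_nat a * m)) / 2))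
      by (apply Rmult_le_compat_l; lra). lra.
Qed.

Lemma lam_rescale_inv a f m : (0 < a)%nat -> thompsonF f -> lam f m ->
  lam (conjf (finv (rescale a)) f) (Z.of_nat a * m).
Proof.
  intros Ha Hf (e & He & H). assert (Hp := rescale_hp a Ha). assert (Hi := hp_finv _ Hp).
  assert (Hpf := thompsonF_hp _ Hf).
  set (y := Rmin (1/2) (p2 (- (Z.of_nat a * m)) / 2)).
  assert (C := Rmin_l (1/2) (p2 (- (Z.of_nat a * m)) / 2)).
  assert (D := Rmin_r (1/2) (p2 (- (Z.of_nat a * m)) / 2)).
  assert (P := p2_pos (- (Z.of_nat a * m))). assert (P' := p2_pos (Z.of_nat a * m)).
  assert (Q := p2_oppl (Z.of_nat a * m)).
  assert (0 < y) by (apply Rmin_glb_lt; lra).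
  assert (L : finv (rescale a) 0 < finv (rescale a) e) by (apply hp_incr; auto).
  rewrite (hp_out (finv (rescale a)) 0) in L by (auto; lra).
  set (x := Rmin y (finv (rescale a) e)).
  assert (A := Rmin_l y (finv (rescale a) e)). assert (B := Rmin_r y (finv (rescale a) e)).
  exists x. split; [apply Rmin_glb_lt; auto|]. intros t Ht. fold x in A, B. unfold y in A.
  unfold conjf. rewrite finv_finv by auto. unfold comp. apply finv_unique; auto.
  rewrite !Rplus_0_r. rewrite rescale_selfsim; auto; [|lra|].
  - rewrite H; [lra|]. split.
    + rewrite <- (hp_out (rescale a) 0) at 1 by (auto; lra). apply hp_le; auto; lra.
    + rewrite Rplus_0_l. rewrite <- (finv_r (rescale a) e) by auto. apply hp_le; auto; lra.
  - assert (p2 (Z.of_nat a * m) * t <= p2 (Z.of_nat a * m) * (p2 (- (Z.of_nat a * m)) / 2))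
      by (apply Rmult_le_compat_l; lra). lra.
Qed.

(** * Subgroups of [F] given by divisibility of the exponents at 0 and 1 *)

Definition germ_subgroup (a b : nat) (f : R -> R) : Prop :=
  thompsonF f /\ (exists m, lam f (Z.of_nat a * m)) /\ (exists n, rho f (Z.of_nat b * n)).

Lemma isomorphic_trans A B C : isomorphic A B -> isomorphic B C -> isomorphic A C.
Proof.
  intros (f & F1 & F2 & F3 & F4) (g & G1 & G2 & G3 & G4). exists (fun x => g (f x)).
  split; [|split; [|split]]; auto.
  - intros z Hz. destruct (G3 z Hz) as (y & Hy & <-). destruct (F3 y Hy) as (x & Hx & <-). now exists x.
  - intros x y Hx Hy. rewrite F4 by auto. auto.
Qed.

Lemma isomorphic_ext A B : (forall f, A f <-> B f) -> isomorphic A B.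
Proof.
  intros E. exists (fun f => f). split; [|split; [|split]]; auto.
  - intros f Hf. now apply E.
  - intros g Hg. exists g. split; auto. now apply E.
Qed.

Lemma germ_subgroup_iso_left a b : (0 < a)%nat -> isomorphic (germ_subgroup a b) (germ_subgroup 1 b).
Proof.
  intros Ha. assert (Hp := rescale_hp a Ha). assert (Hi := hp_finv _ Hp).
  assert (Hid : forall t, 1/2 <= t -> rescale a t = t) by (intros; apply interp_out; auto).
  exists (conjf (rescale a)). split; [|split; [|split]].
  - intros f (Hf & (m & Hm) & (n & Hn)). assert (L := lam_rescale a f m Ha Hf Hm).
    destruct (conj_locally_PL (rescale a) f m) as (F1 & F2); auto.
    { intros t Ht. now apply rescale_PLat. }
    split; auto. split; [exists m; now rewrite Z.mul_1_l|]. exists n. auto.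
  - intros f g _ _ E. rewrite <- (conj_finvK (rescale a) f), <- (conj_finvK (rescale a) g) by auto. now rewrite E.
  - intros g (Hg & (m & Hm) & (n & Hn)). rewrite Z.mul_1_l in Hm.
    assert (L := lam_rescale_inv a g m Ha Hg Hm).
    destruct (conj_locally_PL (finv (rescale a)) g (Z.of_nat a * m)) as (F1 & F2); auto.
    { intros t Ht. rewrite <- (finv_r (rescale a) t) by auto. apply PLat_inv.
      - intros s. now apply finv_l.
      - apply rescale_PLat; auto. intros E. apply Ht. rewrite <- (finv_r (rescale a) t), E by auto.
        apply hp_out; auto. lra. }
    { intros t Ht. apply finv_unique; auto. }
    exists (conjf (finv (rescale a)) g). split; [|now apply conj_Kfinv].
    split; auto. split; [now exists m|]. exists n. auto.
  - intros f g _ _. now apply conj_comp.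
Qed.

Lemma germ_subgroup_iso_flip a b : isomorphic (germ_subgroup a b) (germ_subgroup b a).
Proof.
  assert (F : forall a b f, germ_subgroup a b f -> germ_subgroup b a (flip f)).
  { intros a' b' f (Hf & (m & Hm) & (n & Hn)). split; [now apply flip_F|].
    split; [exists n; now apply flip_lam|exists m; now apply flip_rho]. }
  exists flip. split; [|split; [|split]]; auto.
  - intros f g _ _ E. rewrite <- (flip_flip f), <- (flip_flip g). now rewrite E.
  - intros g Hg. exists (flip g). split; auto. apply flip_flip.
  - intros f g _ _. apply flip_comp.
Qed.

(** Rescaling acts at 0 only, so the condition at 1 is first brought to 0 by a reflection. *)
Lemma germ_subgroup_iso_F a b : (0 < a)%nat -> (0 < b)%nat -> isomorphic (germ_subgroup a b) thompsonF.
Proof.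
  intros Ha Hb. apply (isomorphic_trans _ (germ_subgroup 1 b)); [now apply germ_subgroup_iso_left|].
  apply (isomorphic_trans _ (germ_subgroup b 1)); [apply germ_subgroup_iso_flip|].
  apply (isomorphic_trans _ (germ_subgroup 1 1)); [now apply germ_subgroup_iso_left|].
  apply isomorphic_ext. intros f. split; [intros (Hf & _); auto|].
  intros Hf. split; auto. split.
  - destruct (lam_exists f Hf) as (k & Hk). exists k. now rewrite Z.mul_1_l.
  - destruct (rho_exists f Hf) as (k & Hk). exists k. now rewrite Z.mul_1_l.
Qed.

Lemma Z_multiples (P : Z -> Prop) (a : Z) : P a -> (forall x y, P x -> P y -> P (x - y)%Z) ->
  forall z, P (a * z)%Z.
Proof.
  intros Pa Psub.
  assert (P0 : P 0%Z) by (replace 0%Z with (a - a)%Z by lia; auto).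
  assert (Popp : forall x, P x -> P (- x)%Z) by (intros x Px; apply (Psub 0%Z x); auto).
  assert (Pmul : forall n : nat, P (a * Z.of_nat n)%Z).
  { induction n; [now rewrite Z.mul_0_r|].
    replace (a * Z.of_nat (S n))%Z with (a * Z.of_nat n - - a)%Z by lia. auto. }
  intros z. destruct (Z.le_gt_cases 0 z).
  - rewrite <- (Z2Nat.id z) by lia. auto.
  - replace (a * z)%Z with (- (a * Z.of_nat (Z.to_nat (- z))))%Z by lia. auto.
Qed.

Lemma Z_subgroup_generator (P : Z -> Prop) (N : nat) : (0 < N)%nat -> P (Z.of_nat N) ->
  (forall x y, P x -> P y -> P (x - y)%Z) ->
  exists a, (0 < a)%nat /\ P (Z.of_nat a) /\ forall k, P k -> exists m, k = (Z.of_nat a * m)%Z.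
Proof.
  intros HN PN Psub.
  assert (exists a, (0 < a)%nat /\ P (Z.of_nat a) /\
     forall b, (0 < b)%nat -> P (Z.of_nat b) -> (a <= b)%nat) as (a & Ha & Pa & Hmin).
  { revert HN PN. induction N as [N IH] using (well_founded_induction lt_wf). intros HN PN.
    destruct (classic (exists b, (0 < b < N)%nat /\ P (Z.of_nat b))) as [(b & Hb & Pb)|Hno].
    - apply (IH b); auto; lia.
    - exists N. split; auto. split; auto. intros b Hb Pb. apply Nat.nlt_ge. intros K. apply Hno.
      exists b. auto. }
  exists a. split; auto. split; auto. intros k Pk.
  assert (PmulZ := Z_multiples P (Z.of_nat a) Pa Psub).
  exists (k / Z.of_nat a)%Z.
  assert (E := Z.div_mod k (Z.of_nat a) ltac:(lia)).
  assert (B := Z.mod_pos_bound k (Z.of_nat a) ltac:(lia)).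
  assert (Pr : P (k mod Z.of_nat a)%Z).
  { replace (k mod Z.of_nat a)%Z with (k - Z.of_nat a * (k / Z.of_nat a))%Z by lia. auto. }
  destruct (Z.eq_dec (k mod Z.of_nat a) 0) as [Z0|Z0]; [lia|].
  assert (K := Hmin (Z.to_nat (k mod Z.of_nat a)) ltac:(lia)). rewrite Z2Nat.id in K by lia.
  specialize (K Pr). lia.
Qed.

Theorem theorem1p6 :
  forall (H : (R -> R) -> Prop),
    is_subgroup H -> subset H thompsonF -> finite_index H thompsonF ->
  forall (X : (R -> R) -> Prop),
    subset X homeo_plus -> geometrically_proper X ->
    isomorphic H (gen X) ->
    isomorphic H thompsonF.
Proof.
  intros H HH HHF Hfi X HX Hgp (phi & P1 & P2 & P3 & P4).
  assert (HFc := finite_index_Fc H HH Hfi).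
  destruct (finite_index_power H HH Hfi) as (M & HM & Hpow).
  assert (HF := subgroup_thompsonF).
  assert (Split := germ_split H X phi M HH HHF HFc HM Hpow HX Hgp P1 P2 P3 P4).
  destruct (Z_subgroup_generator (fun k => exists h, H h /\ lam h k) M) as (a & Ha & Pa & Da); auto.
  (* The reflection of [xn 1] has slope 2 at 0, so [M] itself occurs as an exponent there. *)
  { exists (fpow (flip (xn 1)) M). split; [apply Hpow, flip_F, xn_F|].
    rewrite <- (Z.mul_1_r (Z.of_nat M)). apply lam_fpow, flip_lam, (rho_xn 1). }
  { intros x y (f & Hf & Lf) (g & Hg & Lg). exists (comp f (finv g)).
    split; [apply subgroup_comp; auto; now apply subgroup_finv|].
    apply (lam_comp _ _ x (- y)); auto. apply lam_finv; auto. now apply (subgroup_hp H). }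
  destruct (Z_subgroup_generator (fun k => exists h, H h /\ rho h k) M) as (b & Hb & Pb & Db); auto.
  { exists (fpow (xn 1) M). split; [apply Hpow, xn_F|].
    rewrite <- (Z.mul_1_r (Z.of_nat M)). apply rho_fpow, (rho_xn 1). }
  { intros x y (f & Hf & Lf) (g & Hg & Lg). exists (comp f (finv g)).
    split; [apply subgroup_comp; auto; now apply subgroup_finv|].
    apply (rho_comp _ _ x (- y)); auto. apply rho_finv; auto. now apply (subgroup_hp H). }
  apply (isomorphic_trans _ (germ_subgroup a b)); [|now apply germ_subgroup_iso_F].
  apply isomorphic_ext. intros f. split.
  { intros Hf. split; auto. split.
    - destruct (lam_exists f) as (k & Hk); auto. destruct (Da k) as (m & ->); [now exists f|]. now exists m.
    - destruct (rho_exists f) as (k & Hk); auto. destruct (Db k) as (m & ->); [now exists f|]. now exists m. }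
  intros (Hf & (m & Hm) & (n & Hn)).
  (* Exponents realized at 0 by elements trivial near 1 are closed under subtraction; splitting
     shows that [a] is one of them, hence so are all its multiples. *)
  assert (exists h1, H h1 /\ lam h1 (Z.of_nat a * m) /\ rho h1 0) as (h1 & H1 & L1 & R1).
  { apply (Z_multiples (fun k => exists h1, H h1 /\ lam h1 k /\ rho h1 0)).
    - destruct Pa as (h & Hh & Lh). now apply (Split h).
    - intros x y (u & Hu & Lu & Ru) (v & Hv & Lv & Rv). exists (comp u (finv v)).
      assert (Pv := subgroup_hp _ _ HH Hv).
      split; [apply subgroup_comp; auto; now apply subgroup_finv|].
      split; [apply (lam_comp _ _ x (- y)); auto; now apply lam_finv|].
      apply (rho_comp _ _ 0 0); auto. now apply (rho_finv _ 0). }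
  assert (exists h2, H h2 /\ lam h2 0 /\ rho h2 (Z.of_nat b * n)) as (h2 & H2 & L2 & R2).
  { apply (Z_multiples (fun k => exists h2, H h2 /\ lam h2 0 /\ rho h2 k)).
    - destruct Pb as (h & Hh & Rh). destruct (lam_exists h) as (k & Lh); auto.
      destruct (Split h k Hh Lh) as (g & Hg & Lg & Rg). assert (Pg := subgroup_hp _ _ HH Hg).
      (* [g] has the germ of [h] at 0 and a trivial germ at 1; dividing by it clears the germ of [h]
         at 0 and keeps that at 1. *)
      exists (comp (finv g) h). split; [apply subgroup_comp; auto; now apply subgroup_finv|].
      split.
      + replace 0%Z with (- k + k)%Z by lia. apply lam_comp; auto. now apply lam_finv.
      + apply (rho_comp _ _ 0 (Z.of_nat b)); auto. now apply (rho_finv _ 0).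
    - intros x y (u & Hu & Lu & Ru) (v & Hv & Lv & Rv). exists (comp u (finv v)).
      assert (Pv := subgroup_hp _ _ HH Hv).
      split; [apply subgroup_comp; auto; now apply subgroup_finv|].
      split; [apply (lam_comp _ _ 0 0); auto; now apply (lam_finv _ 0)|].
      apply (rho_comp _ _ x (- y)); auto. now apply rho_finv. }
  set (h := comp h1 h2). assert (Hh : H h) by (apply subgroup_comp; auto).
  assert (Lh : lam h (Z.of_nat a * m)) by (rewrite <- (Z.add_0_r (Z.of_nat a * m)); now apply lam_comp).
  assert (Rh : rho h (Z.of_nat b * n)) by now apply (rho_comp _ _ 0).
  assert (Ph := subgroup_hp _ _ HH Hh).
  (* [f] and [h] have the same germs at both ends, so they differ by an element of [Fc], which is
     contained in [H]. *)
  replace f with (comp h (comp (finv h) f)).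
  - apply subgroup_comp; auto. apply HFc. apply Fc_iff. split; [|split].
    + apply subgroup_comp; auto. apply subgroup_finv; auto.
    + replace 0%Z with (- (Z.of_nat a * m) + Z.of_nat a * m)%Z by lia.
      apply lam_comp; auto. now apply lam_finv.
    + replace 0%Z with (- (Z.of_nat b * n) + Z.of_nat b * n)%Z by lia.
      apply rho_comp; auto. now apply rho_finv.
  - apply functional_extensionality. intros t. unfold comp. now apply finv_r.
Qed.
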